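(* Let $\mathcal{X}$ and $\mathcal{Y}$ be countably generated LFCM spaces, and let $\Phi\colon\mathcal{A}(\mathcal{X})\to\mathcal{A}(\mathcal{Y})$ be a fully faithful $*$-functor. Suppose that $\mathcal{A}(\mathcal{X})$ contains a faithful $\mathcal{X}$-module and $\mathcal{A}(\mathcal{Y})$ contains a faithful $\mathcal{Y}$-module. Then there exists a coarse embedding $f^\Phi\colon\mathcal{X}\to\mathcal{Y}$, unique up to closeness, such that for any faithful $\mathcal{X}$-module $C$ in $\mathcal{A}(\mathcal{X})$, any unitary $U(C)\colon H_C\to H_{\Phi(C)}$ with $\Phi(t)=U(C)tU(C)^*$ for all $t\in\operatorname{End}_{\mathcal{A}(\mathcal{X})}(C)$, any $\delta\in(0,1)$, and all sufficiently large entourages $F\in\mathcal{E}^Y$ and $E\in\mathcal{E}^X$, the approximate relation $f^{U(C)}_{\delta,F,E}$ is close to $f^\Phi$. Furthermore, if $\Phi$ is a $*$-equivalence of categories, then $f^\Phi$ is a coarse equivalence.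
   Context: A coarse structure on a set $X$ is a family $\mathcal{E}^X$ of subsets of $X\times X$ (entourages) containing the diagonal and closed under subsets, finite unions, transposes and compositions; it is countably generated if it is the smallest coarse structure containing some countable family. $A\subset X$ is $E$-bounded if $A\times A\subset E$, bounded if it is $E$-bounded for some entourage $E$. With $E[A]=\{x\mid\exists a\in A:(x,a)\in E\}$, $A\prec B$ means $A\subset E[B]$ for some $E\in\mathcal{E}^X$; $A\asymp B$ means $A\prec B$ and $B\prec A$. $Y\times X$ carries the product coarse structure generated by $\mathcal{E}^Y\times\mathcal{E}^X$. $f\colon X\to Y$ is coarse if $(f\times f)(E)\in\mathcal{E}^Y$ for all $E\in\mathcal{E}^X$; coarse maps $f,g$ are close ($f\sim g$) if $(f\times g)(E)\in\mathcal{E}^Y$ for all $E\in\mathcal{E}^X$; $f$ is a coarse equivalence if there is a coarse $g$ with $f\circ g\sim\mathrm{id}$, $g\circ f\sim\mathrm{id}$; $f$ is a coarse embedding if it is a coarse equivalence onto its image with the induced coarse structure. A relation $R\subset Y\times X$ is called close to a coarse map $f$ if $R\asymp\{(f(x),x)\mid x\in X\}$ in $Y\times X$. A locally finite coarse measurable (LFCM) space is a triple $\mathcal{X}=(X,\mathcal{E}^X,\mathfrak{A}^X)$ with $(X,\mathcal{E}^X)$ a coarse space and $\mathfrak{A}^X$ a Boolean algebra of subsets of $X$ (the measurable sets) for which there is a partition $\{A_i\}_{i\in I}$ of $X$ (a discrete partition) by measurable sets such that every bounded set meets finitely many $A_i$, all $A_i$ are $E$-bounded for a common entourage $E$, and $B\in\mathfrak{A}^X$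 iff $B\cap A_i\in\mathfrak{A}^X$ for all $i$. A discrete partition is fixed and $E^X_{\mathrm{disc}}=\bigsqcup_iA_i\times A_i$. A coarse $\mathcal{X}$-module $C$ is a Hilbert space $H_C$ with a (unital) representation $A\mapsto\mathbb{1}^C_A$ of $\mathfrak{A}^X$ by projections on $H_C$ such that the span of $\{\mathbb{1}^C_AH_C\mid A\in\mathfrak{A}^X\text{ is }E^X_{\mathrm{disc}}\text{-bounded}\}$ is dense. Its rank is the Hilbert dimension of $H_C$. $C$ is faithful if $\bigcup\{A\in\mathfrak{A}^X\mid A\ E^X_{\mathrm{disc}}\text{-bounded},\ \mathbb{1}^C_A\neq0\}\asymp X$. The support of a bounded operator $t\colon H_C\to H_D$ between $\mathcal{X}$-modules is $\bigcup\{B\times A\mid A,B\in\mathfrak{A}^X\ E^X_{\mathrm{disc}}\text{-bounded},\ \mathbb{1}^D_Bt\mathbb{1}^C_A\ne0\}$; $t$ has controlled propagation if its support is an entourage, and is approximable if it is a norm limit of controlled propagation operators. For an infinite cardinal $\kappa$, $\mathcal{A}_\kappa(\mathcal{X})$ is the $C^*$-category of coarse $\mathcal{X}$-modules of rank at most $\kappa$ with approximable operators as morphisms; $\mathcal{A}_\infty(\mathcal{X})$ is the same without rank restriction. $\mathcal{A}(\cdot)$ denotes either $\mathcal{A}_\kappa(\cdot)$ for one fixed infinite $\kappa$, or $\mathcal{A}_\infty(\cdot)$, the same choice throughout. $*$-functors are $\mathbb{C}$-linear on morphisms and preserve adjoints; a $*$-equivalence is a $*$-functor that is an equivalence of categories.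 For a bounded $T\colon H_{C_X}\to H_{C_Y}$, the approximate relation is $f^T_{\delta,F,E}=\bigcup\{B\times A\mid B\in\mathfrak{A}^Y\ F\text{-bounded},\ A\in\mathfrak{A}^X\ E\text{-bounded},\ \|\mathbb{1}_B^{C_Y}T\mathbb{1}_A^{C_X}\|>\delta\}\subset Y\times X$. ''All sufficiently large $F,E$'' means all $F\supset F_0$, $E\supset E_0$ for some entourages $F_0,E_0$. It is known that every $*$-isomorphism $\operatorname{End}_{\mathcal{A}(\mathcal{X})}(C)\to\operatorname{End}_{\mathcal{A}(\mathcal{Y})}(\Phi(C))$ is $\operatorname{Ad}_U$ for some unitary $U\colon H_C\to H_{\Phi(C)}$. *)

(* Defs.v *)
From HB Require Import structures.
From mathcomp Require Import all_boot all_order all_algebra.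
From mathcomp Require Import complex.
From mathcomp Require Import all_classical all_reals all_analysis.

Set Implicit Arguments.
Unset Strict Implicit.
Unset Printing Implicit Defensive.

Import Order.TTheory GRing.Theory Num.Theory.
Import numFieldNormedType.Exports.
Import ComplexField.

Local Open Scope classical_set_scope.
Local Open Scope complex_scope.
Local Open Scope ring_scope.

Record is_coarse (X : Type) (EX : set (set (X * X))) : Prop := IsCoarse {
  coarse_diag : EX diagonal;
  coarse_sub : forall E F, E `<=` F -> EX F -> EX E;
  coarse_setU : setU_closed EX;
  coarse_inv : forall E, EX E -> EX (E^-1)%relation;
  coarse_comp : forall E F, EX E -> EX F -> EX (E \; F)%relation }.

Section Coarse.
Variables (X Y : Type) (EX : set (set (X * X))) (EY : set (set (Y * Y))).

Definition countably_generated :=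
  exists2 G : set (set (X * X)), countable G & EX = smallest (@is_coarse X) G.

Definition bounded_by (E : set (X * X)) (A : set X) := A `*` A `<=` E.

Definition coarsely_bounded (A : set X) := exists2 E, EX E & bounded_by E A.

Definition thickening (E : set (X * X)) (A : set X) : set X :=
  [set x | exists2 a, A a & E (x, a)].

Definition coarse_prec (A B : set X) :=
  exists2 E, EX E & A `<=` thickening E B.

Definition coarse_asymp (A B : set X) := coarse_prec A B /\ coarse_prec B A.

Definition map2 (f g : X -> Y) (E : set (X * X)) : set (Y * Y) :=
  [set (f p.1, g p.2) | p in E].

Definition coarse_map (f : X -> Y) := forall E, EX E -> EY (map2 f f E).

Definition coarse_close (f g : X -> Y) := forall E, EX E -> EY (map2 f g E).

Definition induced_coarse (A : set X) : set (set ({x | A x} * {x | A x})) :=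
  [set E | EX [set (sval p.1, sval p.2) | p in E]].

Definition corestrict (f : X -> Y) (x : X) : {y | range f y} :=
  exist _ (f x) (imageT f x).

Definition prod_entourage (F : set (Y * Y)) (E : set (X * X)) :
    set ((Y * X) * (Y * X)) :=
  [set p | F (p.1.1, p.2.1) /\ E (p.1.2, p.2.2)].

Definition prod_coarse : set (set ((Y * X) * (Y * X))) :=
  smallest (@is_coarse (Y * X)%type)
    [set Q | exists F E, [/\ EY F, EX E & Q = prod_entourage F E]].

End Coarse.

Section CoarseMaps.
Variables (X Y : Type) (EX : set (set (X * X))) (EY : set (set (Y * Y))).

Definition coarse_equivalence (f : X -> Y) :=
  coarse_map EX EY f /\
  exists g : Y -> X, [/\ coarse_map EY EX g,
    coarse_close EY EY (f \o g) id & coarse_close EX EX (g \o f) id].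

Definition relation_close (R : set (Y * X)) (f : X -> Y) :=
  coarse_asymp (prod_coarse EX EY) R [set (f x, x) | x in [set: X]].

End CoarseMaps.

Definition coarse_embedding (X Y : Type) (EX : set (set (X * X)))
    (EY : set (set (Y * Y))) (f : X -> Y) :=
  coarse_equivalence EX (induced_coarse EY (A := range f)) (corestrict f).

Record is_set_algebra (X : Type) (G : set (set X)) : Prop := IsSetAlgebra {
  algebra_setT : G setT;
  algebra_setC : setC_closed G;
  algebra_setU : setU_closed G }.

Record is_discrete_partition (X : Type) (EX : set (set (X * X)))
    (G : set (set X)) (I : Type) (A : I -> set X) : Prop :=
  IsDiscretePartition {
    disc_partition : partition setT A setT;
    disc_measurable : forall i, G (A i);
    disc_locally_finite : forall B, coarsely_bounded EX B ->
      finite_set [set i | B `&` A i !=set0];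
    disc_uniform : exists2 E, EX E & forall i, bounded_by E (A i);
    disc_local : forall B, G B <-> forall i, G (B `&` A i) }.

(* The discrete partition is fixed as part of the structure. *)
Record lfcm := LFCM {
  points :> Type;
  ent : set (set (points * points));
  ent_coarse : is_coarse ent;
  meas : set (set points);
  meas_algebra : is_set_algebra meas;
  disc_index : Type;
  disc : disc_index -> set points;
  disc_axiom : is_discrete_partition ent meas disc }.

Definition disc_ent (X : lfcm) : set (X * X) :=
  \bigcup_i (disc (l := X) i `*` disc i).
Arguments disc_ent : clear implicits.

Definition disc_meas (X : lfcm) : set (set X) :=
  [set A | meas A /\ bounded_by (disc_ent X) A].

Record hilbert (R : realType) := Hilbert {
  hcarrier :> completeNormedModType R[i];
  hdot : {dot hcarrier for (@Num.conj R[i])};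
  hdotE : forall x : hcarrier, `|x| ^+ 2 = hdot x x }.

Arguments hdot {R h}.

Record bop (R : realType) (H K : hilbert R) := Bop {
  bfun :> H -> K;
  bop_linear : linear bfun;
  bop_continuous : continuous bfun }.

Section Hilbert.
Variable R : realType.
Implicit Types H K L : hilbert R.

HB.instance Definition _ H K (t : bop H K) :=
  GRing.isLinear.Build R[i] H K *:%R (bfun t) (bop_linear t).

(* The norm of a vector is a nonnegative real element of R[i]; rnorm and opnorm
   take values in R. *)
Definition rnorm H (x : H) : R := complex.Re `|x|.

Definition opnorm H K (t : H -> K) : R :=
  sup [set rnorm (t x) | x in [set x : H | `|x| <= 1]].

(* [s] is the adjoint of [t]; for bounded [t] such an [s] is unique. *)
Definition is_adjoint H K (t : H -> K) (s : K -> H) :=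
  forall x y, hdot (t x) y = hdot x (s y).

Definition is_unitary H K (U : bop H K) (Us : bop K H) :=
  [/\ is_adjoint U Us, cancel U Us & cancel Us U].

Definition linear_span (V : lmodType R[i]) (S : set V) : set V :=
  [set v | exists n (c : 'I_n -> R[i]) (u : 'I_n -> V),
     (forall i, S (u i)) /\ v = \sum_(i < n) c i *: u i].

Definition hilbert_basis H (B : set H) :=
  (forall x y, B x -> B y -> hdot x y = (x == y)%:R)
  /\ dense (linear_span B).

Definition hilbert_dim_le H (kappa : Type) :=
  exists2 B : set H, hilbert_basis B & (B #<= [set: kappa])%card.

End Hilbert.

Section HilbertTheory.
Variable R : realType.
Implicit Types H K L : hilbert R.

Lemma rnormE H (x : H) : `|x| = (rnorm x)%:C.
Proof. by rewrite /rnorm RRe_real. Qed.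

Lemma rnorm_ge0 H (x : H) : 0 <= rnorm x.
Proof. by rewrite -ler0c -rnormE. Qed.

Lemma rnormD H (x y : H) : rnorm (x + y) <= rnorm x + rnorm y.
Proof. by have := ler_normD x y; rewrite !rnormE -rmorphD lecR. Qed.

Lemma rnormZ H (a : R[i]) (x : H) :
  rnorm (a *: x) = complex.Re `|a| * rnorm x.
Proof.
by rewrite {1}/rnorm normrZ rnormE -[`|a|]RRe_real//= mul0r subr0.
Qed.

Lemma rnorm_dot H (x : H) : (rnorm x ^+ 2)%:C = hdot x x.
Proof. by rewrite -hdotE rnormE rmorphXn. Qed.

Lemma bop_eq H K (t s : bop H K) : t =1 s -> t = s.
Proof.
case: t s => [t tl tc] [s sl sc] /= /funext ts.
by subst s; congr Bop; exact: Prop_irrelevance.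
Qed.

Lemma bop_bounded H K (t : bop H K) :
  exists2 M : R, 0 <= M & forall x, rnorm (t x) <= M * rnorm x.
Proof.
have /linear_bounded_continuous/linear_boundedP := @bop_continuous _ _ _ t.
move=> /pinfty_ex_gt0[M M0 tM]; exists (complex.Re M).
  by rewrite -ler0c RRe_real ?gtr0_real// ltW.
by move=> x; have := tM x; rewrite !rnormE -{1}(RRe_real (gtr0_real M0)) -rmorphM lecR.
Qed.

Lemma opnorm_le H K (t : H -> K) (c : R) : 0 <= c ->
  (forall x, rnorm (t x) <= c * rnorm x) -> opnorm t <= c.
Proof.
move=> c0 tc; apply: ge_sup => [|_ [x /= x1 <-]].
  by exists (rnorm (t 0)), 0 => //=; rewrite normr0.
apply: le_trans (tc x) _; by rewrite ler_piMr//; move: x1; rewrite rnormE lecR.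
Qed.

Lemma le_opnorm H K (t : bop H K) x : rnorm (t x) <= opnorm t * rnorm x.
Proof.
have [M M0 tM] := bop_bounded t.
have [->|x0] := eqVneq x 0.
  by rewrite linear0 /rnorm !normr0 mulr0.
have nx : 0 < rnorm x by rewrite -ltcR -rnormE normr_gt0.
rewrite -ler_pdivrMr// mulrC.
have E : (rnorm x)^-1 * rnorm (t x) = rnorm (t ((rnorm x)^-1%:C *: x)).
  by rewrite linearZ rnormZ ger0_norm ?ler0c ?invr_ge0 ?rnorm_ge0.
rewrite E; apply: ub_le_sup.
  exists M => _ [y /= y1 <-]; apply: le_trans (tM y) _.
  by rewrite ler_piMr//; move: y1; rewrite rnormE lecR.
exists ((rnorm x)^-1%:C *: x) => //=.
rewrite rnormE lecR rnormZ ger0_norm ?ler0c ?invr_ge0 ?rnorm_ge0//.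
by rewrite mulVf// gt_eqF.
Qed.

Lemma opnorm_ge0 H K (t : bop H K) : 0 <= opnorm t.
Proof.
apply: ub_le_sup; last by exists 0 => /=; rewrite ?normr0// linear0 /rnorm normr0.
have [M M0 tM] := bop_bounded t.
exists M => _ [y /= y1 <-]; apply: le_trans (tM y) _.
by rewrite ler_piMr//; move: y1; rewrite rnormE lecR.
Qed.

Lemma bop_id_linear H : linear (@id H). Proof. by []. Qed.
Lemma bop_id_continuous H : continuous (@id H). Proof. by move=> x. Qed.
Definition bop_id H : bop H H := Bop (@bop_id_linear H) (@bop_id_continuous H).

Section Comp.
Variables (H K L : hilbert R) (s : bop K L) (t : bop H K).
Lemma bop_comp_linear : linear (s \o t).
Proof. by move=> a x y /=; rewrite !linearP. Qed.
Lemma bop_comp_continuous : continuous (s \o t).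
Proof.
by move=> x; apply: continuous_comp; exact: bop_continuous.
Qed.
Definition bop_comp : bop H L := Bop bop_comp_linear bop_comp_continuous.
End Comp.

Section Lin.
Variables (H K : hilbert R) (a : R[i]) (t s : bop H K).
Let f x := a *: t x + s x.
Lemma bop_lin_linear : linear f.
Proof.
move=> b x y; rewrite /f (linearP t) (linearP s) !scalerDr !scalerA [a * b]mulrC.
by rewrite addrACA.
Qed.
Lemma bop_lin_continuous : continuous f.
Proof.
move=> x; apply: cvgD; last exact: bop_continuous.
by apply: cvgZ; [exact: cvg_cst|exact: bop_continuous].
Qed.
Definition bop_lin : bop H K := Bop bop_lin_linear bop_lin_continuous.
End Lin.

End HilbertTheory.

(* The representation is a function on all subsets, fixed to 0 outside the
   measurable ones, so that it carries no data beyond its values on [meas]. *)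
Record coarse_module (R : realType) (X : lfcm) := CoarseModule {
  mspace :> hilbert R;
  ind : set X -> bop mspace mspace;
  ind_selfadj : forall A, is_adjoint (ind A) (ind A);
  ind_setT : ind setT =1 id;
  ind_setI : forall A B, meas A -> meas B -> ind (A `&` B) =1 ind A \o ind B;
  ind_setU : forall A B, meas A -> meas B -> A `&` B = set0 ->
    forall x, ind (A `|` B) x = ind A x + ind B x;
  ind_nonmeas : forall A, ~ meas A -> forall x, ind A x = 0;
  ind_dense : dense (linear_span
    [set v | exists2 A, disc_meas A & range (ind A) v]) }.

Section Operators.
Variables (R : realType) (X : lfcm).
Implicit Types C D : coarse_module R X.

Definition faithful_module C :=
  coarse_asymp (@ent X)
    (\bigcup_(A in [set A | disc_meas A /\ exists x, ind C A x != 0]) A) setT.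

Definition supp C D (t : C -> D) : set (X * X) :=
  [set p | exists A B, [/\ disc_meas A, disc_meas B,
     exists x, ind D B (t (ind C A x)) != 0 & (B `*` A) p]].

Definition controlled C D (t : C -> D) := ent (supp t).

Definition approximable C D (t : bop C D) :=
  forall eps : R, 0 < eps -> exists2 s : bop C D,
    controlled s & opnorm (fun x => t x - s x) < eps.

Record approx_op C D := ApproxOp {
  aop :> bop C D;
  aop_approximable : approximable aop }.

End Operators.

Section OperatorTheory.
Variables (R : realType) (X : lfcm).
Implicit Types C D : coarse_module R X.

Lemma ind_norm C A (x : C) : rnorm (ind C A x) <= rnorm x.
Proof.
have [mA|nA] := pselect (meas A); last first.
  by rewrite ind_nonmeas// {1}/rnorm normr0 rnorm_ge0.
have PP y : ind C A (ind C A y) = ind C A y.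
  by rewrite -[LHS](ind_setI mA mA) setIid.
have e : hdot (ind C A x) (x - ind C A x) = 0.
  by rewrite ind_selfadj (linearB (ind C A)) /= PP subrr (linear0r hdot).
rewrite -(@ler_pXn2r _ 2) ?nnegrE ?rnorm_ge0// -lecR !rnorm_dot.
rewrite -[in leRHS](subrK (ind C A x) x) [X in _ <= hdot X X]addrC.
rewrite (hnormDd e) lerDl; have := sqr_ge0 (rnorm (x - ind C A x)).
by rewrite -ler0c rnorm_dot.
Qed.

Lemma ind_set0 C (x : C) : ind C set0 x = 0.
Proof.
have m0 : meas (set0 : set X).
  by rewrite -setCT; apply: (algebra_setC (meas_algebra X)); exact: algebra_setT (meas_algebra X).
have := ind_setU m0 m0 (setI0 _) x; rewrite setU0.
by move/eqP; rewrite -subr_eq subrr => /eqP.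
Qed.

Lemma measU (A B : set X) : meas A -> meas B -> meas (A `|` B).
Proof. exact: algebra_setU (meas_algebra X) _ _. Qed.

Lemma measC (A : set X) : meas A -> meas (~` A).
Proof. exact: algebra_setC (meas_algebra X) _. Qed.

Lemma measI (A B : set X) : meas A -> meas B -> meas (A `&` B).
Proof.
by move=> mA mB; rewrite -[_ `&` _]setCK setCI; apply/measC/measU; exact: measC.
Qed.

Lemma disc_ent_entourage : ent (disc_ent X).
Proof.
have [E entE AE] := disc_uniform (disc_axiom X).
apply: (coarse_sub (ent_coarse X)) entE => p [i _]; exact: AE.
Qed.

Lemma disc_ent_sym x y : disc_ent X (x, y) -> disc_ent X (y, x).
Proof. by move=> [i _ [/= ? ?]]; exists i. Qed.

Lemma disc_ent_trans x y z :
  disc_ent X (x, y) -> disc_ent X (y, z) -> disc_ent X (x, z).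
Proof.
move=> [i _ [/= xi yi]] [j _ [/= yj zj]].
have [_ ti _] := disc_partition (disc_axiom X).
have ij : i = j by apply: ti => //; exists y.
by subst j; exists i.
Qed.

Lemma disc_measD (A B : set X) : disc_meas A -> meas B -> disc_meas (A `\` B).
Proof.
move=> [mA bA] mB; split; first by apply: measI => //; exact: measC.
by move=> [x y] [[/= xA _] [yA _]]; exact: bA.
Qed.

Inductive fin_disc : set X -> Prop :=
| fin_disc0 : fin_disc set0
| fin_discU A B : disc_meas A -> fin_disc B -> fin_disc (A `|` B).

Lemma fin_disc_meas U : fin_disc U -> meas U.
Proof.
elim=> [|A B [mA _] _ mB]; last exact: measU.
by rewrite -setCT; apply: measC; exact: algebra_setT (meas_algebra X).
Qed.

Lemma ind_sub C (A B : set X) (x : C) : meas A -> meas B -> A `<=` B ->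
  ind C A x = x -> ind C B x = x.
Proof.
move=> mA mB AB Ax; rewrite -{1}Ax -[LHS](ind_setI mB mA).
by rewrite setIC (setIidl AB).
Qed.

Lemma span_fin_disc C (v : C) :
  linear_span [set v | exists2 A, disc_meas A & range (ind C A) v] v ->
  exists2 U, fin_disc U & ind C U v = v.
Proof.
move=> [n [c [u [uP ->]]]]; elim: n c u uP => [|n IH] c u uP.
  by exists set0; [exact: fin_disc0|rewrite big_ord0 linear0].
have [U fU Uu] := IH (fun i => c (lift ord0 i)) (fun i => u (lift ord0 i))
  (fun i => uP (lift ord0 i)).
have [A dA [x _ Ax]] := uP ord0.
have mA : meas A by case: dA.
have mU := fin_disc_meas fU.
exists (A `|` U); first exact: fin_discU.
rewrite big_ord_recl (linearD (ind C _)) (linearZ_LR (ind C _)) /=.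
congr (_ *: _ + _); last first.
  by apply: ind_sub Uu => //; exact: measU.
apply: (@ind_sub _ A) => //; first exact: measU.
by rewrite -Ax -[LHS](ind_setI mA mA) setIid.
Qed.

Lemma fin_disc_eq0 C (K : hilbert R) (t : bop C K) (v : C) (U : set X) :
  (forall A, disc_meas A -> t (ind C A v) = 0) -> fin_disc U ->
  t (ind C U v) = 0.
Proof.
move=> tA fU.
suff H B : meas B -> t (ind C (U `\` B) v) = 0.
  rewrite -[U]setD0; apply: H; exact: fin_disc_meas fin_disc0.
elim: fU B => [|A V dA fV IH] B mB; first by rewrite set0D ind_set0 linear0.
have [mA _] := dA.
have -> : (A `|` V) `\` B = (A `\` B) `|` (V `\` (A `|` B)).
  apply/seteqP; split=> x /=; last by tauto.
  by have [] := pselect (A x); tauto.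
rewrite ind_setU.
- by rewrite (linearD t) /= IH ?tA ?addr0//; [exact: disc_measD|exact: measU].
- by case: (disc_measD dA mB).
- by apply: measI; [exact: fin_disc_meas|apply/measC/measU].
- by rewrite -subset0 => x /= [? [? ?]]; tauto.
Qed.

Lemma disc_eq0 C (K : hilbert R) (t : bop C K) (v : C) :
  (forall A, disc_meas A -> t (ind C A v) = 0) -> t v = 0.
Proof.
move=> tA; have [M M0 tM] := bop_bounded t.
suff tv (e : R) : 0 < e -> rnorm (t v) <= 2 * M * e.
  apply/eqP; rewrite -normr_eq0 rnormE -(rmorph0 (real_complex R)).
  rewrite (inj_eq (@complexI R)) eq_le rnorm_ge0 andbT.
  apply/ler_addgt0Pr => e e0; rewrite add0r.
  have M1 : 0 < 2 * M + 1 by rewrite ltr_wpDl// mulr_ge0.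
  apply: le_trans (tv (e / (2 * M + 1)) _) _; first by rewrite divr_gt0.
  by rewrite mulrA ler_pdivrMr// mulrC ler_pM2l// lerDl.
move=> e0.
have [u [uv /span_fin_disc[U fU Uu]]] :
    interior (ball v e%:C) `&` linear_span
      [set v | exists2 A, disc_meas A & range (ind C A) v] !=set0.
  apply: (@ind_dense _ _ C); last exact: open_interior.
  by exists v; apply: nbhsx_ballx; rewrite ltcR.
have {}uv : rnorm (v - u) < e.
  by move/interior_subset: uv; rewrite -ball_normE /= rnormE ltcR.
have -> : t v = t ((v - u) - ind C U (v - u)).
  rewrite (linearB (ind C U)) /= Uu opprB addrA subrK (linearB t) /=.
  by rewrite (fin_disc_eq0 tA fU) subr0.
apply: le_trans (tM _) _; rewrite [2 * M]mulrC -mulrA ler_wpM2l//.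
apply: le_trans (rnormD _ _) _; rewrite mulrDl mul1r lerD ?(ltW uv)//.
rewrite {1}/rnorm normrN; apply: le_trans (ind_norm _ _) (ltW uv).
Qed.

Lemma controlled_comp C D (E : coarse_module R X) (s : bop D E) (t : bop C D) :
  controlled s -> controlled t -> controlled (bop_comp s t).
Proof.
move=> cs ct; apply: (coarse_sub (ent_coarse X)) (coarse_comp (ent_coarse X) ct cs).
move=> [z x] [A [B [dA dB [h nz] [/= Bz Ax]]]].
have [G dG nzG] : exists2 G, disc_meas G &
    ind E B (s (ind D G (t (ind C A h)))) != 0.
  apply: contrapT => nG; move/eqP: nz; apply.
  apply: (@disc_eq0 _ _ (bop_comp (ind E B) s)) => G dG /=.
  by apply: contrapT => /eqP ?; apply: nG; exists G.
have [y Gy] : G !=set0.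
  apply/set0P/eqP => G0; move: nzG.
  by rewrite G0 ind_set0 (linear0 s) (linear0 (ind E B)) eqxx.
exists y => /=.
  by exists G, B; split => //; exists (t (ind C A h)).
exists A, G; split => //; exists h; apply: contra_neq nzG => /= ->.
by rewrite (linear0 s) (linear0 (ind E B)).
Qed.

Lemma controlled_id C : controlled (@bop_id R C).
Proof.
apply: (coarse_sub (ent_coarse X)) disc_ent_entourage.
move=> [y x] [A [B [[mA dA] [mB dB] [h /= nz] [/= By Ax]]]].
have [z [Bz Az]] : (B `&` A) !=set0.
  apply/set0P/eqP => BA; move: nz.
  by rewrite -[X in X != _](ind_setI mB mA) BA ind_set0 eqxx.
by apply: (@disc_ent_trans _ z); [exact: dB|exact: dA].
Qed.

Lemma controlled_lin C D a (t s : bop C D) :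
  controlled t -> controlled s -> controlled (bop_lin a t s).
Proof.
move=> ct cs; apply: (coarse_sub (ent_coarse X)) (coarse_setU (ent_coarse X) ct cs).
move=> p [A [B [dA dB [h nz] BA]]].
have [tz|tz] := eqVneq (ind D B (t (ind C A h))) 0.
  right; exists A, B; split => //; exists h; apply: contra_neq nz => /= sz.
  by rewrite (linearP (ind D B)) /= tz sz scaler0 addr0.
by left; exists A, B; split => //; exists h.
Qed.

Lemma approximable_id C : approximable (@bop_id R C).
Proof.
move=> e e0; exists (@bop_id R C); first exact: controlled_id.
apply: le_lt_trans e0; apply: opnorm_le => // x.
by rewrite subrr {1}/rnorm normr0 mul0r.
Qed.

Lemma approximable_lin C D a (t s : bop C D) :
  approximable t -> approximable s -> approximable (bop_lin a t s).
Proof.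
move=> at_ as_ e e0; pose k := complex.Re `|a|.
have k0 : 0 <= k by rewrite -ler0c RRe_real.
have k1 : 0 < k + 1 by rewrite ltr_wpDl.
have e2 : 0 < e / 2 by rewrite divr_gt0.
have ek : 0 < e / 2 / (k + 1) by rewrite divr_gt0.
have [t' ct' tt'] := at_ _ ek; have [s' cs' ss'] := as_ _ e2.
exists (bop_lin a t' s'); first exact: controlled_lin.
have lt := le_opnorm (bop_lin (-1) t' t); have ls := le_opnorm (bop_lin (-1) s' s).
have E u u' : bop_lin (-1) u' u = (fun x => u x - u' x) :> (C -> D).
  by apply/funext => x /=; rewrite scaleN1r addrC.
rewrite E in lt; rewrite E in ls.
have H := opnorm_ge0 (bop_lin (-1) t' t); have H0 := opnorm_ge0 (bop_lin (-1) s' s).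
rewrite E in H; rewrite E in H0.
set ot := opnorm (fun x => t x - t' x) in tt' lt H.
set os := opnorm (fun x => s x - s' x) in ss' ls H0.
apply: (@le_lt_trans _ _ (k * ot + os)).
  apply: opnorm_le => [|x /=]; first by rewrite addr_ge0// mulr_ge0.
  rewrite opprD addrACA -scalerBr; apply: le_trans (rnormD _ _) _.
  by rewrite rnormZ mulrDl -mulrA lerD// ler_wpM2l.
rewrite [ltRHS](splitr e); apply: ler_ltD => //.
move: tt'; rewrite ltr_pdivlMr// => /ltW; apply: le_trans.
by rewrite mulrC ler_wpM2l// lerDl.
Qed.

Lemma approximable_comp C D (E : coarse_module R X) (s : bop D E) (t : bop C D) :
  approximable s -> approximable t -> approximable (bop_comp s t).
Proof.
move=> as_ at_ e e0.
have e2 : 0 < e / 2 by rewrite divr_gt0.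
have s1 : 0 < opnorm s + 1 by rewrite ltr_wpDl// opnorm_ge0.
have [t' ct' tt'] := at_ _ (divr_gt0 e2 s1).
have t1 : 0 < opnorm t' + 1 by rewrite ltr_wpDl// opnorm_ge0.
have [s' cs' ss'] := as_ _ (divr_gt0 e2 t1).
exists (bop_comp s' t'); first exact: controlled_comp.
have lt := le_opnorm (bop_lin (-1) t' t); have ls := le_opnorm (bop_lin (-1) s' s).
have Et : bop_lin (-1) t' t = (fun x => t x - t' x) :> (C -> D).
  by apply/funext => x /=; rewrite scaleN1r addrC.
have Es : bop_lin (-1) s' s = (fun x => s x - s' x) :> (D -> E).
  by apply/funext => x /=; rewrite scaleN1r addrC.
have ot0 := opnorm_ge0 (bop_lin (-1) t' t); have os0 := opnorm_ge0 (bop_lin (-1) s' s).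
rewrite Et in lt ot0; rewrite Es in ls os0.
set ot := opnorm (fun x => t x - t' x) in tt' lt ot0.
set os := opnorm (fun x => s x - s' x) in ss' ls os0.
apply: (@le_lt_trans _ _ (opnorm s * ot + os * opnorm t')).
  apply: opnorm_le => [|x /=].
    by rewrite addr_ge0// mulr_ge0// opnorm_ge0.
  have -> : s (t x) - s' (t' x) = s (t x - t' x) + (s (t' x) - s' (t' x)).
    by rewrite (linearB s) /= addrA subrK.
  apply: le_trans (rnormD _ _) _; rewrite mulrDl -!mulrA lerD//.
    apply: le_trans (le_opnorm s _) _; rewrite ler_wpM2l ?opnorm_ge0//.
  apply: le_trans (ls _) _; rewrite ler_wpM2l//; exact: le_opnorm.
rewrite [ltRHS](splitr e); apply: ler_ltD.
  move: tt'; rewrite ltr_pdivlMr// => /ltW; apply: le_trans.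
  by rewrite mulrC ler_wpM2l// lerDl.
move: ss'; rewrite ltr_pdivlMr//; apply: le_lt_trans.
by rewrite ler_wpM2l// lerDl.
Qed.

Lemma approx_op_eq C D (t s : approx_op C D) : t =1 s -> t = s.
Proof.
case: t s => [t ta] [s sa] /= /bop_eq ts.
by subst s; congr ApproxOp; exact: Prop_irrelevance.
Qed.

End OperatorTheory.

Record category := Category {
  obj :> Type;
  hom : obj -> obj -> Type;
  idm : forall a, hom a a;
  cmp : forall a b c, hom b c -> hom a b -> hom a c;
  cmp1m : forall a b (f : hom a b), cmp (idm b) f = f;
  cmpm1 : forall a b (f : hom a b), cmp f (idm a) = f;
  cmpA : forall a b c d (f : hom c d) (g : hom b c) (h : hom a b),
    cmp f (cmp g h) = cmp (cmp f g) h }.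

Arguments idm {_} _.

Record functor (A B : category) := Functor {
  fobj :> A -> B;
  fmap : forall a b, hom a b -> hom (fobj a) (fobj b);
  fmap_id : forall a, fmap (idm a) = idm (fobj a);
  fmap_cmp : forall a b c (f : hom b c) (g : hom a b),
    fmap (cmp f g) = cmp (fmap f) (fmap g) }.

Arguments fmap {A B} _ {a b} _.

Section Functors.
Variables A B C : category.

Definition functor_id : functor A A :=
  @Functor A A id (fun _ _ f => f) (fun _ => erefl) (fun _ _ _ _ _ => erefl).

Variables (G : functor B C) (F : functor A B).
Let comp_map a b (f : hom a b) := fmap G (fmap F f).
Lemma functor_comp_id a : comp_map (idm a) = idm (G (F a)).
Proof. by rewrite /comp_map !fmap_id. Qed.
Lemma functor_comp_cmp a b c (f : hom b c) (g : hom a b) :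
  comp_map (cmp f g) = cmp (comp_map f) (comp_map g).
Proof. by rewrite /comp_map !fmap_cmp. Qed.
Definition functor_comp : functor A C :=
  @Functor A C (fun a => G (F a)) comp_map functor_comp_id functor_comp_cmp.

End Functors.

Definition is_iso (A : category) (a b : A) (f : hom a b) :=
  exists g : hom b a, cmp f g = idm b /\ cmp g f = idm a.

Definition naturally_isomorphic (A B : category) (F G : functor A B) :=
  exists eta : forall a, hom (F a) (G a),
    (forall a, is_iso (eta a)) /\
    (forall a b (f : hom a b), cmp (eta b) (fmap F f) = cmp (fmap G f) (eta a)).

Definition is_equivalence (A B : category) (F : functor A B) :=
  exists G : functor B A, naturally_isomorphic (functor_comp G F) (functor_id A)
    /\ naturally_isomorphic (functor_comp F G) (functor_id B).

Definition fully_faithful (A B : category) (F : functor A B) :=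
  forall a b : A, bijective (@fmap A B F a b).

(* [kappa] stands for its cardinality. *)
Inductive rank_bound :=
| RankAtMost (kappa : Type) of infinite_set [set: kappa]
| NoRankBound.

Definition has_rank_bound (R : realType) (k : rank_bound) (H : hilbert R) :=
  match k with
  | RankAtMost kappa _ => hilbert_dim_le H kappa
  | NoRankBound => True
  end.

Section ApproxCategory.
Variables (R : realType) (k : rank_bound) (X : lfcm).

Record amodule := AModule {
  amod :> coarse_module R X;
  amod_rank : has_rank_bound k amod }.

Definition approx_id (C : amodule) : approx_op C C :=
  ApproxOp (@approximable_id R X C).

Definition approx_comp (C D E : amodule) (s : approx_op D E)
    (t : approx_op C D) : approx_op C E :=
  ApproxOp (approximable_comp (aop_approximable s) (aop_approximable t)).

Definition approx_lin (C D : amodule) (a : R[i]) (t s : approx_op C D) :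
    approx_op C D :=
  ApproxOp (approximable_lin a (aop_approximable t) (aop_approximable s)).

Lemma approx_comp1m (C D : amodule) (t : approx_op C D) : approx_comp (approx_id D) t = t.
Proof. exact: approx_op_eq. Qed.

Lemma approx_compm1 (C D : amodule) (t : approx_op C D) : approx_comp t (approx_id C) = t.
Proof. exact: approx_op_eq. Qed.

Lemma approx_compA (C D E F : amodule) (t : approx_op E F) (s : approx_op D E)
    (r : approx_op C D) :
  approx_comp t (approx_comp s r) = approx_comp (approx_comp t s) r.
Proof. exact: approx_op_eq. Qed.

Definition Acat : category :=
  @Category amodule (fun C D => approx_op C D) approx_id approx_comp
    approx_comp1m approx_compm1 approx_compA.

End ApproxCategory.

Record star_functor (R : realType) (k : rank_bound) (X Y : lfcm) :=
  StarFunctor {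
    sfunctor :> functor (Acat R k X) (Acat R k Y);
    sfunctor_linear : forall (C D : amodule R k X) (a : R[i])
        (t s : approx_op C D),
      fmap sfunctor (approx_lin a t s : @hom (Acat R k X) C D)
      = approx_lin a (fmap sfunctor t) (fmap sfunctor s);
    sfunctor_adjoint : forall (C D : amodule R k X)
        (t : approx_op C D) (s : approx_op D C),
      is_adjoint t s ->
      is_adjoint (fmap sfunctor t : approx_op _ _)
                 (fmap sfunctor s : approx_op _ _) }.

Definition approx_relation (R : realType) (X Y : lfcm) (C : coarse_module R X)
    (D : coarse_module R Y) (T : C -> D) (delta : R)
    (F : set (Y * Y)) (E : set (X * X)) : set (Y * X) :=
  [set p | exists B A, [/\ meas B /\ bounded_by F B, meas A /\ bounded_by E A,
     delta < opnorm (ind D B \o T \o ind C A) & (B `*` A) p]].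

Definition implements (R : realType) (k : rank_bound) (X Y : lfcm)
    (Phi : star_functor R k X Y) (C : amodule R k X)
    (U : bop C (Phi C : amodule R k Y)) (Us : bop (Phi C : amodule R k Y) C) :=
  is_unitary U Us /\
  forall t : approx_op C C,
    (fmap Phi t : approx_op (Phi C : amodule R k Y) (Phi C : amodule R k Y))
      =1 U \o t \o Us.

Definition approximated (R : realType) (k : rank_bound) (X Y : lfcm)
    (Phi : star_functor R k X Y) (f : X -> Y) :=
  forall C : amodule R k X, faithful_module C ->
  forall (U : bop C (Phi C : amodule R k Y)) (Us : bop (Phi C : amodule R k Y) C),
    implements U Us ->
  forall delta : R, 0 < delta < 1 ->
  exists F0 E0, [/\ ent F0, ent E0 &
    forall F E, ent F -> ent E -> F0 `<=` F -> E0 `<=` E ->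
      relation_close (@ent X) (@ent Y) (approx_relation U delta F E) f].

(* Main.v *)
Require Import Defs.
From HB Require Import structures.
From mathcomp Require Import all_boot all_order all_algebra.
From mathcomp Require Import complex.
From mathcomp Require Import all_classical all_reals all_analysis.
From mathcomp Require Import ring lra.

Set Implicit Arguments.
Unset Strict Implicit.
Unset Printing Implicit Defensive.

Import Order.TTheory GRing.Theory Num.Theory.
Import numFieldNormedType.Exports.
Import ComplexField.

Local Open Scope classical_set_scope.
Local Open Scope complex_scope.
Local Open Scope ring_scope.

(** Let a unitary [U] implement [Phi] on a module.  Two uniformity statements, both obtained
    from a Nikodym-type principle (this is where countable generation enters), drive the
    proof.

    - Rank-one operators between uniformly close vectors of [X] have images under [Phi]
      that are uniformly almost supported near the diagonal of [Y]: for orthonormal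
      sequences all sums over subsets of the index set are morphisms, so their images are
      uniformly quasi-local, and hence so are the summands, which are differences of such
      sums.  Hence [U v] and [U w] live near each other whenever [v] and [w] do.

    - The projections [U^* 1_B U], for [B] a union of pieces of the discrete partition of
      [Y], are uniformly quasi-local.  So for a unit vector [v] in a small set [A], all
      [U^* 1_B U v] are almost supported near [A]; averaging over signs, the normalised
      [1_B U v] for some single piece [B] is mapped by [U^*] almost into a neighbourhood
      of [A].

    The second statement says that every point of [X] is related to some point of [Y], and
    the first, applied to [U] and to [U^*], that the relation is the graph of a coarse
    embedding up to closeness. *)

(** * Hilbert spaces *)

(** Arbitrary subset sums of rank-one operators are bounded because the sequences are orthonormal,
    and this shapes the argument. Counterexamples with disjoint supports are orthonormal for free,
    but those returning to one bounded set are not; for them the image of a bounded set is shown to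
    be almost bounded, and there a Gram-Schmidt correction produces the orthogonality. An
    implementing unitary belongs to one module and is tied to [Phi] on endomorphisms only. For a
    rank-one [t] between unit vectors of two modules, with adjoint [s], the identity [t = t s t]
    reduces to endomorphisms and leaves a phase that norms do not see. This is how relations of
    different modules are compared. The two bounds on [delta] have different origins. Control of the
    relation uses [delta > 0]: two related rectangles give a matrix block of size more than
    [delta ^+ 3], two factors from the source vector and one from the target vector. Existence of
    related points uses [delta < 1]: the proportion [1 - delta ^+ 2] of squared norm that may leak
    out of a neighbourhood has to be positive. *)

Section HilbertSpaces.
Variable R : realType.
Implicit Types H K L : hilbert R.

Definition cmod (z : R[i]) : R := complex.Re `|z|.

Lemma cmodE z : `|z| = (cmod z)%:C.
Proof. by rewrite /cmod RRe_real. Qed.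

Lemma cmod_ge0 z : 0 <= cmod z.
Proof. by rewrite -ler0c -cmodE. Qed.

Lemma cmodM z w : cmod (z * w) = cmod z * cmod w.
Proof. by apply: complexI; rewrite rmorphM /= -!cmodE normrM. Qed.

Lemma cmod_real (x : R) : cmod x%:C = `|x|.
Proof.
have [x0|/ltW x0] := leP 0 x; first by rewrite /cmod ger0_norm ?ler0c ?ger0_norm.
by rewrite /cmod -normrN -rmorphN ger0_norm ?ler0c ?oppr_ge0// ler0_norm.
Qed.

Lemma cmod0 : cmod 0 = 0.
Proof. by rewrite -[0 in LHS](rmorph0 (real_complex R)) cmod_real normr0. Qed.

Lemma cmodX_conj z : ((cmod z) ^+ 2)%:C = z * z^*.
Proof. by rewrite rmorphXn /= -cmodE normCK. Qed.

Lemma cmod_conj z : cmod z^* = cmod z.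
Proof. by apply: complexI; rewrite -!cmodE norm_conjC. Qed.

Lemma conj_realC (x : R) : (x%:C)^* = x%:C :> R[i].
Proof. by apply/CrealP/complex_realP; exists x. Qed.

Lemma hdotC H (x y : H) : hdot y x = (hdot x y)^*.
Proof. by rewrite hermC /= expr0 mul1r. Qed.

Lemma hdotDl H (x y z : H) : hdot (x + y) z = hdot x z + hdot y z.
Proof. exact: linearDl. Qed.

Lemma hdotDr H (x y z : H) : hdot z (x + y) = hdot z x + hdot z y.
Proof. exact: linearDr. Qed.

Lemma hdotZl H a (x z : H) : hdot (a *: x) z = a * hdot x z.
Proof. by rewrite linearZl_LR. Qed.

Lemma hdotZr H a (x z : H) : hdot z (a *: x) = a^* * hdot z x.
Proof. by rewrite linearZr_LR. Qed.

Lemma hdot0l H (x : H) : hdot 0 x = 0.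
Proof. exact: linear0l. Qed.

Lemma hdot0r H (x : H) : hdot x 0 = 0.
Proof. exact: linear0r. Qed.

Lemma hdotBl H (x y z : H) : hdot (x - y) z = hdot x z - hdot y z.
Proof. exact: linearBl. Qed.

Lemma hdotBr H (x y z : H) : hdot z (x - y) = hdot z x - hdot z y.
Proof. exact: linearBr. Qed.

Lemma hdot_eq0C H (x y : H) : hdot x y = 0 -> hdot y x = 0.
Proof. by move=> xy; rewrite hdotC xy rmorph0. Qed.

Lemma rnorm0 H : rnorm (0 : H) = 0.
Proof. by rewrite /rnorm normr0. Qed.

Lemma rnormN H (x : H) : rnorm (- x) = rnorm x.
Proof. by rewrite /rnorm normrN. Qed.

Lemma rnormBC H (x y : H) : rnorm (x - y) = rnorm (y - x).
Proof. by rewrite -rnormN opprB. Qed.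

Lemma rnorm_eq0 H (x : H) : rnorm x = 0 -> x = 0.
Proof. by move=> x0; apply/eqP; rewrite -normr_eq0 rnormE x0. Qed.

Lemma rnorm_gt0 H (x : H) : x != 0 -> 0 < rnorm x.
Proof. by move=> x0; rewrite -ltcR -rnormE normr_gt0. Qed.

Lemma rnormZE H a (x : H) : rnorm (a *: x) = cmod a * rnorm x.
Proof. exact: rnormZ. Qed.

Lemma rnorm_eq_dot H K (x : H) (y : K) : hdot x x = hdot y y -> rnorm x = rnorm y.
Proof.
rewrite -!rnorm_dot => /(@complexI R)/eqP.
by rewrite eqrXn2 ?rnorm_ge0// => /eqP.
Qed.

Lemma rnormB_le H (x y : H) : rnorm x - rnorm y <= rnorm (x - y).
Proof. by rewrite lerBlDr -{1}(subrK y x) rnormD. Qed.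

Lemma rnormB_tri H (x y z : H) : rnorm (x - z) <= rnorm (x - y) + rnorm (y - z).
Proof. by rewrite -[x in leLHS](subrK y) -addrA rnormD. Qed.

(** The squared norm of [b *: x - a *: y], with [a = hdot x y] and [b] the squared norm of [y], is
    nonnegative; it equals [b] times the difference of the squares of the two sides. *)
Lemma cauchy_schwarz H (x y : H) : cmod (hdot x y) <= rnorm x * rnorm y.
Proof.
have [->|y0] := eqVneq y 0; first by rewrite hdot0r cmod0 rnorm0 mulr0.
have ny := rnorm_gt0 y0.
set a := hdot x y; set b : R[i] := (rnorm y ^+ 2)%:C.
have bc : b^* = b by exact: conj_realC.
have : 0 <= hdot (b *: x - a *: y) (b *: x - a *: y) by rewrite -rnorm_dot ler0c sqr_ge0.
rewrite hdotBl !hdotBr !hdotZl !hdotZr bc -/a (hdotC x y) -/a -!rnorm_dot -/b.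
have -> : b * (b * (rnorm x ^+ 2)%:C) - b * (a^* * a) -
   (a * (b * a^*) - a * (a^* * b)) = b * (b * (rnorm x ^+ 2)%:C - a * a^*) by ring.
rewrite -cmodX_conj -rmorphM -rmorphB -rmorphM ler0c pmulr_rge0 ?exprn_gt0//.
rewrite subr_ge0 -exprMn ler_pXn2r ?nnegrE ?cmod_ge0 ?mulr_ge0 ?rnorm_ge0//.
by rewrite mulrC.
Qed.

Lemma pythagoras H (x y : H) : hdot x y = 0 ->
  rnorm (x + y) ^+ 2 = rnorm x ^+ 2 + rnorm y ^+ 2.
Proof.
move=> xy; apply: (@complexI R); rewrite rmorphD /= !rnorm_dot.
by rewrite hdotDl !hdotDr xy (hdot_eq0C xy) addr0 add0r.
Qed.

Lemma parallelogram H (x y : H) :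
  rnorm (x + y) ^+ 2 + rnorm (x - y) ^+ 2 = 2 * (rnorm x ^+ 2 + rnorm y ^+ 2).
Proof.
apply: (@complexI R); rewrite rmorphM !rmorphD /= !rnorm_dot.
rewrite hdotBl !hdotBr hdotDl !hdotDr; ring.
Qed.

Lemma dense_rnorm H (S : set H) : dense S ->
  forall x (e : R), 0 < e -> exists2 y, S y & rnorm (x - y) < e.
Proof.
move=> dS x e e0.
have [y [xy Sy]] : interior (ball x e%:C) `&` S !=set0.
  apply: dS; last exact: open_interior.
  by exists x; apply: nbhsx_ballx; rewrite ltcR.
exists y => //; move/interior_subset: xy.
by rewrite -ball_normE /= rnormE ltcR.
Qed.

Definition rlim H (u : nat -> H) (l : H) :=
  forall e : R, 0 < e -> exists N, forall n, (N <= n)%N -> rnorm (u n - l) <= e.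

Lemma complete_rnorm H (u : nat -> H) :
  (forall e : R, 0 < e -> exists N, forall n, (N <= n)%N ->
     rnorm (u N - u n) <= e) ->
  exists l, rlim u l.
Proof.
move=> cu.
have /cauchy_cvgP/cvg_ex[l ul] : cauchy (u @ \oo).
  apply: cauchy_exP => e e0.
  have er : e = (complex.Re e)%:C by rewrite RRe_real// gtr0_real.
  have e0' : 0 < complex.Re e / 2 by rewrite divr_gt0// -ltcR -er.
  have [N uN] := cu _ e0'; exists (u N); exists N => // n /= Nn.
  rewrite -ball_normE /= er rnormE ltcR (le_lt_trans (uN n Nn))//.
  by rewrite ltr_pdivrMr// ltr_pMr ?ltr1n// -ltcR -er.
exists l => e e0.
have /(_ (e%:C)) : forall e, 0 < e -> \forall n \near \oo, `|l - u n| < e.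
  by move=> e1 e10; move/cvgrPdist_lt : ul => /(_ _ e10).
rewrite ltcR => /(_ e0)[N _ uN]; exists N => n Nn.
by have := uN n Nn; rewrite /= rnormBC rnormE ltcR => /ltW.
Qed.

Lemma bop_of_bounded H K (f : H -> K) (M : R) : linear f ->
  (forall x, rnorm (f x) <= M * rnorm x) -> exists t : bop H K, t =1 f.
Proof.
move=> lf fM.
pose g : {linear H -> K} := HB.pack f (GRing.isLinear.Build _ _ _ _ f lf).
have cg : continuous g.
  apply/linear_bounded_continuous/linear_boundedP.
  exists (Num.max 0 M)%:C; split; first by apply/complex_realP; exists (Num.max 0 M).
  move=> r Mr x.
  rewrite !rnormE (le_trans (_ : _ <= (Num.max 0 M * rnorm x)%:C)) ?lecR//.
    by rewrite (le_trans (fM x))// ler_wpM2r ?rnorm_ge0// le_max lexx orbT.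
  by rewrite rmorphM ler_wpM2r// ?ler0c ?rnorm_ge0// ltW.
by exists (@Bop _ _ _ f lf cg).
Qed.
End HilbertSpaces.

Section Limits.
Variable R : realType.
Implicit Types H K L : hilbert R.

Lemma small_inv (e : R) : 0 < e ->
  exists N, forall n, (N <= n)%N -> (n.+1%:R : R)^-1 <= e.
Proof.
move=> e0; have e1 : 0 <= e^-1 by rewrite invr_ge0 ltW.
exists (Num.Def.archi_bound e^-1) => n Nn.
rewrite -[leRHS]invrK lef_pV2 ?posrE ?invr_gt0//.
apply: ltW; apply: lt_le_trans (archi_boundP e1) _.
by rewrite ler_nat leqW.
Qed.

Lemma cmod_eq0 (z : R[i]) : (forall e : R, 0 < e -> cmod z <= e) -> z = 0.
Proof.
move=> ze; apply/eqP; rewrite -normr_eq0 cmodE -(rmorph0 (real_complex R)).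
rewrite (inj_eq (@complexI R)) eq_le cmod_ge0 andbT.
by apply/ler_addgt0Pr => e e0; rewrite add0r; exact: ze.
Qed.

Lemma cmodD (z w : R[i]) : cmod (z + w) <= cmod z + cmod w.
Proof. by rewrite -lecR rmorphD /= -!cmodE ler_normD. Qed.

Lemma rlim_le H (u : nat -> H) l c : rlim u l ->
  (forall n, rnorm (u n) <= c) -> rnorm l <= c.
Proof.
move=> ul uc; apply/ler_addgt0Pr => e /ul[N /(_ N (leqnn N)) uN].
rewrite -[l](subrK (u N)) (le_trans (rnormD _ _))// addrC lerD//.
by rewrite rnormBC.
Qed.

Lemma rlim0 H (u : nat -> H) l : rlim u l -> (forall n, u n = 0) -> l = 0.
Proof.
move=> ul u0; apply: rnorm_eq0; apply/eqP; rewrite eq_le rnorm_ge0 andbT.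
by apply: rlim_le ul _ => n; rewrite u0 rnorm0.
Qed.

Lemma rlim_lin H (u w : nat -> H) l m a : rlim u l -> rlim w m ->
  rlim (fun n => a *: u n + w n) (a *: l + m).
Proof.
move=> ul wm e e0.
have a1 : 0 < cmod a + 1 by rewrite ltr_wpDl// cmod_ge0.
have [N1 u1] := ul _ (divr_gt0 (divr_gt0 e0 (ltr0n _ 2)) a1).
have [N2 w2] := wm _ (divr_gt0 e0 (ltr0n _ 2)).
exists (maxn N1 N2) => n; rewrite geq_max => /andP[n1 n2].
rewrite opprD addrACA -scalerBr (le_trans (rnormD _ _))// [leRHS](splitr e).
rewrite lerD ?w2// rnormZE; have := u1 n n1.
rewrite ler_pdivlMr//; apply: le_trans.
by rewrite mulrC ler_wpM2l ?rnorm_ge0// lerDl.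
Qed.

Lemma rlim_bop H K (t : bop H K) (u : nat -> H) l :
  rlim u l -> rlim (fun n => t (u n)) (t l).
Proof.
move=> ul e e0; have [M M0 tM] := bop_bounded t.
have M1 : 0 < M + 1 by rewrite ltr_wpDl.
have [N uN] := ul _ (divr_gt0 e0 M1); exists N => n /uN un.
rewrite -(linearB t); apply: le_trans (tM _) _.
move: un; rewrite ler_pdivlMr//; apply: le_trans.
by rewrite mulrC ler_wpM2l ?rnorm_ge0// lerDl.
Qed.

Lemma rlim_unique H (u : nat -> H) l m : rlim u l -> rlim u m -> l = m.
Proof.
move=> ul um; apply/eqP; rewrite -subr_eq0; apply/eqP.
have := rlim_lin (-1) um ul; rewrite scaleN1r addrC => /rlim0; apply=> n.
by rewrite scaleN1r addNr.
Qed.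

Lemma rlim_dot H (u w : nat -> H) l m : rlim u l -> rlim w m ->
  forall e : R, 0 < e ->
  exists N, forall n, (N <= n)%N -> cmod (hdot (u n) (w n) - hdot l m) <= e.
Proof.
move=> ul wm e e0.
have m1 : 0 < rnorm m + 1 by rewrite ltr_wpDl// rnorm_ge0.
have l1 : 0 < rnorm l + 1 by rewrite ltr_wpDl// rnorm_ge0.
have e2 := divr_gt0 e0 (ltr0n R 2).
have [N1 u1] := ul _ (divr_gt0 e2 m1); have [N2 w2] := wm _ (divr_gt0 e2 l1).
have [N3 w3] := wm _ ltr01.
exists (maxn N1 (maxn N2 N3)) => n; rewrite !geq_max => /and3P[n1 n2 n3].
have -> : hdot (u n) (w n) - hdot l m = hdot (u n - l) (w n) + hdot l (w n - m).
  by rewrite hdotBl hdotBr; ring.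
rewrite (le_trans (cmodD _ _))// [leRHS](splitr e) lerD//.
  apply: le_trans (cauchy_schwarz _ _) _; have := u1 n n1; rewrite ler_pdivlMr//.
  apply: le_trans; rewrite ler_wpM2l ?rnorm_ge0//.
  by rewrite -{1}(subrK m (w n)) (le_trans (rnormD _ _))// addrC lerD2l w3.
apply: le_trans (cauchy_schwarz _ _) _; have := w2 n n2; rewrite ler_pdivlMr//.
by apply: le_trans; rewrite mulrC ler_wpM2l ?rnorm_ge0// lerDl.
Qed.

Lemma bop_of_limit H K (t : nat -> bop H K) (M : R) :
  (forall n x, rnorm (t n x) <= M * rnorm x) ->
  (forall x (e : R), 0 < e -> exists N, forall n, (N <= n)%N ->
     rnorm (t N x - t n x) <= e) ->
  exists T : bop H K, forall x, rlim (fun n => t n x) (T x).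
Proof.
move=> tM tc; have /choice[f ft] x := complete_rnorm (tc x).
have lf : linear f.
  move=> a x y; apply: (rlim_unique (ft _)).
  have := rlim_lin a (ft x) (ft y); congr rlim; apply/funext => n.
  by rewrite linearP.
have [x|T Tf] := bop_of_bounded (M := M) lf; first exact: (rlim_le (ft x)).
by exists T => x; rewrite Tf.
Qed.

Section Theta.
Variables (H K : hilbert R) (w : K) (v : H).

Lemma theta_subproof : exists t : bop H K, t =1 (fun x => hdot x v *: w).
Proof.
apply: (@bop_of_bounded _ _ _ _ (rnorm v * rnorm w)) => [a x y|x].
  by rewrite hdotDl hdotZl scalerDl scalerA.
rewrite rnormZE mulrAC ler_wpM2r ?rnorm_ge0// mulrC; exact: cauchy_schwarz.
Qed.

(** The rank-one operator usually written |w><v|. *)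
Definition theta : bop H K := projT1 (cid theta_subproof).

Lemma thetaE x : theta x = hdot x v *: w.
Proof. exact: (projT2 (cid theta_subproof)). Qed.

End Theta.

Lemma theta_adj H K (w : K) (v : H) : is_adjoint (theta w v) (theta v w).
Proof.
by move=> x y; rewrite !thetaE hdotZl hdotZr -hdotC mulrC.
Qed.

Lemma theta_comp H K L (u : L) (w w' : K) (v : H) x :
  theta u w (theta w' v x) = hdot w' w *: theta u v x.
Proof. by rewrite !thetaE hdotZl !scalerA mulrC. Qed.

(** * Unitaries from equal Gram matrices *)

Section GramUnitary.
Variables (H K : hilbert R).

(** A linear relation rather than a map: that the second vector is determined by the first only
    follows from equality of Gram matrices. *)
Inductive gspan (G : H -> K -> Prop) : H -> K -> Prop :=
| gspan0 : gspan G 0 0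
| gspanS a u w v z : G u w -> gspan G v z -> gspan G (a *: u + v) (a *: w + z).

Lemma gspan1 G u w : G u w -> gspan G u w.
Proof.
by move=> Guw; have := gspanS 1 Guw (gspan0 G); rewrite !scale1r !addr0.
Qed.

Lemma gspan_lin G a v z v' z' : gspan G v z -> gspan G v' z' ->
  gspan G (a *: v + v') (a *: z + z').
Proof.
move=> + g'; elim=> [|b u w v1 z1 Guw _ IH]; first by rewrite !scaler0 !add0r.
rewrite !scalerDr !scalerA -!addrA; exact: gspanS.
Qed.

Lemma gspanB G v z v' z' : gspan G v z -> gspan G v' z' ->
  gspan G (v - v') (z - z').
Proof.
move=> g g'; rewrite [v - v']addrC [z - z']addrC -(scaleN1r v') -(scaleN1r z').
exact: gspan_lin.
Qed.

Variable G : H -> K -> Prop.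
Hypothesis gram : forall u w u' w', G u w -> G u' w' -> hdot u u' = hdot w w'.

Lemma gspan_gram v z v' z' : gspan G v z -> gspan G v' z' ->
  hdot v v' = hdot z z'.
Proof.
move=> + g'; elim=> [|a u w v1 z1 Guw _ IH]; first by rewrite !hdot0l.
rewrite !hdotDl !hdotZl IH; congr (_ * _ + _).
elim: g' => [|b u' w' v2 z2 Guw' _ IH']; first by rewrite !hdot0r.
by rewrite !hdotDr !hdotZr IH' (gram Guw Guw').
Qed.

Definition gclosure x y := exists v z, [/\ forall n : nat, gspan G (v n) (z n),
  rlim v x & rlim z y].

Lemma gclosure_gspan x y : gspan G x y -> gclosure x y.
Proof.
move=> g; exists (fun=> x), (fun=> y); split=> // e e0.
  by exists 0%N => n _; rewrite subrr rnorm0 ltW.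
by exists 0%N => n _; rewrite subrr rnorm0 ltW.
Qed.

Lemma gclosure_gram x y x' y' : gclosure x y -> gclosure x' y' ->
  hdot x x' = hdot y y'.
Proof.
move=> [v [z [g vx zy]]] [v' [z' [g' vx' zy']]].
apply/eqP; rewrite -subr_eq0; apply/eqP/cmod_eq0 => e e0.
have e2 := divr_gt0 e0 (ltr0n R 2).
have [N1 h1] := rlim_dot vx vx' e2; have [N2 h2] := rlim_dot zy zy' e2.
have {}h1 := h1 _ (leq_maxl N1 N2); have {}h2 := h2 _ (leq_maxr N1 N2).
move: h1 h2; set n := maxn _ _; rewrite (gspan_gram (g n) (g' n)).
set a := hdot (z n) _ => h1 h2.
have -> : hdot x x' - hdot y y' = (-1) * (a - hdot x x') + (a - hdot y y') by ring.
rewrite (le_trans (cmodD _ _))// [leRHS](splitr e) lerD// cmodM.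
by rewrite -(rmorphN1 (real_complex R)) cmod_real normrN1 mul1r.
Qed.

Lemma gclosure_lin a x y x' y' : gclosure x y -> gclosure x' y' ->
  gclosure (a *: x + x') (a *: y + y').
Proof.
move=> [v [z [g vx zy]]] [v' [z' [g' vx' zy']]].
exists (fun n => a *: v n + v' n), (fun n => a *: z n + z' n); split.
- by move=> n; exact: gspan_lin.
- exact: rlim_lin.
- exact: rlim_lin.
Qed.

(** By linearity 0 is related to the difference of the two images, and equality of inner products
    makes that difference a vector of norm zero. *)
Lemma gclosure_fun x y y' : gclosure x y -> gclosure x y' -> y = y'.
Proof.
move=> g g'; apply/eqP; rewrite -subr_eq0; apply/eqP/rnorm_eq0.
have := gclosure_lin (-1) g' g; rewrite !scaleN1r addNr addrC => h.
have := gclosure_gram h h; rewrite hdot0l -rnorm_dot.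
move=> /(@complexI _ 0)/esym/eqP; by rewrite sqrf_eq0 => /eqP.
Qed.

Lemma gclosure_total :
  (forall x (e : R), 0 < e -> exists v z, gspan G v z /\ rnorm (x - v) <= e) ->
  forall x, exists y, gclosure x y.
Proof.
move=> dG x.
have /choice[v] : forall n, exists v, exists z, gspan G v z /\
    rnorm (x - v) <= n.+1%:R^-1.
  by move=> n; apply: dG; rewrite invr_gt0.
move=> /choice[z vz].
have vx : rlim v x.
  move=> e /small_inv[N sN]; exists N => n /sN; apply: le_trans.
  by rewrite rnormBC; case: (vz n).
have [y zy] : exists y, rlim z y.
  apply: complete_rnorm => e e0; have [N vN] := vx _ (divr_gt0 e0 (ltr0n R 2)).
  exists N => n Nn; have -> : rnorm (z N - z n) = rnorm (v N - v n).
    by apply/rnorm_eq_dot/esym/gspan_gram; apply: gspanB;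
      [case: (vz N)|case: (vz n)|case: (vz N)|case: (vz n)].
  rewrite (le_trans (rnormB_tri _ x _))// [leRHS](splitr e) lerD ?vN//.
  by rewrite rnormBC vN.
by exists y, v, z; split => // n; case: (vz n).
Qed.

End GramUnitary.

Lemma gspan_flip H K (G : H -> K -> Prop) v z :
  gspan G v z -> gspan (fun y x => G x y) z v.
Proof. by elim=> [|a u w v1 z1 Guw _ IH]; [exact: gspan0|exact: gspanS]. Qed.

Lemma gspan_sum H K (G : H -> K -> Prop) n (c : 'I_n -> R[i]) (u : 'I_n -> H) :
  (forall i, exists w, gspan G (u i) w) ->
  exists w, gspan G (\sum_(i < n) c i *: u i) w.
Proof.
move=> h; apply: (big_ind (fun v => exists w, gspan G v w)) =>
  [|v1 v2 [w1 h1] [w2 h2]|i _].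
- by exists 0; exact: gspan0.
- exists (w1 + w2).
  by have := gspan_lin 1 h1 h2; rewrite !scale1r.
- have [w hw] := h i; exists (c i *: w).
  by have := gspan_lin (c i) hw (gspan0 G); rewrite !addr0.
Qed.

(** The closed span of [G] is the graph of an isometry. Density on the left makes it total; density
    on the right does the same for the flipped relation, whose isometry is the inverse. *)
Lemma gram_unitary H K (G : H -> K -> Prop) :
  (forall u w u' w', G u w -> G u' w' -> hdot u u' = hdot w w') ->
  (forall x (e : R), 0 < e -> exists v z, gspan G v z /\ rnorm (x - v) <= e) ->
  (forall y (e : R), 0 < e -> exists v z, gspan G v z /\ rnorm (y - z) <= e) ->
  exists (U : bop H K) (Us : bop K H), Defs.is_unitary U Us /\
    forall u w, G u w -> U u = w.
Proof.
move=> gr d1 d2; have /choice[f fP] := gclosure_total gr d1.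
have gr' : forall u w u' w', G w u -> G w' u' -> hdot u u' = hdot w w'.
  by move=> u w u' w' h h'; rewrite (gr _ _ _ _ h h').
have /(gclosure_total gr')/choice[g gP] : forall y (e : R), 0 < e ->
    exists v z, gspan (fun y x => G x y) v z /\ rnorm (y - v) <= e.
  by move=> y e /(d2 y)[v [z [/gspan_flip ? ?]]]; exists z, v.
have {}gP y : gclosure G (g y) y.
  have [v [z [vz ? ?]]] := gP y; exists z, v; split => // n.
  exact: (gspan_flip (vz n)).
have lf : linear f.
  by move=> a x y; apply: (gclosure_fun gr (fP _)); exact: gclosure_lin.
have fg : cancel g f by move=> y; exact: (gclosure_fun gr (fP _)).
have ff x y : hdot (f x) (f y) = hdot x y by apply/esym/(gclosure_gram gr).
have nf x : rnorm (f x) = rnorm x by exact: rnorm_eq_dot.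
have gf : cancel f g.
  move=> x; apply/eqP; rewrite -subr_eq0; apply/eqP/rnorm_eq0.
  rewrite -nf -scaleN1r addrC lf fg scaleN1r addNr; exact: rnorm0.
have lg : linear g by move=> a x y; rewrite -[RHS]gf lf !fg.
have [x|U Uf] := bop_of_bounded (M := 1) lf; first by rewrite nf mul1r.
have [x|Us Ug] := bop_of_bounded (M := 1) lg; first by rewrite -nf fg mul1r.
exists U, Us; split; first split.
- by move=> x y; rewrite Uf Ug -[y in LHS]fg ff.
- by move=> x; rewrite Uf Ug gf.
- by move=> x; rewrite Uf Ug fg.
- move=> u w Guw; rewrite Uf; apply: (gclosure_fun gr (fP u)).
  exact/gclosure_gspan/gspan1.
Qed.
End Limits.

(** * Sums of rank-one operators along orthonormal sequences *)

Section OrthonormalSums.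
Variable R : realType.
Implicit Types H K L : hilbert R.

Definition orthoseq H (e : nat -> H) := forall i j, hdot (e i) (e j) = (i == j)%:R.

Lemma orthoseq_norm H (e : nat -> H) : orthoseq e -> forall i, rnorm (e i) = 1.
Proof.
move=> he i; apply/eqP; rewrite -(@eqrXn2 _ 2) ?rnorm_ge0//; apply/eqP/(@complexI R).
by rewrite rnorm_dot he eqxx expr1n.
Qed.

Section PartialSums.
Variables (H K : hilbert R) (e' : nat -> K) (e : nat -> H).
Implicit Types S : set nat.

(** Membership in [S] enters as a coefficient 0 or 1, so that additivity in [S] is additivity of
    coefficients; [theta 0 0] is the zero operator. *)
Fixpoint psum S n : bop H K :=
  if n is m.+1 then bop_lin (`[< S m >]%:R) (theta (e' m) (e m)) (psum S m)
  else theta 0 0.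

Lemma psumS S n x :
  psum S n.+1 x = `[< S n >]%:R *: (hdot x (e n) *: e' n) + psum S n x.
Proof. by rewrite /= thetaE. Qed.

Lemma psum0 S x : psum S 0 x = 0.
Proof. by rewrite /= thetaE scaler0. Qed.

Lemma psum_out S n x : (forall i, (i < n)%N -> ~ S i) -> psum S n x = 0.
Proof.
elim: n => [|n IH] Sn; first exact: psum0.
rewrite psumS IH => [|i ni]; last by apply: Sn; exact: ltnW.
by rewrite asboolF ?scale0r ?addr0//; exact: Sn.
Qed.

Lemma psum_setU S S' n x : S `&` S' = set0 ->
  psum (S `|` S') n x = psum S n x + psum S' n x.
Proof.
move=> SS'; elim: n => [|n IH]; first by rewrite !psum0 addr0.
rewrite !psumS IH addrACA -scalerDl; congr (_ *: _ + _).
have -> : `[< (S `|` S') n >] = `[< S n >] || `[< S' n >] by exact: asbool_or.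
case: asboolP => sn; case: asboolP => sn' /=; rewrite ?addr0 ?add0r//.
by suff : (S `&` S') n by rewrite SS'.
Qed.

Lemma psum_cut S m n x : (m <= n)%N ->
  psum S n x - psum S m x = psum (S `&` [set i | (m <= i)%N]) n x.
Proof.
elim: n => [|n IH]; first by rewrite leqn0 => /eqP ->; rewrite subrr psum0.
rewrite leq_eqVlt => /orP[/eqP ->|mn].
  by rewrite subrr psum_out// => i + [_ /=]; rewrite ltnNge => /negP.
rewrite !psumS -IH// addrA; congr (_ *: _ + _ - _).
suff -> : `[< (S `&` [set i | (m <= i)%N]) n >] = `[< S n >] by [].
by apply: asbool_equiv_eq; split => [[]|].
Qed.

Definition bsum S n x : R :=
  \sum_(0 <= i < n) `[< S i >]%:R * cmod (hdot x (e i)) ^+ 2.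

Lemma bsum_le S n m x : (n <= m)%N -> bsum S n x <= bsum S m x.
Proof.
move=> nm; rewrite /bsum (big_cat_nat (leq0n n) nm)//= lerDl sumr_ge0// => i _.
by rewrite mulr_ge0// sqr_ge0.
Qed.

Hypothesis he' : orthoseq e'.

Lemma psum_orth S n m x : (n <= m)%N -> hdot (e' m) (psum S n x) = 0.
Proof.
elim: n => [|n IH] nm; first by rewrite psum0 hdot0r.
rewrite psumS hdotDr !hdotZr he' IH ?(ltnW nm)// addr0.
by rewrite gtn_eqF// !mulr0.
Qed.

Lemma psum_norm S n x : rnorm (psum S n x) ^+ 2 = bsum S n x.
Proof.
elim: n => [|n IH]; first by rewrite psum0 rnorm0 /bsum big_geq// expr0n.
rewrite psumS pythagoras ?IH; last by rewrite !hdotZl psum_orth// !mulr0.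
rewrite /bsum big_nat_recr//= addrC; congr (_ + _).
rewrite !rnormZE (orthoseq_norm he') mulr1 exprMn; congr (_ * _).
by case: asboolP => _ /=; rewrite ?cmod0 ?expr0n// -(rmorph1 (real_complex R))
  cmod_real normr1 expr1n.
Qed.

End PartialSums.

Lemma psum_setI1 H K (e' : nat -> K) (e : nat -> H) i n x :
  psum e' e [set i] n x = if (i < n)%N then theta (e' i) (e i) x else 0.
Proof.
elim: n => [|n IH]; first exact: psum0.
rewrite psumS IH ltnS; have [ni|ni|->] := ltngtP i n.
- by rewrite asboolF ?scale0r ?add0r// => ni'; rewrite ni' ltnn in ni.
- by rewrite asboolF ?scale0r ?add0r// => ni'; rewrite ni' ltnn in ni.
- by rewrite asboolT// scale1r thetaE addr0.
Qed.

Lemma psum_adj H K (e' : nat -> K) (e : nat -> H) S n x y :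
  hdot (psum e' e S n x) y = hdot x (psum e e' S n y).
Proof.
elim: n => [|n IH]; first by rewrite !psum0 hdot0l hdot0r.
rewrite !psumS hdotDl hdotDr IH !hdotZl !hdotZr -hdotC rmorph_nat; congr (_ + _).
by rewrite [hdot x _ * _]mulrC.
Qed.

(** [psum e e setT n] is the orthogonal projection onto the span of the first [n] vectors, so
    Pythagoras applies to [x] split along it. *)
Lemma bessel H (e : nat -> H) n x : orthoseq e -> bsum e setT n x <= rnorm x ^+ 2.
Proof.
move=> he; set y := psum e e setT n x.
have xy : hdot x y = (bsum e setT n x)%:C.
  rewrite /y; elim: n {y} => [|n IH].
    by rewrite psum0 hdot0r /bsum big_geq// rmorph0.
  rewrite psumS hdotDr IH /bsum big_nat_recr//= addrC rmorphD /=; congr (_ + _).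
  rewrite asboolT// scale1r mul1r hdotZr cmodX_conj; exact: mulrC.

rewrite -(psum_norm e he) -/y -[in leRHS](subrK y x) pythagoras ?lerDr ?sqr_ge0//.
by rewrite hdotBl xy -rnorm_dot psum_norm// subrr.
Qed.

Lemma bessel_tail H (e : nat -> H) x (eta : R) : orthoseq e -> 0 < eta ->
  exists N, forall n, bsum e [set i | (N <= i)%N] n x <= eta.
Proof.
move=> he eta0.
pose A := range (fun n => bsum e setT n x).
have supA : has_sup A.
  split; first by exists (bsum e setT 0 x), 0%N.
  by exists (rnorm x ^+ 2) => _ [n _ <-]; exact: bessel.
have [_ [N _ <-] sN] := sup_adherent eta0 supA.
exists N => n.
have bS m : (N <= m)%N -> 
    bsum e setT m x = bsum e setT N x + bsum e [set i | (N <= i)%N] m x.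
  move=> Nm; rewrite /bsum !(big_cat_nat (leq0n N) Nm)//=; congr (_ + _).
  rewrite [X in _ = X + _]big_nat_cond [X in _ = X + _]big1 ?add0r => [|i]; last first.
    rewrite andbT => /andP[_ iN]; rewrite asboolF ?mul0r// => Ni.
    by rewrite ltnNge Ni in iN.
  rewrite big_nat_cond [RHS]big_nat_cond; apply: eq_bigr => i.
  by rewrite andbT => /andP[Ni _]; rewrite !asboolT.
rewrite (le_trans (bsum_le _ _ _ (leq_maxr N n)))//.
have := bS _ (leq_maxl N n); move/eqP; rewrite addrC -subr_eq => /eqP <-.
rewrite lerBlDr -lerBlDl ltW// (le_lt_trans _ sN)//.
rewrite lerD2r; apply: ub_le_sup; first by case: supA.
by exists (maxn N n).
Qed.

Section SumOp.
Variables (H K : hilbert R) (e' : nat -> K) (e : nat -> H).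
Hypotheses (he' : orthoseq e') (he : orthoseq e).

Lemma bsum_sub S S' n x : S `<=` S' -> bsum e S n x <= bsum e S' n x.
Proof.
move=> SS'; apply: ler_sum => i _; rewrite ler_wpM2r ?sqr_ge0// ler_nat.
by case: asboolP => // /SS' s; rewrite asboolT.
Qed.

Lemma sumop_subproof S :
  exists T : bop H K, forall x, rlim (fun n => psum e' e S n x) (T x).
Proof.
apply: (@bop_of_limit _ _ _ _ 1) => [n x|x eps eps0].
  rewrite mul1r -(@ler_pXn2r _ 2) ?nnegrE ?rnorm_ge0// psum_norm//.
  by apply: le_trans (bessel n x he); exact: bsum_sub.
have [N Nx] := bessel_tail x he (exprn_gt0 2 eps0).
exists N => n Nn; rewrite rnormBC psum_cut//.
rewrite -(@ler_pXn2r _ 2) ?nnegrE ?rnorm_ge0 ?(ltW eps0)// psum_norm//.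
by apply: le_trans (Nx n); apply: bsum_sub => i [].
Qed.

(** A partial isometry for every set [S] of indices, both sequences being orthonormal; the sum
    converges pointwise, not in norm. *)
Definition sumop S : bop H K := projT1 (cid (sumop_subproof S)).

Lemma sumop_lim S x : rlim (fun n => psum e' e S n x) (sumop S x).
Proof. exact: (projT2 (cid (sumop_subproof S))). Qed.

Lemma sumop_setU S S' x : S `&` S' = set0 ->
  sumop (S `|` S') x = sumop S x + sumop S' x.
Proof.
move=> SS'; apply: (rlim_unique (sumop_lim _ _)).
have := rlim_lin 1 (sumop_lim S x) (sumop_lim S' x); rewrite scale1r.
by congr rlim; apply/funext => n; rewrite scale1r psum_setU.
Qed.

Lemma sumop1 i x : sumop [set i] x = theta (e' i) (e i) x.
Proof.
apply: (rlim_unique (sumop_lim _ _)) => eps eps0; exists i.+1 => n ni.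
by rewrite psum_setI1 ni subrr rnorm0 ltW.
Qed.

(** One [N] serves all [S], because the Bessel tail of [x] does not depend on [S]. This will be
    exhaustiveness in the sense of [nikodym]. *)
Lemma sumop_tail x (eta : R) : 0 < eta -> exists N, forall S,
  (forall i, S i -> (N <= i)%N) -> rnorm (sumop S x) <= eta.
Proof.
move=> eta0; have [N Nx] := bessel_tail x he (exprn_gt0 2 eta0).
exists N => S SN; apply: (rlim_le (sumop_lim S x)) => n.
rewrite -(@ler_pXn2r _ 2) ?nnegrE ?rnorm_ge0 ?(ltW eta0)// psum_norm//.
by apply: le_trans (Nx n); exact: bsum_sub.
Qed.

End SumOp.

Lemma sumop_adj H K (e' : nat -> K) (e : nat -> H) (he' : orthoseq e')
  (he : orthoseq e) S : is_adjoint (sumop he' he S) (sumop he he' S).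
Proof.
move=> x y; apply/eqP; rewrite -subr_eq0; apply/eqP/cmod_eq0 => eps eps0.
have e2 := divr_gt0 eps0 (ltr0n R 2).
have cst H' (z : H') : rlim (fun=> z) z.
  by move=> a a0; exists 0%N => n _; rewrite subrr rnorm0 ltW.
have [N1 h1] := rlim_dot (sumop_lim he' he S x) (cst _ y) e2.
have [N2 h2] := rlim_dot (cst _ x) (sumop_lim he he' S y) e2.
have {}h1 := h1 _ (leq_maxl N1 N2); have {}h2 := h2 _ (leq_maxr N1 N2).
move: h1 h2; set n := maxn _ _; rewrite psum_adj; set a := hdot x (psum _ _ _ _ _) => h1 h2.
have -> : hdot (sumop he' he S x) y - hdot x (sumop he he' S y) =
  (-1) * (a - hdot (sumop he' he S x) y) + (a - hdot x (sumop he he' S y)) by ring.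
rewrite (le_trans (cmodD _ _))// [leRHS](splitr eps) lerD// cmodM.
by rewrite -(rmorphN1 (real_complex R)) cmod_real normrN1 mul1r.
Qed.

End OrthonormalSums.

(** * A uniform boundedness principle *)

(* A vanishing version of the Nikodym boundedness theorem: an exhaustive [phi] is
   almost determined by finitely many indices, so if the conclusion failed one could
   build, finitely many indices at a time, a set on which [Qpt] fails. *)
Section Nikodym.
Variables (R : realType) (J : Type) (K : hilbert R).
Implicit Types (phi : set J -> K) (S : set J) (l : seq J).

Definition set_additive phi :=
  forall S S', S `&` S' = set0 -> phi (S `|` S') = phi S + phi S'.

Definition exhaustive phi := forall eta : R, 0 < eta -> exists l, forall S,
  (forall j, S j -> ~ List.In j l) -> rnorm (phi S) <= eta.

Lemma set_additiveID phi S A : set_additive phi ->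
  phi S = phi (S `&` A) + phi (S `\` A).
Proof.
move=> ad; rewrite -{1}(setUIDK S A) ad// -subset0 => j [[_ Aj] [_]]; exact.
Qed.

Variable Q : nat -> set (set J -> K).
Hypothesis Qphi : forall m phi, Q m phi -> set_additive phi /\ exhaustive phi.
Hypothesis QS : forall m phi, Q m.+1 phi -> Q m phi.
Hypothesis Qpt : forall S (eps : R), 0 < eps ->
  exists m, forall phi, Q m phi -> rnorm (phi S) <= eps.

Lemma Q_le m n phi : (m <= n)%N -> Q n phi -> Q m phi.
Proof.
elim: n => [|n IH]; first by rewrite leqn0 => /eqP ->.
by rewrite leq_eqVlt => /orP[/eqP ->//|mn /QS]; exact: IH.
Qed.

(** Additivity splits off one point at a time, so [Qpt] is needed only at [set0] and at the finitely
    many singletons of [l]. *)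
Lemma nikodym_finite l (eps : R) : 0 < eps -> exists m, forall phi, Q m phi ->
  forall S, (forall j, S j -> List.In j l) -> rnorm (phi S) <= eps.
Proof.
elim: l eps => [|j l IH] eps eps0.
  have [m mQ] := Qpt set0 eps0; exists m => phi /mQ phi0 S S0.
  suff -> : S = set0 by [].
  by rewrite -subset0 => j /S0.
have e2 := divr_gt0 eps0 (ltr0n R 2).
have [m1 h1] := IH _ e2; have [m2 h2] := Qpt [set j] e2.
have [m3 h3] := Qpt set0 e2.
exists (maxn m1 (maxn m2 m3)) => phi Qm S Sl.
have [ad _] := Qphi Qm.
rewrite (set_additiveID S [set j] ad) (le_trans (rnormD _ _))// [leRHS](splitr eps) lerD//.
  have [Sj|Sj] := pselect (S j).
    rewrite (_ : S `&` _ = [set j]); last by apply/seteqP; split => [k []|k ->].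
    by apply/h2/(Q_le _ Qm); rewrite !leq_max leqnn orbT.
  rewrite (_ : S `&` _ = set0); last by rewrite -subset0 => k [+ kj]; rewrite kj.
  by apply/h3/(Q_le _ Qm); rewrite !leq_max leqnn !orbT.
apply: h1 => [|k [/Sl[<-|//] []]//].
by apply: (Q_le _ Qm); rewrite leq_max leqnn.
Qed.

Lemma nikodym (eps : R) : 0 < eps ->
  exists m, forall phi, Q m phi -> forall S, rnorm (phi S) <= eps.
Proof.
move=> eps0; have e4 := divr_gt0 eps0 (ltr0n R 4).
(* A Baire category step: some finite condition, prescribing a set on [l] to agree with [s], makes
   all of [Q m] small on every set that meets it. Otherwise the conditions could be refined
   forever. *)
have [m [l [s ls]]] : exists m l s, forall phi, Q m phi -> forall S,
    (forall j, List.In j l -> (S j <-> s j)) -> rnorm (phi S) <= eps / 4.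
  apply: contrapT => no.
  have step m (p : seq J * set J) : exists q : seq J * set J,
      [/\ forall j, List.In j p.1 -> List.In j q.1,
          forall j, List.In j p.1 -> (q.2 j <-> p.2 j) &
          exists2 phi, Q m phi & forall S,
            (forall j, List.In j q.1 -> (S j <-> q.2 j)) -> eps / 8 < rnorm (phi S)].
    case: p => l s; apply: contrapT => nq; apply: no; exists m, l, s => phi Qm S Sl.
    rewrite leNgt; apply/negP => big; apply: nq.
    have [ad ex] := Qphi Qm.
    (* Off [l'] the function contributes at most [eps / 16]. Altering [S] outside [L] thus costs at
       most twice that, and of [eps / 4] more than [eps / 8] survives. *)
    have [l' hl'] := ex _ (divr_gt0 eps0 (ltr0n R 16)).
    pose L := [set j | List.In j (l ++ l')].
    exists (l ++ l', S); split => //= [j ?|].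
      by apply/List.in_or_app; left.
    exists phi => // S' SS'.
    have LL : S' `&` L = S `&` L.
      by apply/seteqP; split => j [? Lj]; split => //; apply/(SS' _ Lj).
    have tl T : rnorm (phi (T `\` L)) <= eps / 16.
      by apply: hl' => j [_ Lj] jl; apply/Lj/List.in_or_app; right.
    have := tl S; have := tl S'; have := rnormD (phi (S `&` L)) (phi (S `\` L)).
    rewrite -(set_additiveID S L ad) -LL.
    have := rnormB_le (phi (S' `&` L)) (- phi (S' `\` L)).
    rewrite opprK rnormN -(set_additiveID S' L ad).
    by move: big; lra.
  have /choice[f fP] : forall mp : nat * (seq J * set J), exists q : seq J * set J,
      [/\ forall j, List.In j mp.2.1 -> List.In j q.1,
          forall j, List.In j mp.2.1 -> (q.2 j <-> mp.2.2 j) &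
          exists2 phi, Q mp.1 phi & forall S,
            (forall j, List.In j q.1 -> (S j <-> q.2 j)) -> eps / 8 < rnorm (phi S)].
    by move=> [m p]; exact: step.
  pose st := fix st n := if n is m.+1 then f (m, st m) else ([::], set0).
  have stP m n : (m <= n)%N -> forall j, List.In j (st m).1 ->
      List.In j (st n).1 /\ ((st n).2 j <-> (st m).2 j).
    elim: n => [|n IH]; first by rewrite leqn0 => /eqP ->.
    rewrite leq_eqVlt => /orP[/eqP ->//|mn] j /(IH mn)[jn e].
    have [h1 h2 _] := fP (n, st n); split; first exact: h1.
    by apply: iff_trans (h2 _ jn) e.
  (* The limit set agrees with every stage on its list, so each [Q m] contains a function exceeding
     [eps / 8] at [s], against [Qpt]. *)
  pose s := [set j | exists m, List.In j (st m).1 /\ (st m).2 j].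
  have [m sm] := Qpt s (divr_gt0 eps0 (ltr0n R 8)).
  have [_ _ [phi Qm /(_ s)]] := fP (m, st m).
  rewrite -[f _]/(st m.+1) ltNge sm// => h; suff : false by [].
  apply: h => j jm; split => [[n [jn sn]]|sj]; last by exists m.+1.
  have [_ e1] := stP _ _ (leq_maxl m.+1 n) j jm.
  have [_ e2] := stP _ _ (leq_maxr m.+1 n) j jn.
  by apply/e1/e2.
have [m' hm'] := nikodym_finite l e4.
exists (maxn m m') => phi Qm S; have [ad _] := Qphi Qm.
have Q1 := Q_le (leq_maxl _ _) Qm; have Q2 := Q_le (leq_maxr _ _) Qm.
pose L := [set j | List.In j l].
have fin T : rnorm (phi (T `&` L)) <= eps / 4 by apply: hm' => // j [].
(* Off [L], complete [S] by the part of [s] inside [L]: the union meets the finite condition. Three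
   terms of size [eps / 4] remain: this union, the part of [s] inside [L], and the part of [S]
   inside [L]. *)
have disj : (S `\` L) `&` (s `&` L) = set0.
  by rewrite -subset0 => j [[_ nL] [_ Lj]]; exact: nL.
have : rnorm (phi ((S `\` L) `|` (s `&` L))) <= eps / 4.
  apply: ls => // j jl; split => [[[_ /(_ jl)]//|[]//]|sj]; by right.
rewrite ad// (set_additiveID S L ad).
have := rnormB_le (phi (S `\` L)) (- phi (s `&` L)); rewrite opprK rnormN.
have := rnormD (phi (S `&` L)) (phi (S `\` L)).
have := fin S; have := fin s; lra.
Qed.

End Nikodym.

(** * Coarse spaces and supports *)

(** This is [(F \; E)%relation], with the factors in the order in which a chain of points is read
    from left to right. *)
Definition rcomp (X : Type) (E F : set (X * X)) : set (X * X) :=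
  [set p | exists2 z, E (p.1, z) & F (z, p.2)].

Section CoarseBasics.
Variables (X : Type) (EX : set (set (X * X))).
Hypothesis coarseX : is_coarse EX.

Definition cofinal_entourages (E : nat -> set (X * X)) :=
  [/\ forall n, EX (E n), forall m n, (m <= n)%N -> E m `<=` E n &
      forall F, EX F -> exists n, F `<=` E n].

(** Each stage adds the compositions and inverses of the previous one and one more generator. The
    subsets of stages then form a coarse structure containing all generators, hence all
    entourages. *)
Lemma countably_generated_cofinal : countably_generated EX ->
  exists E, cofinal_entourages E.
Proof.
move=> [G /countable_injP[f finj] EG].
have GEX : G `<=` EX by rewrite EG => A GA M [_]; exact.
(* As [f] is injective on [G], this union has at most one member. *)
pose g n : set (X * X) := \bigcup_(A in [set A | G A /\ f A = n]) A.
have gE n : EX (g n).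
  have [[A [GA fA]]|no] := pselect (exists A, G A /\ f A = n).
    apply: (coarse_sub coarseX) (GEX _ GA) => p [B [GB fB] Bp].
    by rewrite (finj A B) ?inE// fA fB.
  apply: (coarse_sub coarseX) (coarse_diag coarseX) => p [A GA _].
  by exfalso; apply: no; exists A.
pose E := fix E n : set (X * X) := if n is m.+1 then
  (E m `|` (E m \; E m)%relation) `|` ((E m)^-1%relation `|` g m) else diagonal.
have EE n : EX (E n).
  elim: n => [|n IH]; first exact: coarse_diag coarseX.
  apply: (coarse_setU coarseX); apply: (coarse_setU coarseX) => //.
  - exact: (coarse_comp coarseX).
  - exact: (coarse_inv coarseX).
have Emon m n : (m <= n)%N -> E m `<=` E n.
  elim: n => [|n IH]; first by rewrite leqn0 => /eqP ->.
  by rewrite leq_eqVlt => /orP[/eqP ->//|/IH mn] p /mn ?; left; left.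
exists E; split => // F; rewrite EG => /(_ [set F | exists n, F `<=` E n]); apply; split.
  split=> [|A B AB [n Bn]|A B [n An] [m Bm]|A [n An]|A B [n An] [m Bm]].
  - by exists 0%N.
  - by exists n; apply: subset_trans Bn.
  - exists (maxn n m) => p [/An|/Bm]; apply: Emon; [exact: leq_maxl|exact: leq_maxr].
  - by exists n.+1 => p /= /An ?; right; left.
  - exists (maxn n m).+1 => p [z Az Bz]; left; right; exists z.
      exact: (Emon _ _ (leq_maxr n m) _ (Bm _ Az)).
    exact: (Emon _ _ (leq_maxl n m) _ (An _ Bz)).
- by move=> A GA; exists (f A).+1 => p Ap; right; right; exists A.
Qed.

Lemma entS (E F : set (X * X)) : E `<=` F -> EX F -> EX E.
Proof. exact: coarse_sub. Qed.

Lemma ent_rcomp (E F : set (X * X)) : EX E -> EX F -> EX (rcomp E F).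
Proof. by move=> EE EF; exact: (coarse_comp coarseX EF EE). Qed.

Lemma entourage_setM_trans (A B C : set X) (b : X) : B b ->
  EX (A `*` B) -> EX (B `*` C) -> EX (A `*` C).
Proof.
move=> Bb AB BC; apply: entS (ent_rcomp AB BC).
by move=> [a c] [/= Aa Cc]; exists b.
Qed.

Lemma entourage_setM_inv (A B : set X) : EX (A `*` B) -> EX (B `*` A).
Proof. by move=> /(coarse_inv coarseX); apply: entS => -[a c] []. Qed.

Lemma entourage_setM_thick (A B A' B' : set X) (E : set (X * X)) : EX E ->
  EX (A `*` B) -> A' `<=` thickening E A -> B' `<=` thickening E B ->
  EX (A' `*` B').
Proof.
move=> EE AB A'A B'B.
have := ent_rcomp (ent_rcomp EE AB) (coarse_inv coarseX EE).
apply: entS => -[a' b'] [/= /A'A[a Aa Eaa] /B'B[b Bb Ebb]].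
by exists b => //=; exists a.
Qed.

End CoarseBasics.

Definition separated (X : Type) (E : set (X * X)) (B A : set X) :=
  forall b a, B b -> A a -> ~ E (b, a).

Section Discrete.
Variable X : lfcm.
Implicit Types (A B K : set X) (S : set (disc_index X)).
Let coarseX := ent_coarse X.

Definition discU S : set X := \bigcup_(i in S) disc i.

Lemma disc_fun i j (x : X) : disc i x -> disc j x -> i = j.
Proof.
have [_ ti _] := disc_partition (disc_axiom X).
by move=> xi xj; apply: ti => //; exists x.
Qed.

Lemma disc_cover (x : X) : exists i, disc i x.
Proof.
have [cov _ _] := disc_partition (disc_axiom X).
have : cover setT (disc (l := X)) x by rewrite cov.
by move=> [i _ xi]; exists i.
Qed.

Lemma disc_nonempty i : exists x : X, disc i x.
Proof. by have [_ _ /(_ i I)] := disc_partition (disc_axiom X). Qed.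

Lemma meas_set0 : meas (set0 : set X).
Proof. rewrite -setCT; apply: measC; exact: algebra_setT (meas_algebra X). Qed.

Lemma meas_disc i : meas (disc (l := X) i).
Proof. exact: disc_measurable (disc_axiom X) i. Qed.

Lemma meas_discU S : meas (discU S).
Proof.
apply/(disc_local (disc_axiom X)) => i; have [Si|Si] := pselect (S i).
  rewrite setIidr; first exact: meas_disc.
  by move=> x xi; exists i.
rewrite (_ : _ `&` _ = set0); first exact: meas_set0.
by rewrite -subset0 => x [[j Sj xj] xi]; apply: Si; rewrite (disc_fun xi xj).
Qed.

Lemma disc_meas_disc i : disc_meas (disc (l := X) i).
Proof. by split; [exact: meas_disc|move=> p [? ?]; exists i]. Qed.

Lemma disc_meas_sub A : disc_meas A -> A !=set0 -> exists i, A `<=` disc i.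
Proof.
move=> [_ bA] [x Ax]; have [i xi] := disc_cover x; exists i => y Ay.
have [j _ [/= xj yj]] : disc_ent X (x, y) by exact: bA.
by rewrite (disc_fun xi xj).
Qed.

Definition hit K : set (disc_index X) := [set i | K `&` disc i !=set0].

(** Neighbourhoods need not be measurable; [sat] replaces a set by a measurable one at the cost of a
    [disc_ent] thickening. *)
Definition sat K : set X := discU (hit K).

Lemma meas_sat K : meas (sat K).
Proof. exact: meas_discU. Qed.

Lemma sub_sat K : K `<=` sat K.
Proof. by move=> x Kx; have [i xi] := disc_cover x; exists i => //; exists x. Qed.

Lemma sat_thick K : sat K `<=` thickening (disc_ent X) K.
Proof. by move=> x [i [y [Ky yi]] xi]; exists y => //; exists i. Qed.

Lemma seq_In (T : eqType) (s : seq T) x : x \in s -> List.In x s.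
Proof.
elim: s => // y s IH; rewrite inE => /orP[/eqP ->|/IH ?]; first by left.
by right.
Qed.

Lemma bounded_discU K : coarsely_bounded (@ent X) K ->
  exists l : seq (disc_index X), K `<=` discU [set i | List.In i l].
Proof.
move=> /(disc_locally_finite (disc_axiom X)).
move=> /(@finite_seqP {classic (disc_index X)})[s hs].
exists s => x Kx; have [i xi] := disc_cover x; exists i => //=.
apply: (@seq_In {classic (disc_index X)}); suff : [set` s] i by [].
by rewrite -hs; exists x.
Qed.

Lemma fin_disc_discU U : fin_disc U ->
  exists l : seq (disc_index X), U `<=` discU [set i | List.In i l].
Proof.
elim=> [|A B dA _ [l Bl]]; first by exists [::].
have [->|/set0P A0] := eqVneq A set0.
  by exists l; rewrite set0U.
have [i Ai] := disc_meas_sub dA A0; exists (i :: l) => x [/Ai xi|/Bl[j jl xj]].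
  by exists i => //; left.
by exists j => //; right.
Qed.

End Discrete.

Section Support.
Variables (R : realType) (X : lfcm).
Implicit Types (C D : coarse_module R X) (A B : set X).

Definition supported C A (v : C) := ind C A v = v.

Lemma ind_comp C A B (v : C) : meas A -> meas B ->
  ind C A (ind C B v) = ind C (A `&` B) v.
Proof. by move=> mA mB; rewrite (ind_setI mA mB). Qed.

Lemma ind_ind C A (v : C) : meas A -> supported A (ind C A v).
Proof. by move=> mA; rewrite /supported ind_comp// setIid. Qed.

Lemma supportedS C A B (v : C) : meas A -> meas B -> A `<=` B ->
  supported A v -> supported B v.
Proof. exact: ind_sub. Qed.

Lemma supported_disj C A B (v : C) : meas A -> meas B -> A `&` B = set0 ->
  supported A v -> ind C B v = 0.
Proof. by move=> mA mB AB <-; rewrite ind_comp// setIC AB ind_set0. Qed.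

Lemma supportedZ C A a (v : C) : supported A v -> supported A (a *: v).
Proof. by move=> Av; rewrite /supported linearZ /= Av. Qed.

Lemma ind_setC C A (v : C) : meas A -> ind C (~` A) v = v - ind C A v.
Proof.
move=> mA; have := ind_setU mA (measC mA) (setICr A) v.
by rewrite setUv ind_setT => h; rewrite [X in _ = X - _]h addrC addKr.
Qed.

Lemma ind_pythagoras C A (v : C) : meas A ->
  rnorm v ^+ 2 = rnorm (ind C A v) ^+ 2 + rnorm (ind C (~` A) v) ^+ 2.
Proof.
move=> mA; rewrite -pythagoras; last first.
  by rewrite ind_setC// ind_selfadj linearB /= ind_ind// subrr hdot0r.
by rewrite ind_setC// addrC subrK.
Qed.

Lemma ind_le C A B (v : C) : meas A -> meas B -> A `<=` B ->
  rnorm (ind C A v) <= rnorm (ind C B v).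
Proof.
move=> mA mB AB; rewrite -(setIidl AB) -ind_comp//; exact: ind_norm.
Qed.

Lemma ind_dot C A (v : C) : meas A -> hdot v (ind C A v) = (rnorm (ind C A v) ^+ 2)%:C.
Proof. by move=> mA; rewrite rnorm_dot ind_selfadj ind_ind. Qed.

Lemma disc_detect C (v : C) : v != 0 -> exists2 A, disc_meas A & ind C A v != 0.
Proof.
move=> v0; apply: contrapT => no; move/eqP: v0; apply.
apply: (@disc_eq0 _ _ _ _ (bop_id C)) => A dA /=.
by apply: contrapT => /eqP ?; apply: no; exists A.
Qed.

Lemma disc_measI A G : meas A -> disc_meas G -> disc_meas (A `&` G).
Proof.
move=> mA [mG bG]; split; first exact: measI.
by move=> p [[_ ?] [_ ?]]; exact: bG.
Qed.

Lemma ind_eq0 C A (v : C) : meas A ->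
  (forall G, disc_meas G -> G `<=` A -> ind C G v = 0) -> ind C A v = 0.
Proof.
move=> mA h; apply: (disc_eq0 (t := ind C A)) => G dG.
have [mG bG] := dG; rewrite ind_comp//; apply: h => [|x []//].
exact: disc_measI.
Qed.

(** [supp] tests an operator on small sets only; [ind_eq0] and [disc_eq0] extend the vanishing to
    arbitrary measurable sets. *)
Lemma controlled_separated C D (s : bop C D) E B A x : supp s `<=` E ->
  meas A -> meas B -> separated E B A -> ind D B (s (ind C A x)) = 0.
Proof.
move=> sE mA mB BA; apply: ind_eq0 => // G dG GB.
apply: (disc_eq0 (t := bop_comp (ind D G) (bop_comp s (ind C A)))) => G' dG' /=.
rewrite ind_comp//; last by case: dG'.
apply: contrapT => /eqP nz.
have [b Gb] : G !=set0.
  by apply/set0P/eqP => G0; move: nz; rewrite G0 ind_set0 eqxx.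
have [a [Aa Ga]] : A `&` G' !=set0.
  by apply/set0P/eqP => G0; move: nz; rewrite G0 ind_set0 (linear0 s) linear0 eqxx.
apply: (BA b a (GB _ Gb) Aa); apply: sE.
exists (A `&` G'), G; split=> //; first exact: disc_measI.
by exists x.
Qed.

Lemma quasi_local C D (t : bop C D) (eps : R) : approximable t -> 0 < eps ->
  exists2 E, ent E & forall B A, meas A -> meas B -> separated E B A ->
    forall x, rnorm (ind D B (t (ind C A x))) <= eps * rnorm x.
Proof.
move=> at_ eps0; have [s cs ts] := at_ _ eps0.
exists (supp s) => // B A mA mB BA x.
have -> : ind D B (t (ind C A x)) = ind D B (t (ind C A x) - s (ind C A x)).
  by rewrite [RHS]linearB /= (controlled_separated x (fun p h => h) mA mB BA) subr0.
apply: le_trans (ind_norm _ _) _.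
have := le_opnorm (bop_lin (-1) s t) (ind C A x).
have -> : (bop_lin (-1) s t : C -> D) = (fun x => t x - s x).
  by apply/funext => y /=; rewrite scaleN1r addrC.
move=> h; apply: le_trans h _; apply: ler_pM; rewrite ?rnorm_ge0 ?(ltW ts)//.
- rewrite -[X in opnorm X](_ : (bop_lin (-1) s t : C -> D) = _) ?opnorm_ge0//.
  by apply/funext => y /=; rewrite scaleN1r addrC.
- exact: ind_norm.
Qed.

(** By density [x] is close to a vector supported in finitely many pieces. This is exhaustiveness
    for sets of pieces. *)
Lemma ind_tail C (x : C) (eta : R) : 0 < eta ->
  exists l : seq (disc_index X), forall S,
    (forall j, S j -> ~ List.In j l) -> rnorm (ind C (discU S) x) <= eta.
Proof.
move=> eta0; have [u /span_fin_disc[U fU Uu] xu] :=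
  dense_rnorm (ind_dense (c := C)) x eta0.
have [l Ul] := fin_disc_discU fU; exists l => S Sl.
have uS : ind C (discU S) u = 0.
  apply: supported_disj Uu; [exact: fin_disc_meas|exact: meas_discU|].
  by rewrite -subset0 => y [/Ul[i il yi] [j Sj yj]]; apply: (Sl j) => //;
    rewrite -(disc_fun yi yj).
have -> : ind C (discU S) x = ind C (discU S) (x - u) by rewrite linearB /= uS subr0.
exact: le_trans (ind_norm _ _) (ltW xu).
Qed.

Lemma theta_supp C D (w : D) (v : C) A B : meas A -> meas B ->
  supported A v -> supported B w ->
  supp (theta w v) `<=` rcomp (disc_ent X) (rcomp (B `*` A) (disc_ent X)).
Proof.
move=> mA mB Av Bw [y x] [G [G' [dG dG' [h nz] [/= G'y Gx]]]].
have [mG bG] := dG; have [mG' bG'] := dG'.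
have [a [Ga Aa]] : G `&` A !=set0.
  apply/set0P/eqP => GA; move: nz.
  by rewrite thetaE ind_selfadj -Av ind_comp// GA ind_set0 hdot0r scale0r linear0 eqxx.
have [b [Gb Bb]] : G' `&` B !=set0.
  apply/set0P/eqP => GB; move: nz.
  by rewrite thetaE linearZ /= -Bw ind_comp// GB ind_set0 scaler0 eqxx.
exists b; first exact: bG'.
by exists a => //; exact: bG.
Qed.

Lemma theta_controlled C D (w : D) (v : C) A B : meas A -> meas B ->
  supported A v -> supported B w -> ent (B `*` A) -> controlled (theta w v).
Proof.
move=> mA mB Av Bw BA; apply: (coarse_sub (ent_coarse X)) (theta_supp mA mB Av Bw) _.
have dX := disc_ent_entourage X.
by apply: (ent_rcomp (ent_coarse X)) => //; exact: (ent_rcomp (ent_coarse X)).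
Qed.

Lemma controlled_approximable C D (t : bop C D) : controlled t -> approximable t.
Proof.
move=> ct e e0; exists t => //; apply: le_lt_trans e0; apply: opnorm_le => // x.
by rewrite subrr rnorm0 mul0r.
Qed.

Lemma sumop_controlled C D (e' : nat -> D) (e : nat -> C) (he' : orthoseq e')
  (he : orthoseq e) S E : ent E -> (forall n, supp (theta (e' n) (e n)) `<=` E) ->
  controlled (sumop he' he S).
Proof.
move=> EE tE; apply: (coarse_sub (ent_coarse X)) EE => p [A [B [dA dB [x nz] BA]]].
have [n nz'] : exists n, ind D B (theta (e' n) (e n) (ind C A x)) != 0.
  apply: contrapT => no; move/eqP: nz; apply.
  apply: (rlim0 (rlim_bop (ind D B) (sumop_lim he' he S (ind C A x)))) => n.
  elim: n => [|n IH]; first by rewrite psum0 linear0.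
  rewrite psumS linearD /= IH addr0 linearZ /= -thetaE.
  have -> : ind D B (theta (e' n) (e n) (ind C A x)) = 0; last exact: scaler0.
  by apply: contrapT => /eqP ?; apply: no; exists n.
by apply: (tE n); exists A, B; split => //; exists x.
Qed.

End Support.

(** Dependent choice where each term may depend on all earlier ones, listed latest first; [ok] is
    the invariant that keeps the construction going. *)
Lemma history_choice (T : Type) (ok : seq T -> Prop) (P : seq T -> T -> Prop) :
  ok [::] -> (forall l, ok l -> exists x, P l x /\ ok (x :: l)) ->
  exists (f : nat -> T) (l : nat -> seq T),
    [/\ l 0%N = [::], forall k, l k.+1 = f k :: l k & forall k, P (l k) (f k)].
Proof.
move=> ok0 step; have [x0 _] := step _ ok0.
have /choice[g gP] : forall l, exists x, ok l -> P l x /\ ok (x :: l).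
  move=> l; have [okl|nok] := pselect (ok l); last by exists x0.
  by have [x] := step _ okl; exists x.
pose l := fix l k := if k is j.+1 then g (l j) :: l j else [::].
have lok k : ok (l k) by elim: k => //= k /gP[].
by exists (fun k => g (l k)), l; split => // k; case: (gP (l k) (lok k)).
Qed.

Section Unitary.
Variables (R : realType) (H K : hilbert R) (U : bop H K) (Us : bop K H).
Hypothesis UU : Defs.is_unitary U Us.

Lemma unitary_norm x : rnorm (U x) = rnorm x.
Proof.
by have [ad UsU _] := UU; apply: rnorm_eq_dot; rewrite ad UsU.
Qed.

Lemma unitary_sym : Defs.is_unitary Us U.
Proof.
have [ad UsU UUs] := UU; split => // x y.
by rewrite -[x in RHS]UUs ad UsU.
Qed.

End Unitary.

Section Scaling.
Variables (R : realType) (H : hilbert R).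

Definition normalize (v : H) : H := ((rnorm v)^-1)%:C *: v.

Lemma normalize_norm v : v != 0 -> rnorm (normalize v) = 1.
Proof.
move=> v0; rewrite rnormZE cmod_real ger0_norm ?invr_ge0 ?rnorm_ge0//.
by rewrite mulVf// gt_eqF// rnorm_gt0.
Qed.

Lemma normalizeK v : v = (rnorm v)%:C *: normalize v.
Proof.
have [->|v0] := eqVneq v 0; first by rewrite /normalize !scaler0.
by rewrite scalerA -rmorphM mulfV ?scale1r// gt_eqF// rnorm_gt0.
Qed.

Lemma rnormZr (r : R) (v : H) : 0 <= r -> rnorm (r%:C *: v) = r * rnorm v.
Proof. by move=> r0; rewrite rnormZE cmod_real ger0_norm. Qed.

Lemma bop_normalize (K : hilbert R) (t : bop H K) v :
  rnorm (t v) = rnorm v * rnorm (t (normalize v)).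
Proof.
rewrite {1}(normalizeK v) linearZ /= rnormZE cmod_real.
by rewrite ger0_norm ?rnorm_ge0.
Qed.

End Scaling.

(** * Transport of rank-one operators *)

(* [Psi] plays the role of [t |-> U' t U^*], up to phases. *)
Record transport (R : realType) (X Y : lfcm) (C C' : coarse_module R X)
    (D D' : coarse_module R Y) (U : bop C D) (U' : bop C' D')
    (Psi : approx_op C C' -> approx_op D D') : Prop := Transport {
  transport_add : forall r s t : approx_op C C', (forall x, r x = s x + t x) ->
    forall y, Psi r y = Psi s y + Psi t y;
  transport_norm : forall (t : approx_op C C') (s : approx_op C' C),
    is_adjoint t s -> forall x, rnorm (Psi t (U x)) = rnorm (t x);
  transport_theta : forall (t : approx_op C C') (s : approx_op C' C) v v',
    t =1 theta v' v -> s =1 theta v v' -> rnorm v = 1 -> rnorm v' = 1 ->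
    exists2 c : R[i], cmod c = 1 & forall y, Psi t y = (c * hdot y (U v)) *: U' v' }.

Section TransportSums.
Variables (R : realType) (X Y : lfcm) (C C' : coarse_module R X).
Variables (D D' : coarse_module R Y) (U : bop C D) (U' : bop C' D').
Variable Psi : approx_op C C' -> approx_op D D'.
Hypothesis Psi_tr : transport U U' Psi.
Variable Us : bop D C.
Hypothesis UU : Defs.is_unitary U Us.
Variable F : nat -> set (Y * Y).
Hypothesis cofF : cofinal_entourages (@ent Y) F.

Lemma separatedS (T : Type) (E E' : set (T * T)) B A : E `<=` E' ->
  separated E' B A -> separated E B A.
Proof. by move=> EE' s b a Bb Aa /EE'; exact: s. Qed.

(** Up to a phase [Psi t] is the rank-one operator from [U v] to [U' v'], and the inner product of
    [ind D B (U v)] with [U v] is the squared norm of the former. *)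
Lemma transport_theta_norm (t : approx_op C C') (s : approx_op C' C) v v' B B' :
  t =1 theta v' v -> s =1 theta v v' -> rnorm v = 1 -> rnorm v' = 1 -> meas B ->
  rnorm (ind D' B' (Psi t (ind D B (U v)))) =
    rnorm (ind D B (U v)) ^+ 2 * rnorm (ind D' B' (U' v')).
Proof.
move=> tE sE v1 v'1 mB; have [c c1 ->] := transport_theta Psi_tr tE sE v1 v'1.
rewrite linearZ /= rnormZE cmodM c1 mul1r hdotC ind_dot// cmod_conj cmod_real.
by rewrite ger0_norm// sqr_ge0.
Qed.

(** [nikodym] for the functions [S |-> ind D' B' (Psi (t S) (ind D B y))]: smallness at a fixed [S]
    is quasi-locality of the single operator [Psi (t S)], and the product in the conclusion is the
    norm of the value at the singleton of [n] for [y = U (e n)]. *)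
Lemma transport_sum (e : nat -> C) (e' : nat -> C') (E E' : set (X * X)) :
  orthoseq e -> orthoseq e' -> ent E -> ent E' ->
  (forall n, supp (theta (e' n) (e n)) `<=` E) ->
  (forall n, supp (theta (e n) (e' n)) `<=` E') ->
  forall eps : R, 0 < eps -> exists m, forall n B B', meas B -> meas B' ->
    separated (F m) B' B ->
    rnorm (ind D B (U (e n))) ^+ 2 * rnorm (ind D' B' (U' (e' n))) <= eps.
Proof.
move=> he he' EE EE' tE tE' eps eps0.
pose t S : approx_op C C' :=
  ApproxOp (controlled_approximable (sumop_controlled he' he S EE tE)).
pose s S : approx_op C' C :=
  ApproxOp (controlled_approximable (sumop_controlled he he' S EE' tE')).
have ts S : is_adjoint (t S) (s S) by exact: sumop_adj.
pose Q m (phi : set nat -> D') := exists B B' y, [/\ meas B, meas B',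
  separated (F m) B' B, rnorm y <= 1 &
  phi = fun S => ind D' B' (Psi (t S) (ind D B y))].
have [_ Fmon Fcof] := cofF.
have [m|m|S eta eta0|m mQ] := @nikodym _ _ _ Q _ _ _ eps eps0.
- move=> _ [B [B' [y [mB mB' _ _ ->]]]]; split => [S S' SS'|eta eta0].
    rewrite (transport_add Psi_tr (s := t S) (t := t S')) ?linearD//= => x.
    exact: sumop_setU.
  (* [transport_norm] carries the tail estimate from [t S] over to [Psi (t S)]. *)
  have [N hN] := sumop_tail he' he (Us (ind D B y)) eta0.
  exists (iota 0 N) => S Sl; apply: le_trans (ind_norm _ _) _.
  have [_ _ UUs] := UU; rewrite -(UUs (ind D B y)) (transport_norm Psi_tr (ts S)).
  apply: hN => i Si; rewrite leqNgt; apply/negP => iN; apply: (Sl i Si).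
  by apply: seq_In; rewrite mem_iota.
- move=> phi [B [B' [y [mB mB' sep y1 phiE]]]]; exists B, B', y; split => //.
  by apply: separatedS sep; exact: Fmon.
- have [G GE ql] := quasi_local (aop_approximable (Psi (t S))) eta0.
  have [m Gm] := Fcof _ GE; exists m => _ [B [B' [y [mB mB' sep y1 ->]]]].
  have := ql B' B mB mB' (separatedS Gm sep) y; move/le_trans; apply.
  by rewrite ler_piMr// ltW.
- exists m => n B B' mB mB' sep.
  rewrite -(@transport_theta_norm (t [set n]) (s [set n]))//; first last.
  + exact: orthoseq_norm.
  + exact: orthoseq_norm.
  + by move=> x /=; rewrite sumop1.
  + by move=> x /=; rewrite sumop1.
  + apply: (mQ (fun S => ind D' B' (Psi (t S) (ind D B (U (e n)))))).
    exists B, B', (U (e n)); split => //.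
    by rewrite (unitary_norm UU) orthoseq_norm.
Qed.

End TransportSums.

Section TransportBounded.
Variables (R : realType) (X Y : lfcm) (C : coarse_module R X).
Variables (D : coarse_module R Y) (U : bop C D) (Us : bop D C).
Hypothesis UU : Defs.is_unitary U Us.
Variable Psi : approx_op C C -> approx_op D D.
Hypothesis Psi_tr : transport U U Psi.
Variable F : nat -> set (Y * Y).
Hypothesis cofF : cofinal_entourages (@ent Y) F.
Variable A : set X.
Hypotheses (mA : meas A) (entA : ent (A `*` A)).

Section Neighbourhoods.
Variables (v0 : C) (B0 : set Y).
Hypotheses (Av0 : supported A v0) (v01 : rnorm v0 = 1).
Hypotheses (dB0 : disc_meas B0) (Bv0 : ind D B0 (U v0) != 0).

(** Measurable bounded sets that eventually contain any given entourage neighbourhood of [B0]. *)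
Let Bn n : set Y := sat (thickening (F n) B0).

Let mBn n : meas (Bn n). Proof. exact: meas_sat. Qed.

Let Bn_le m n : (m <= n)%N -> Bn m `<=` Bn n.
Proof.
have [_ Fmon _] := cofF.
move=> mn x [i [y [[b Bb Fyb] yi]] xi]; exists i => //; exists y; split => //.
by exists b => //; exact: Fmon Fyb.
Qed.

Let entBn n : ent (Bn n `*` Bn n).
Proof.
have [FE _ _] := cofF; have [_ bB0] := dB0.
have entB0 : ent (B0 `*` B0) by apply: entS (disc_ent_entourage Y); [exact: ent_coarse|].
pose T := rcomp (disc_ent Y) (F n).
have TE : ent T by apply: ent_rcomp => //; [exact: ent_coarse|exact: disc_ent_entourage].
have BT : Bn n `<=` thickening T B0.
  by move=> x /sat_thick[y [b Bb Fyb] xy]; exists b => //; exists y.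
exact: (entourage_setM_thick (ent_coarse Y) TE entB0 BT BT).
Qed.

(** The rank-one operator from [v0] to [normalize v] is controlled because [A] is bounded, so its
    image is quasi-local. As [B0] catches a fixed part [b] of [U v0], little of [U v] can lie far
    from [B0]; the factor [b ^+ 2] in the tolerance cancels against that part. *)
Let Bn_cvg v (eta : R) : supported A v -> 0 < eta ->
  exists n, forall m, (n <= m)%N -> rnorm (ind D (~` Bn m) (U v)) <= eta.
Proof.
move=> Av eta0; have [->|vn0] := eqVneq v 0.
  by exists 0%N => m _; rewrite !linear0 rnorm0 ltW.
have v1 := normalize_norm vn0; have nv := rnorm_gt0 vn0.
have Av1 : supported A (normalize v) by exact: supportedZ.
have [mB0 _] := dB0.
pose t : approx_op C C :=
  ApproxOp (controlled_approximable (theta_controlled mA mA Av0 Av1 entA)).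
pose s : approx_op C C :=
  ApproxOp (controlled_approximable (theta_controlled mA mA Av1 Av0 entA)).
set b := rnorm (ind D B0 (U v0)); have b0 : 0 < b ^+ 2 by rewrite exprn_gt0// rnorm_gt0.
have eps0 : 0 < eta / rnorm v * b ^+ 2 by rewrite mulr_gt0// divr_gt0.
have [G GE ql] := quasi_local (aop_approximable (Psi t)) eps0.
have [FE Fmon Fcof] := cofF.
have [n Gn] := Fcof _ GE; exists n => m nm.
have sep : separated G (~` Bn m) B0.
  move=> x y nBx By /Gn Fxy; apply: nBx; apply: (Bn_le nm).
  by apply: sub_sat; exists y.
have := ql _ _ mB0 (measC (mBn m)) sep (U v0).
rewrite (transport_theta_norm Psi_tr (t := t) (s := s) (v := v0) (v' := normalize v))//.
rewrite (unitary_norm UU) v01 mulr1.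
rewrite mulrC ler_pM2r// => h.
rewrite (bop_normalize (bop_comp (ind D (~` Bn m)) U)).
by move: h; rewrite ler_pdivlMr// mulrC.
Qed.

Let Bn_sep k m : exists h, separated (F k) (~` Bn h) (Bn m).
Proof.
have [FE Fmon Fcof] := cofF; have cY := ent_coarse Y.
have [h hh] := Fcof _ (ent_rcomp cY (FE k) (ent_rcomp cY (disc_ent_entourage Y) (FE m))).
exists h => x y nBx /sat_thick[z [b Bb Fzb] yz] Fxy; apply: nBx.
by apply: sub_sat; exists b => //; apply: hh; exists y => //; exists z.
Qed.

Let ok := fix ok (l : seq C) : Prop := if l is x :: l' then
  [/\ ok l', supported A x, rnorm x = 1 & forall y, y \in l' -> hdot x y = 0] else True.

(* Otherwise there is an orthonormal sequence [e] in [A] such that [U (e k)] escapes every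
   bounded set; the sums of [theta (e k.+1) (e k)] over arbitrary sets of indices are
   controlled, and [transport_sum] is contradicted. *)
Lemma transport_bounded_aux (eps : R) : 0 < eps ->
  exists B, [/\ meas B, ent (B `*` B) & forall v, supported A v ->
    rnorm (ind D (~` B) (U v)) <= eps * rnorm v].
Proof.
move=> eps0; suff [n hn] : exists n, forall v, supported A v ->
    rnorm (ind D (~` Bn n) (U v)) <= eps * rnorm v by exists (Bn n); split.
move: eps0.
move=> eps0; apply: contrapT => no.
have big n : exists v, [/\ supported A v, rnorm v <= 1 &
    eps < rnorm (ind D (~` Bn n) (U v))].
  apply: contrapT => nv; apply: no; exists n => v Av.
  rewrite leNgt; apply/negP => lt; apply: nv; exists (normalize v).
  have vn0 : v != 0.
    by apply: contraTneq lt => ->; rewrite !linear0 !rnorm0 mulr0 ltxx.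
  rewrite normalize_norm//; split => //; first exact: supportedZ.
  move: lt; rewrite (bop_normalize (bop_comp (ind D (~` Bn n)) U)).
  by rewrite mulrC ltr_pM2l// rnorm_gt0.
(* Gram-Schmidt. The image of each earlier [x] is negligible outside [Bn m] for large [m], so
   removing the component along [x] costs at most [(eps - e) / 2]; starting above [(e + eps) / 2]
   leaves more than [e]. *)
have bigl l : ok l -> forall e n, e < eps -> exists v, [/\ supported A v, rnorm v <= 1,
    forall y, y \in l -> hdot v y = 0 & e < rnorm (ind D (~` Bn n) (U v))].
  elim: l => [_ e n lt|x l IH [okl Ax x1 xl] e n lt].
    by have [v [Av v1 h]] := big n; exists v; split => //; exact: lt_trans h.
  have e1 : 0 < (eps - e) / 2 by rewrite divr_gt0// subr_gt0.
  have [m hm] := Bn_cvg Ax e1.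
  have e2 : (e + eps) / 2 < eps by move: lt; lra.
  have [v [Av v1 vl vB]] := IH okl _ (maxn n m) e2.
  set r := v - hdot v x *: x.
  have rx : hdot r x = 0 by rewrite hdotBl hdotZl -rnorm_dot x1 expr1n mulr1 subrr.
  have vE : rnorm v ^+ 2 = rnorm r ^+ 2 + rnorm (hdot v x *: x) ^+ 2.
    by rewrite -pythagoras ?subrK// hdotZr rx mulr0.
  exists r; split.
  - by rewrite /supported linearB linearZ /= Av Ax.
  - apply: le_trans v1; rewrite -(@ler_pXn2r _ 2) ?nnegrE ?rnorm_ge0// vE.
    by rewrite lerDl sqr_ge0.
  - move=> y; rewrite inE => /orP[/eqP ->//|yl].
    by rewrite hdotBl hdotZl vl// xl// mulr0 subrr.
  - apply: (@lt_le_trans _ _ (rnorm (ind D (~` Bn (maxn n m)) (U r)))); last first.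
      apply: ind_le; [exact: measC|exact: measC|].
      by apply: subsetC; apply: Bn_le; exact: leq_maxl.
    rewrite /r linearB linearZ /= linearB linearZ /=.
    apply: lt_le_trans (rnormB_le _ _); rewrite rnormZE.
    have c1 : cmod (hdot v x) <= 1.
      by apply: le_trans (cauchy_schwarz _ _) _; rewrite x1 mulr1.
    have := ler_pM (cmod_ge0 _) (rnorm_ge0 _) c1 (hm _ (leq_maxr n m)).
    by move: vB; rewrite mul1r; lra.
have /choice[M hM] x : exists n, supported A x -> forall m, (n <= m)%N ->
    rnorm (ind D (~` Bn m) (U x)) <= 1 / 2.
  have [Ax|] := pselect (supported A x); last by exists 0%N.
  by have [n hn] := Bn_cvg Ax (divr_gt0 ltr01 (ltr0n R 2)); exists n.
have /choice[h hh] : forall km : nat * nat, exists h,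
    separated (F km.1) (~` Bn h) (Bn km.2) by move=> [k m]; exact: Bn_sep.
(* The image of the latest vector [y] has norm at most 1/2 outside [Bn (M y)]. The next vector has
   to be visible outside a set whose complement is [F k]-separated from [Bn (M y)], with [k] the
   length of the history. *)
pose N (l : seq C) := if l is y :: _ then h (size l, M y) else 0%N.
pose P (l : seq C) x := [/\ supported A x, rnorm x = 1, forall y, y \in l -> hdot x y = 0 &
  exists2 n, (N l <= n)%N & eps / 2 < rnorm (ind D (~` Bn n) (U x))].
have [||e [l [l0 lS eP]]] := @history_choice _ ok P; first by [].
  move=> l okl; have e2 : eps / 2 < eps by move: eps0; lra.
  have [v [Av v1 vl vB]] := bigl l okl _ (N l) e2.
  have v0' : v != 0.
    by apply: contraTneq vB => ->; rewrite !linear0 rnorm0 -leNgt ltW// divr_gt0.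
  have nv := normalize_norm v0'.
  have Av' : supported A (normalize v) by exact: supportedZ.
  have vl' y : y \in l -> hdot (normalize v) y = 0 
    by move=> /vl; rewrite hdotZl => ->; rewrite mulr0.
  exists (normalize v); split => //; split => //; exists (N l) => //.
  apply: lt_le_trans vB _; rewrite (bop_normalize (bop_comp (ind D _) U)).
  by rewrite ler_piMl// rnorm_ge0.
have el j k : (j < k)%N -> e j \in l k.
  elim: k => // k IH; rewrite ltnS lS inE leq_eqVlt => /orP[/eqP ->|/IH ->].
    by rewrite eqxx.
  by rewrite orbT.
have szl k : size (l k) = k by elim: k => [|k IH]; rewrite ?l0// lS /= IH.
have Ae k : supported A (e k) by case: (eP k).
have he : orthoseq e.
  move=> i j; have [ij|ji|<-] := ltngtP i j.
  - by apply: hdot_eq0C; have [_ _ + _] := eP j; apply; exact: el.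
  - by have [_ _ + _] := eP i; apply; exact: el.
  - by rewrite -rnorm_dot; have [_ -> _ _] := eP i; rewrite expr1n.
have he' : orthoseq (fun k => e k.+1) by move=> i j; rewrite he eqSS.
have [FE Fmon Fcof] := cofF; have cX := ent_coarse X.
have dX := disc_ent_entourage X.
have EE : ent (rcomp (disc_ent X) (rcomp (A `*` A) (disc_ent X))).
  by apply: (ent_rcomp cX) => //; exact: (ent_rcomp cX).
have [] := @transport_sum _ _ _ _ _ _ _ _ _ _ Psi_tr Us UU F cofF e _ _ _ he he' EE EE _ _ (eps / 4).
- by move=> n; exact: theta_supp.
- by move=> n; exact: theta_supp.
- by rewrite divr_gt0.
move=> m hm.
have [_ _ _ [n nN nB]] := eP m.+1.
have sep : separated (F m) (~` Bn n) (Bn (M (e m))).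
  move=> x y nBx By Fxy; apply: (hh (m.+1, M (e m)) x y) => //.
    move=> Bx; apply: nBx; apply: (Bn_le nN); move: Bx.
    by rewrite /N lS /= szl.
  by apply: (Fmon m) Fxy.
have := hm m _ _ (mBn (M (e m))) (measC (mBn n)) sep.
have := ind_pythagoras (U (e m)) (mBn (M (e m))).
have := hM _ (Ae m) _ (leqnn _); have := rnorm_ge0 (ind D (~` Bn (M (e m))) (U (e m))).
rewrite (unitary_norm UU) (orthoseq_norm he).
move: nB; set a := rnorm (ind D (~` Bn n) _); set b := rnorm (ind D (~` _) _).
set c := rnorm (ind D (Bn _) _) ^+ 2 => nB b0 b1 h1.
(* At least 3/4 of the squared norm of [U (e m)] lies in [Bn (M (e m))], and [U (e m.+1)] has norm
   more than [eps / 2] outside [Bn n]: the product exceeds the bound [eps / 4]. *)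
have c1 : 3 / 4 <= c by nra.
have a0 : 0 <= a by exact: rnorm_ge0.
by nra.
Qed.

End Neighbourhoods.

Lemma transport_bounded (eps : R) : 0 < eps ->
  exists B, [/\ meas B, ent (B `*` B) & forall v, supported A v ->
    rnorm (ind D (~` B) (U v)) <= eps * rnorm v].
Proof.
move=> eps0; have [[v [Av v0]]|no] := pselect (exists v : C, supported A v /\ v != 0).
  have Uv0 : U (normalize v) != 0.
    apply/eqP => h; have := normalize_norm v0.
    by rewrite -(unitary_norm UU) h rnorm0 => /esym/eqP; rewrite oner_eq0.
  have [B0 dB0 Bv0] := disc_detect Uv0.
  have Av' : supported A (normalize v) by exact: supportedZ.
  exact: (transport_bounded_aux Av' (normalize_norm v0) dB0 Bv0 eps0).
have s0 : (set0 : set Y) `*` set0 `<=` disc_ent Y by move=> ? [].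
exists set0; split;
  [exact: meas_set0|exact: (entS (ent_coarse Y) s0 (disc_ent_entourage Y))|].
move=> v Av; have -> : v = 0 by apply: contrapT => /eqP v0; apply: no; exists v.
by rewrite !linear0 !rnorm0 mulr0.
Qed.

End TransportBounded.

Section TransportControlled.
Variables (R : realType) (X Y : lfcm) (C C' : coarse_module R X).
Variables (D D' : coarse_module R Y) (U : bop C D) (U' : bop C' D').
Variables (Us : bop D C) (Us' : bop D' C').
Hypotheses (UU : Defs.is_unitary U Us) (UU' : Defs.is_unitary U' Us').
Variables (Psi : approx_op C C' -> approx_op D D').
Variables (Psi1 : approx_op C C -> approx_op D D).
Variables (Psi2 : approx_op C' C' -> approx_op D' D').
Hypotheses (Psi_tr : transport U U' Psi) (Psi_tr1 : transport U U Psi1)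
  (Psi_tr2 : transport U' U' Psi2).
Variable F : nat -> set (Y * Y).
Hypothesis cofF : cofinal_entourages (@ent Y) F.

(** One rectangle of [approx_relation], with the operator norm replaced by a unit vector that
    witnesses it. *)
Definition concentrated (C0 : coarse_module R X) (D0 : coarse_module R Y)
    (V : bop C0 D0) (E : set (X * X)) (F1 : set (Y * Y)) (delta : R)
    (A : set X) (v : C0) (B : set Y) : Prop :=
  [/\ meas A /\ bounded_by E A, supported A v, rnorm v = 1,
      meas B /\ bounded_by F1 B & delta < rnorm (ind D0 B (V v))].

Lemma concentrated_meet (C0 : coarse_module R X) (D0 : coarse_module R Y)
    (V : bop C0 D0) E F1 delta A v B (A0 : set X) (B0 : set Y) : 0 < delta ->
  concentrated V E F1 delta A v B -> meas A0 -> A `<=` A0 -> meas B0 ->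
  (forall v, supported A0 v -> rnorm (ind D0 (~` B0) (V v)) <= delta / 2 * rnorm v) ->
  B `&` B0 !=set0.
Proof.
move=> delta0 [[mA _] Av v1 [mB _] vB] mA0 AA0 mB0 h; apply/set0P/eqP => BB0.
have := h _ (supportedS mA mA0 AA0 Av); rewrite v1 mulr1 => vB0.
have := @ind_le _ _ D0 _ _ (V v) mB (measC mB0) (proj1 (disjoints_subset _ _) BB0).
by move: vB vB0; lra.
Qed.

(** Between [B] and [B'] the image of the rank-one operator from [v] to [v'] has size more than
    [delta ^+ 2 * delta]; quasi-locality at half of this prevents the two sets from being
    separated. *)
Lemma transport_link E F1 delta A A' v v' B B' : 0 < delta -> ent (A' `*` A) ->
  concentrated U E F1 delta A v B -> concentrated U' E F1 delta A' v' B' ->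
  exists2 G, ent G & exists b' b, [/\ B' b', B b & G (b', b)].
Proof.
move=> delta0 AA [[mA _] Av v1 [mB _] vB] [[mA' _] Av' v1' [mB' _] vB'].
have AA' := entourage_setM_inv (ent_coarse X) AA.
pose t : approx_op C C' :=
  ApproxOp (controlled_approximable (theta_controlled mA mA' Av Av' AA)).
pose s : approx_op C' C :=
  ApproxOp (controlled_approximable (theta_controlled mA' mA Av' Av AA')).
have d3 : 0 < delta ^+ 3 / 2 by rewrite divr_gt0// exprn_gt0.
have [G GE ql] := quasi_local (aop_approximable (Psi t)) d3.
exists G => //; apply: contrapT => no.
have sep : separated G B' B by move=> b' b ? ? ?; apply: no; exists b', b.
have := ql _ _ mB mB' sep (U v).
rewrite (transport_theta_norm Psi_tr (t := t) (s := s) (v := v) (v' := v'))//.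
rewrite (unitary_norm UU) v1 mulr1 leNgt => /negP; apply.
apply: (@lt_trans _ _ (delta ^+ 3)).
  by rewrite ltr_pdivrMr// ltr_pMr ?ltr1n// exprn_gt0.
rewrite exprSr; apply: ltr_pM; rewrite ?exprn_ge0// ?ltW//.
by rewrite ltr_pXn2r ?nnegrE ?rnorm_ge0// ltW.
Qed.

Lemma supported_orth (C0 : coarse_module R X) A A' (v v' : C0) : meas A -> meas A' ->
  A `&` A' = set0 -> supported A v -> supported A' v' -> hdot v v' = 0.
Proof.
move=> mA mA' AA' Av Av'; rewrite -Av ind_selfadj (supported_disj mA' mA _ Av') ?hdot0r//.
by rewrite setIC.
Qed.

Lemma sat_bounded (Z : lfcm) (E : set (Z * Z)) i : ent E ->
  ent (sat (thickening E (disc (l := Z) i)) `*` sat (thickening E (disc (l := Z) i))).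
Proof.
move=> EE; have cZ := ent_coarse Z; have dZ := disc_ent_entourage Z.
have iE : ent (disc (l := Z) i `*` disc (l := Z) i).
  by apply: (entS cZ) dZ => p ?; exists i.
have T : sat (thickening E (disc (l := Z) i)) `<=`
    thickening (rcomp (disc_ent Z) E) (disc (l := Z) i).
  by move=> x /sat_thick[y [b Bb Fyb] xy]; exists b => //; exists y.
exact: (entourage_setM_thick cZ (ent_rcomp cZ dZ EE) iE T T).
Qed.

(* A sequence of counterexamples either returns infinitely often to some piece of the
   discrete partition of [X], where [transport_bounded] applies, or has a subsequence with
   disjoint supports, where [transport_sum] does. *)
Lemma transport_controlled E F1 (delta : R) : ent E -> ent F1 -> 0 < delta ->
  exists2 G, ent G & forall A A' v v' B B', A' `*` A `<=` E ->
    concentrated U E F1 delta A v B -> concentrated U' E F1 delta A' v' B' ->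
    B' `*` B `<=` G.
Proof.
move=> EE F1E delta0; apply: contrapT => no.
have cX := ent_coarse X; have cY := ent_coarse Y.
have dX := disc_ent_entourage X.
have [FE Fmon Fcof] := cofF.
have /choice[A /choice[A' /choice[v /choice[v' /choice[B /choice[B' bad]]]]]] n :
    exists A A' v v' B B', [/\ A' `*` A `<=` E, concentrated U E F1 delta A v B,
      concentrated U' E F1 delta A' v' B' & ~ (B' `*` B `<=` F n)].
  apply: contrapT => nb; apply: no; exists (F n) => // A A' v v' B B' AE c c'.
  by apply: contrapT => nB; apply: nb; exists A, A', v, v', B, B'.
have AAE n : ent (A' n `*` A n) by have [h _ _ _] := bad n; exact: entS h EE.
pose E2 := E `|` (E^-1)%relation.
have E2E : ent E2 by apply: (coarse_setU cX) => //; exact: (coarse_inv cX).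
pose K n := A n `|` A' n.
have KE n : K n `*` K n `<=` E2.
  have [h [[_ hA] _ _ _ _] [[_ hA'] _ _ _ _] _] := bad n.
  move=> [x y] [/= [Ax|Ax] [Ay|Ay]].
  - by left; exact: hA.
  - by right; apply: h.
  - by left; apply: h.
  - by left; exact: hA'.
have Bthick n b0 : B n b0 -> B n `<=` thickening F1 [set b0].
  have [_ [_ _ _ [_ hB] _] _ _] := bad n.
  by move=> Bb b Bb'; exists b0 => //; exact: hB.
have B'thick n b0 : B' n b0 -> B' n `<=` thickening F1 [set b0].
  have [_ _ [_ _ _ [_ hB] _] _] := bad n.
  by move=> Bb b Bb'; exists b0 => //; exact: hB.
have Bbig n b' b G m : B' n b' -> B n b -> G (b', b) ->
    rcomp F1 (rcomp G (F1^-1)%relation) `<=` F m -> ~ (m <= n)%N.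
  move=> Bb' Bb Gb GF mn; have [_ _ _] := bad n; apply => -[x' x] [/= Bx' Bx].
  apply: (Fmon _ _ mn); apply: GF.
  have [_ -> ?] := B'thick _ _ Bb' _ Bx'; exists b' => //.
  by have [_ -> ?] := Bthick _ _ Bb _ Bx; exists b.
have [[i recur]|nrec] :=
    pselect (exists i, forall N, exists2 n, (N <= n)%N & K n `&` disc i !=set0).
  pose A0 := sat (thickening E2 (disc (l := X) i)).
  have mA0 : meas A0 by exact: meas_sat.
  have A0E : ent (A0 `*` A0) by exact: sat_bounded.
  have KA0 n : K n `&` disc i !=set0 -> K n `<=` A0.
    move=> [y [Ky yi]] x Kx; apply: sub_sat; exists y => //; exact: (KE n).
  have d2 : 0 < delta / 2 by rewrite divr_gt0.
  have [B0 [mB0 B0E hB0]] := transport_bounded UU Psi_tr1 cofF mA0 A0E d2.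
  have [B0' [mB0' B0E' hB0']] := transport_bounded UU' Psi_tr2 cofF mA0 A0E d2.
  have meet n : K n `&` disc i !=set0 -> B n `&` B0 !=set0.
    move=> /KA0 KA; have [_ c _ _] := bad n.
    by apply: concentrated_meet delta0 c mA0 _ mB0 hB0 => x Ax; apply: KA; left.
  have meet' n : K n `&` disc i !=set0 -> B' n `&` B0' !=set0.
    move=> /KA0 KA; have [_ _ c _] := bad n.
    by apply: concentrated_meet delta0 c mA0 _ mB0' hB0' => x Ax; apply: KA; right.
  (* [hB0] and [hB0'] treat [U] and [U'] separately; a single return to the piece places [B0'] near
     [B0], through [transport_link]. *)
  have BBE : ent (B0' `*` B0).
    have [n0 _ Kn0] := recur 0%N.
    have [_ c c' _] := bad n0.
    have [G GE [b' [b [Bb' Bb Gb]]]] := transport_link delta0 (AAE n0) c c'.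
    have [p [Bp B0p]] := meet _ Kn0; have [p' [Bp' B0p']] := meet' _ Kn0.
    pose W := rcomp F1 (rcomp G (F1^-1)%relation).
    have WE : ent W.
      by do 2!apply: ent_rcomp => //; exact: (coarse_inv cY).
    have Wp : W (p', p).
      have [_ -> ?] := B'thick _ _ Bb' _ Bp'; exists b' => //.
      by have [_ -> ?] := Bthick _ _ Bb _ Bp; exists b.
    have := ent_rcomp cY B0E' (ent_rcomp cY WE B0E); apply: entS => //.
    by move=> [x' x] [/= Bx' Bx]; exists p' => //; exists p.
  have [m hm] := Fcof _ (ent_rcomp cY F1E (ent_rcomp cY BBE (coarse_inv cY F1E))).
  have [n mn Kn] := recur m.
  have [p [Bp B0p]] := meet _ Kn; have [p' [Bp' B0p']] := meet' _ Kn.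
  exact: (Bbig n p' p (B0' `*` B0) m).
(* Now every piece is left for good; by local finiteness so is every bounded set, in particular each
   [K k]. *)
have esc i : exists N, forall n, (N <= n)%N -> K n `&` disc i = set0.
  apply: contrapT => nN; apply: nrec; exists i => N; apply: contrapT => nn.
  apply: nN; exists N => n Nn; apply/eqP; apply: contrapT => /negP/set0P h.
  by apply: nn; exists n.
have /choice[g gP] k : exists N, forall n, (N <= n)%N -> K n `&` K k = set0.
  have [l Kl] : exists l : seq (disc_index X), K k `<=` discU [set i | List.In i l].
    by apply: bounded_discU; exists E2 => //; exact: KE.
  have [N hN] : exists N, forall n, (N <= n)%N ->
      K n `&` discU [set i | List.In i l] = set0.
    elim: l {Kl} => [|i l [N hN]].
      by exists 0%N => n _; rewrite -subset0 => x [_ []].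
    have [N' hN'] := esc i; exists (maxn N N') => n; rewrite geq_max => /andP[Nn N'n].
    rewrite -subset0 => x [Kx [j /= [<-|jl] xj]].
      by have : (K n `&` disc i) x by []; rewrite hN'.
    have : (K n `&` discU [set i | List.In i l]) x by split => //; exists j.
    by rewrite hN.
  exists N => n /hN; rewrite -!subset0 => h x [Kx /Kl ?]; exact: (h x).
(* The next index exceeds [g i] for every [i] up to the current one, which makes the sets [K (nk k)]
   pairwise disjoint. *)
pose nk := fix nk k : nat := if k is j.+1 then
  (\max_(i < (nk j).+1) g i + nk j).+1 else 0%N.
have nkS k : (nk k < nk k.+1)%N by rewrite /= ltnS leq_addl.
have nkk k : (k <= nk k)%N by elim: k => // k IH; exact: leq_ltn_trans (nkS k).
have nkmon j k : (j <= k)%N -> (nk j <= nk k)%N.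
  elim: k => [|k IH]; first by rewrite leqn0 => /eqP ->.
  by rewrite leq_eqVlt => /orP[/eqP ->//|/IH h]; apply: leq_trans h (ltnW (nkS k)).
have Kdisj j k : (j < k)%N -> K (nk k) `&` K (nk j) = set0.
  move=> jk; apply: gP; apply: leq_trans (nkmon _ _ jk) => /=.
  apply: leqW; apply: leq_trans (leq_addr _ _).
  exact: (leq_bigmax (ord_max : 'I_(nk j).+1)).
have Kd j k : j != k -> K (nk j) `&` K (nk k) = set0.
  by rewrite neq_ltn => /orP[/Kdisj|/Kdisj//]; rewrite setIC.
have Ad j k : j != k -> A (nk j) `&` A (nk k) = set0.
  by move=> /Kd; rewrite -!subset0 => h x [? ?]; apply: (h x); split; left.
have Ad' j k : j != k -> A' (nk j) `&` A' (nk k) = set0.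
  by move=> /Kd; rewrite -!subset0 => h x [? ?]; apply: (h x); split; right.
have he : orthoseq (fun k => v (nk k)).
  move=> j k; have [_ [[mj _] Aj vj _ _] _ _] := bad (nk j).
  have [_ [[mk _] Ak _ _ _] _ _] := bad (nk k).
  have [<-|jk] := eqVneq j k; first by rewrite -rnorm_dot vj expr1n.
  exact: supported_orth (Ad _ _ jk) Aj Ak.
have he' : orthoseq (fun k => v' (nk k)).
  move=> j k; have [_ _ [[mj _] Aj vj _ _] _] := bad (nk j).
  have [_ _ [[mk _] Ak _ _ _] _] := bad (nk k).
  have [<-|jk] := eqVneq j k; first by rewrite -rnorm_dot vj expr1n.
  exact: supported_orth (Ad' _ _ jk) Aj Ak.
have d3 : 0 < delta ^+ 3 / 2 by rewrite divr_gt0// exprn_gt0.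
have rE G : ent G -> ent (rcomp (disc_ent X) (rcomp G (disc_ent X))).
  by move=> GE; apply: ent_rcomp => //; exact: ent_rcomp.
have [||m hm] := transport_sum Psi_tr UU cofF he he' (rE _ EE)
    (rE _ (coarse_inv cX EE)) _ _ d3.
- move=> n; have [h [[mA _] Av _ _ _] [[mA' _] Av' _ _ _] _] := bad (nk n).
  move=> p /(theta_supp mA mA' Av Av')[a ? [b ab ?]]; exists a => //; exists b => //.
  exact: h.
- move=> n; have [h [[mA _] Av _ _ _] [[mA' _] Av' _ _ _] _] := bad (nk n).
  move=> p /(theta_supp mA' mA Av' Av)[a ? [b [? ?] ?]]; exists a => //; exists b => //.
  exact: h.
(* [F j] absorbs the [F1]-thickening of [F m]. As [j <= nk j], the failure at [nk j] then forces
   [B' (nk j)] and [B (nk j)] to be [F m]-separated. *)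
have [j hj] := Fcof _ (ent_rcomp cY F1E (ent_rcomp cY (FE m) (coarse_inv cY F1E))).
have [_ [_ _ _ [mB _] vB] [_ _ _ [mB' _] vB'] _] := bad (nk j).
have sep : separated (F m) (B' (nk j)) (B (nk j)).
  by move=> b' b Bb' Bb Fb; apply: (Bbig _ _ _ _ _ Bb' Bb Fb hj); exact: nkk.
have := hm j _ _ mB mB' sep; rewrite leNgt => /negP; apply.
apply: (@lt_trans _ _ (delta ^+ 3)).
  by rewrite ltr_pdivrMr// ltr_pMr ?ltr1n// exprn_gt0.
rewrite exprSr; apply: ltr_pM; rewrite ?exprn_ge0// ?ltW//.
by rewrite ltr_pXn2r ?nnegrE ?rnorm_ge0// ltW.
Qed.

End TransportControlled.

(** * Concentration *)

Section Concentration.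
Variables (R : realType) (X Y : lfcm) (C : coarse_module R X) (D : coarse_module R Y).
Variables (U : bop C D) (Us : bop D C).
Hypothesis UU : Defs.is_unitary U Us.
Hypothesis conj_approx : forall t : bop D D,
  approximable t -> approximable (bop_comp Us (bop_comp t U)).
Variable E : nat -> set (X * X).
Hypothesis cofE : cofinal_entourages (@ent X) E.

Lemma discU_setU (S S' : set (disc_index Y)) : discU (S `|` S') = discU S `|` discU S'.
Proof.
apply/seteqP; split=> [x [j [Sj|Sj] xj]|x [[j Sj xj]|[j Sj xj]]].
- by left; exists j.
- by right; exists j.
- by exists j => //; left.
- by exists j => //; right.
Qed.

Lemma discU_setI0 (S S' : set (disc_index Y)) : S `&` S' = set0 ->
  discU S `&` discU S' = set0.
Proof.
rewrite -!subset0 => SS' x [[j Sj xj] [k Sk xk]]; apply: (SS' j).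
by split => //; rewrite (disc_fun xj xk).
Qed.

Lemma ind_discU (S S' : set (disc_index Y)) (w : D) : S `&` S' = set0 ->
  ind D (discU (S `|` S')) w = ind D (discU S) w + ind D (discU S') w.
Proof.
move=> SS'; rewrite discU_setU ind_setU//; [exact: meas_discU|exact: meas_discU|].
exact: discU_setI0.
Qed.

Lemma ind_controlled (B : set Y) : meas B -> controlled (ind D B).
Proof.
move=> mB; apply: (coarse_sub (ent_coarse Y)) (disc_ent_entourage Y).
move=> [y x] [G [G' [[mG bG] [mG' bG'] [h /= nz] [/= G'y Gx]]]].
have [z [[G'z Bz] Gz]] : G' `&` B `&` G !=set0.
  apply/set0P/eqP => BA; move: nz.
  by rewrite !ind_comp// ?BA ?ind_set0 ?eqxx//; exact: measI.
by apply: (@disc_ent_trans _ _ z); [exact: bG'|exact: bG].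
Qed.

(** [nikodym] over sets of pieces of [Y]: at a fixed [S] the conjugated projection is approximable,
    hence quasi-local, and exhaustiveness is [ind_tail]. A single entourage for all [S] is
    essential, since the sets supplied by [sign_choice] are not known in advance. *)
Lemma conj_equi (eps : R) : 0 < eps -> exists m, forall A G, meas A -> meas G ->
  separated (E m) G A -> forall x, rnorm x <= 1 -> forall S,
    rnorm (ind C G (Us (ind D (discU S) (U (ind C A x))))) <= eps.
Proof.
move=> eps0.
pose Q m (phi : set (disc_index Y) -> C) := exists A G x, [/\ meas A, meas G,
  separated (E m) G A, rnorm x <= 1 &
  phi = fun S => ind C G (Us (ind D (discU S) (U (ind C A x))))].
have [_ Emon Ecof] := cofE.
have [m|m|S eta eta0|m mQ] := @nikodym _ _ _ Q _ _ _ eps eps0.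
- move=> _ [A [G [x [mA mG _ _ ->]]]]; split => [S S' SS'|eta eta0].
    by rewrite ind_discU// !linearD.
  have [l hl] := ind_tail (U (ind C A x)) eta0; exists l => S Sl.
  apply: le_trans (ind_norm _ _) _; rewrite (unitary_norm (unitary_sym UU)).
  exact: hl.
- move=> phi [A [G [x [mA mG sep x1 phiE]]]]; exists A, G, x; split => //.
  by apply: separatedS sep; exact: Emon.
- have [W WE ql] := quasi_local (conj_approx
    (controlled_approximable (ind_controlled (meas_discU S)))) eta0.
  have [m Wm] := Ecof _ WE; exists m => _ [A [G [x [mA mG sep x1 ->]]]].
  have := ql G A mA mG (separatedS Wm sep) x; move/le_trans; apply.
  by rewrite ler_piMr// ltW.
- exists m => A G mA mG sep x x1.
  by apply: (mQ (fun S => ind C G (Us (ind D (discU S) (U (ind C A x)))))); exists A, G, x.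
Qed.

(* Derandomised averaging over signs: by the parallelogram law, one of the two choices at
   each step is at least as good as the average. *)
Lemma sign_choice (K : hilbert R) (Q : bop D K) (w : D) (c : R) : 0 <= c ->
  (forall j, c * rnorm (ind D (disc j) w) ^+ 2 <= rnorm (Q (ind D (disc j) w)) ^+ 2) ->
  forall l, exists S1 S2, [/\ forall j, S1 j -> List.In j l,
    forall j, S2 j -> List.In j l &
    c * rnorm (ind D (discU [set j | List.In j l]) w) ^+ 2 <=
      rnorm (Q (ind D (discU S1) w) - Q (ind D (discU S2) w)) ^+ 2].
Proof.
move=> c0 hc; elim=> [|j l [S1 [S2 [S1l S2l h]]]].
  exists set0, set0; split => //; rewrite subrr rnorm0.
  rewrite (_ : discU _ = set0) ?ind_set0 ?rnorm0 ?expr0n ?mulr0//.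
  by rewrite -subset0 => x [].
have [jl|jl] := pselect (List.In j l).
  exists S1, S2; split => [k /S1l|k /S2l|]; [by right|by right|].
  rewrite (_ : [set k | _] = [set k | List.In k l])//.
  by apply/seteqP; split => k /=; [case=> [<-|]|right].
have jS (S : set (disc_index Y)) : (forall k, S k -> List.In k l) -> S `&` [set j] = set0.
  by move=> Sl; rewrite -subset0 => k [/Sl + kj]; rewrite kj.
have dj : discU [set j] = disc j.
  by apply/seteqP; split => [x [k ->]|x xj] //; exists j.
have Lj : ind D (discU [set k | List.In k (j :: l)]) w =
    ind D (discU [set k | List.In k l]) w + ind D (disc j) w.
  rewrite -dj -ind_discU ?jS//; congr (ind D (discU _) w).
  by apply/seteqP; split => k /=; [case=> [->|]; [right|left]|case=> [|->]; [right|left]].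
have nL : rnorm (ind D (discU [set k | List.In k (j :: l)]) w) ^+ 2 =
    rnorm (ind D (discU [set k | List.In k l]) w) ^+ 2 + rnorm (ind D (disc j) w) ^+ 2.
  rewrite Lj pythagoras// -dj ind_selfadj ind_comp; [|exact: meas_discU|exact: meas_discU].
  by rewrite discU_setI0 ?jS// ind_set0 hdot0r.
have add S : (forall k, S k -> List.In k l) ->
    Q (ind D (discU (S `|` [set j])) w) = Q (ind D (discU S) w) + Q (ind D (disc j) w).
  by move=> Sl; rewrite ind_discU ?jS// linearD dj.
set a := Q (ind D (discU S1) w) - Q (ind D (discU S2) w) in h.
set b := Q (ind D (disc j) w).
have := parallelogram a b; have := hc j; rewrite -/b => hb par.
have [ge|lt] := leP (rnorm a ^+ 2 + rnorm b ^+ 2) (rnorm (a + b) ^+ 2).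
  exists (S1 `|` [set j]), S2; split => [k [/S1l ?|->]|k /S2l ?|];
    [by right|by left|by right|].
  rewrite add// addrAC -/a -/b nL mulrDr; apply: le_trans ge; exact: lerD.
exists S1, (S2 `|` [set j]); split => [k /S1l ?|k [/S2l ?|->]|];
  [by right|by right|by left|].
rewrite add// opprD addrA -/a -/b nL mulrDr.
apply: (@le_trans _ _ (rnorm a ^+ 2 + rnorm b ^+ 2)); first exact: lerD.
by move: lt par; lra.
Qed.

(** If [Us] sent every piece of [w = U v] with at least the proportion [c = 1 - delta ^+ 2] of its
    squared norm outside [A1], [sign_choice] would assemble a vector contradicting [conj_equi]. A
    piece that fails this, once normalised, has more than [delta ^+ 2] inside [A1]. *)
Lemma concentration_piece (delta : R) : 0 < delta < 1 -> exists m, forall A A1 (v : C),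
  meas A -> meas A1 -> separated (E m) (~` A1) A -> supported A v -> rnorm v = 1 ->
  exists j (u : C), [/\ supported A1 u, rnorm u = 1 & delta < rnorm (ind D (disc j) (U u))].
Proof.
move=> /andP[d0 d1]; pose c := 1 - delta ^+ 2.
have c0 : 0 < c by rewrite subr_gt0 expr_lt1// ltW.
have c1 : c <= 1 by rewrite gerBl sqr_ge0.
have [m hm] := conj_equi (divr_gt0 c0 (ltr0n R 4)).
exists m => A A1 v mA mA1 sep Av v1; set w := U v; set G := ~` A1.
have mG : meas G by exact: measC.
have w1 : rnorm w = 1 by rewrite (unitary_norm UU).
pose Q := bop_comp (ind C G) Us.
have [j jlt] : exists j,
    rnorm (Q (ind D (disc j) w)) ^+ 2 < c * rnorm (ind D (disc j) w) ^+ 2.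
  apply: contrapT => no.
  have hc j : c * rnorm (ind D (disc j) w) ^+ 2 <= rnorm (Q (ind D (disc j) w)) ^+ 2.
    by rewrite leNgt; apply/negP => lt; apply: no; exists j.
  (* All but norm 1/2 of [w] lies in finitely many pieces, so these carry at least 3/4 of its
     squared norm. The two bounds [c / 4] then give [c * (3 / 4) <= (c / 2) ^+ 2 <= c / 4], which is
     absurd. *)
  have [l hl] := ind_tail w (divr_gt0 ltr01 (ltr0n R 2)).
  have [S1 [S2 [_ _ hS]]] := sign_choice (ltW c0) hc l.
  set L := discU [set j | List.In j l] in hS.
  have mL : meas L by exact: meas_discU.
  have nL : ~` L = discU [set j | ~ List.In j l].
    apply/seteqP; split => [y Ly|y [j jl yj] [k kl yk]]; last first.
      by apply: jl; rewrite (disc_fun yj yk).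
    by have [j yj] := disc_cover y; exists j => // jl; apply: Ly; exists j.
  have := ind_pythagoras w mL; rewrite nL w1.
  have := hl [set j | ~ List.In j l] (fun j h => h).
  have q S : rnorm (Q (ind D (discU S) w)) <= c / 4.
    by have := hm A G mA mG sep v; rewrite v1 lexx Av => /(_ isT S).
  have := rnormD (Q (ind D (discU S1) w)) (- Q (ind D (discU S2) w)).
  rewrite rnormN; have := q S1; have := q S2; move: hS.
  have := rnorm_ge0 (ind D (discU [set j | ~ List.In j l]) w).
  have := rnorm_ge0 (Q (ind D (discU S1) w) - Q (ind D (discU S2) w)).
  set x := rnorm (_ - _); set y := rnorm (ind D L w) ^+ 2; set z := rnorm (ind D _ w).
  move=> x0 z0 hx h2 h1 hx' hz hw.
  have {}hx' : x <= c / 2 by move: h1 h2 hx'; lra.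
  have z4 : z ^+ 2 <= 1 / 4 by nra.
  have y4 : 3 / 4 <= y by move: hw; rewrite expr1n; lra.
  have x4 : x ^+ 2 <= c / 4 by nra.
  have : c * (3 / 4) <= c / 4 by apply: le_trans x4; apply: le_trans hx; rewrite ler_pM2l.
  by lra.
have wj0 : ind D (disc j) w != 0.
  apply: contraTneq jlt => ->; rewrite linear0 !rnorm0 expr0n mulr0 ltxx//.
have w'1 := normalize_norm wj0; set w' := normalize _ in w'1.
have w'j : supported (disc j) w' by apply: supportedZ; apply: ind_ind; exact: meas_disc.
have Qw' : rnorm (ind C G (Us w')) ^+ 2 < c.
  move: jlt; rewrite (bop_normalize Q) -/w' exprMn mulrC ltr_pM2r//.
  by rewrite exprn_gt0// rnorm_gt0.
set z := ind C A1 (Us w').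
have zd : delta < rnorm z.
  rewrite -(@ltr_pXn2r _ 2) ?nnegrE ?rnorm_ge0 ?(ltW d0)//.
  have := ind_pythagoras (Us w') mA1; rewrite (unitary_norm (unitary_sym UU)) w'1 expr1n.
  by move: Qw'; rewrite /c -/G -/z; lra.
have z0 : z != 0.
  by apply: contraTneq zd => ->; rewrite rnorm0 -leNgt ltW.
exists j, (normalize z); split.
- by apply: supportedZ; exact: ind_ind.
- exact: normalize_norm.
- apply: lt_le_trans zd _.
  have nz := rnorm_gt0 z0; rewrite -(ler_pM2l nz).
  rewrite -(bop_normalize (bop_comp (ind D (disc j)) U)) /=.
  (* Duality: this inner product equals that of [z] with [Us w'], which is the squared norm of
     [z]. *)
  have := cauchy_schwarz (ind D (disc j) (U z)) w'; rewrite w'1 mulr1.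
  have [ad _ _] := UU.
  rewrite ind_selfadj w'j ad {1}/z ind_selfadj ind_dot// cmod_real ger0_norm ?sqr_ge0//.
Qed.

(** [A1] may be enlarged freely, so [x] is adjoined to it. All of [A1] stays within [W] of the point
    [a], which bounds its size independently of [A] and [x]. *)
Lemma concentration (E1 : set (X * X)) (delta : R) : ent E1 -> 0 < delta < 1 ->
  exists2 E0, ent E0 & forall x a A, disc_meas A -> A a ->
    (exists h, ind C A h != 0) -> E1 (x, a) ->
    exists A1 u j, concentrated U E0 (disc_ent Y) delta A1 u (disc j) /\ A1 x.
Proof.
move=> E1E d01; have [m hm] := concentration_piece d01.
have cX := ent_coarse X; have dX := disc_ent_entourage X.
have [EE _ _] := cofE.
pose W := rcomp (disc_ent X) (rcomp (E m) (disc_ent X) `|` E1).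
have WE : ent W.
  by apply: ent_rcomp => //; apply: (coarse_setU cX) => //; exact: ent_rcomp.
exists (rcomp W (W^-1)%relation); first by apply: ent_rcomp => //; exact: (coarse_inv cX).
move=> x a A [mA bA] Aa [h nz] xa.
pose A1 := sat (thickening (E m) A `|` [set x]).
have mA1 : meas A1 by exact: meas_sat.
have A1W y : A1 y -> W (y, a).
  move=> /sat_thick[z Az yz]; exists z => //; case: Az => [[b Ab zb]|->]; last by right.
  by left; exists b => //; exact: bA.
have sep : separated (E m) (~` A1) A.
  by move=> y b nA1 Ab Eb; apply: nA1; apply: sub_sat; left; exists b.
have Av : supported A (normalize (ind C A h)) by apply: supportedZ; exact: ind_ind.
have [j [u [A1u u1 du]]] := hm _ _ _ mA mA1 sep Av (normalize_norm nz).
exists A1, u, j; split; last by apply: sub_sat; right.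
split => //; [split => // -[y z] [/= /A1W ? /A1W ?]; by exists a|].
exact: disc_meas_disc.
Qed.

End Concentration.

(** * Implementation of the functor by a unitary *)

Section RankOne.
Variables (R : realType) (X : lfcm).
Implicit Types C D : coarse_module R X.

Lemma approximable_eq C D (t s : bop C D) : t =1 s -> approximable t -> approximable s.
Proof. by move=> /bop_eq ->. Qed.

Lemma approximable0 C D : approximable (theta (0 : D) (0 : C)).
Proof.
apply: controlled_approximable; apply: (coarse_sub (ent_coarse X)) (disc_ent_entourage X).
by move=> p [A [B [_ _ [h + _]]]]; rewrite thetaE scaler0 linear0 eqxx.
Qed.

Lemma approximableZ C D a (t s : bop C D) : (forall x, s x = a *: t x) ->
  approximable t -> approximable s.
Proof.
move=> ts at_; apply: approximable_eq (approximable_lin a at_ (approximable0 C D)) => x.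
by rewrite /= thetaE scaler0 addr0.
Qed.

Lemma ind_approximable C A : meas A -> approximable (ind C A).
Proof. by move=> mA; exact/controlled_approximable/ind_controlled. Qed.

(* Taking adjoints termwise would prove [flip], but adjoints of general bounded operators
   are not available; truncating [b] to finitely many pieces avoids them. *)
Section Flip.
Variables (C D : coarse_module R X) (A : set X) (a : C).
Hypotheses (dA : disc_meas A) (Aa : supported A a) (a0 : a != 0).

(** The block of [theta b a] from [A] to [G] sends [a] to a vector of norm
    [rnorm a ^+ 2 * rnorm (ind D G b)], too large for separated sets. So an entourage joins a point
    of [G] to one of [A], and since both sets are bounded their product is an entourage. *)
Lemma flip_piece (b : D) G : approximable (theta b a) -> disc_meas G ->
  controlled (theta a (ind D G b)).
Proof.
move=> ba dG; have [mA bA] := dA; have [mG bG] := dG.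
have cX := ent_coarse X; have dX := disc_ent_entourage X.
have [->|nz] := eqVneq (ind D G b) 0.
  apply: (coarse_sub cX) dX => p [A' [B' [_ _ [h + _]]]].
  by rewrite thetaE hdot0r scale0r linear0 eqxx.
have AE : ent (A `*` A) by apply: (entS cX) dX.
have GE : ent (G `*` G) by apply: (entS cX) dX.
suff [E EE [g [x [Gg Ax Egx]]]] : exists2 E, ent E & exists g x, [/\ G g, A x & E (g, x)].
  have gx : ent ([set g] `*` [set x]).
    by apply: (entS cX) EE => -[? ?] [/= -> ->].
  apply: (theta_controlled mG mA (ind_ind b mG) Aa).
  apply: (entourage_setM_inv cX).
  apply: (entourage_setM_trans cX (b := g) (B := [set g])) => //.
    by apply: (entS cX) GE => -[? ?] [/= ? ->].
  apply: (entourage_setM_trans cX (b := x) (B := [set x])) => //.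
  by apply: (entS cX) AE => -[? ?] [/= -> ?].
have na := rnorm_gt0 a0; have nb := rnorm_gt0 nz.
have e0 : 0 < rnorm a * rnorm (ind D G b) / 2 by rewrite divr_gt0// mulr_gt0.
have [E EE ql] := quasi_local ba e0.
exists E => //; apply: contrapT => no.
have sep : separated E G A by move=> g x ? ? ?; apply: no; exists g, x.
have := ql _ _ mA mG sep a; rewrite Aa thetaE linearZ /= -rnorm_dot rnormZr ?sqr_ge0//.
rewrite leNgt => /negP; apply.
by have := mulr_gt0 (mulr_gt0 na na) nb; lra.
Qed.

Lemma flip_fin_disc (b : D) U : approximable (theta b a) -> fin_disc U ->
  controlled (theta a (ind D U b)).
Proof.
move=> + fU; elim: fU b => [b _|G V dG fV IH b ba].
  apply: (coarse_sub (ent_coarse X)) (disc_ent_entourage X) => p [A' [B' [_ _ [h + _]]]].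
  by rewrite thetaE ind_set0 hdot0r scale0r linear0 eqxx.
have [mG _] := dG; have mV := fin_disc_meas fV.
have ba' : approximable (theta (ind D (~` G) b) a).
  apply: approximable_eq (approximable_comp (ind_approximable D (measC mG)) ba) => x.
  by rewrite /= !thetaE linearZ.
have := controlled_lin 1 (flip_piece ba dG) (IH _ ba').
rewrite (_ : bop_lin _ _ _ = theta a (ind D (G `|` V) b))//.
apply: bop_eq => x /=; rewrite scale1r !thetaE -scalerDl -hdotDr; congr (hdot x _ *: _).
rewrite ind_comp//; last exact: measC.
rewrite -ind_setU//; last 2 first.
- by apply: measI => //; exact: measC.
- by rewrite -subset0 => y [? []].
congr (ind D _ b); apply/seteqP; split => y; first by case=> [|[]]; [left|right].
by have [] := pselect (G y); [left|move=> ? []; [left|right]].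
Qed.

Lemma flip (b : D) : approximable (theta b a) -> approximable (theta a b).
Proof.
move=> ba e e0; have na := rnorm_gt0 a0.
have e1 : 0 < e / (rnorm a * 2) by rewrite divr_gt0// mulr_gt0.
have [u /span_fin_disc[U fU Uu] bu] := dense_rnorm (ind_dense (c := D)) b e1.
have mU := fin_disc_meas fU.
exists (theta a (ind D U b)); first exact: flip_fin_disc.
apply: (@le_lt_trans _ _ (e / 2)); last by rewrite ltr_pdivrMr// ltr_pMr ?ltr1n.
apply: opnorm_le => [|x]; first by rewrite divr_ge0// ltW.
rewrite !thetaE -scalerBl -hdotBr -ind_setC// rnormZE.
have h : rnorm (ind D (~` U) b) <= e / (rnorm a * 2).
  have -> : ind D (~` U) b = ind D (~` U) (b - u).
    by rewrite linearB /= [ind D _ u]ind_setC// Uu subrr subr0.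
  exact: le_trans (ind_norm _ _) (ltW bu).
apply: (@le_trans _ _ (rnorm x * (e / (rnorm a * 2)) * rnorm a)).
  rewrite ler_wpM2r ?rnorm_ge0//; apply: le_trans (cauchy_schwarz _ _) _.
  by rewrite ler_wpM2l ?rnorm_ge0.
have -> : rnorm x * (e / (rnorm a * 2)) * rnorm a = e / 2 * rnorm x => //.
by field; rewrite gt_eqF.
Qed.

End Flip.
End RankOne.

Section Functor.
Variables (R : realType) (k : rank_bound) (X Y : lfcm).
Variable Phi : star_functor R k X Y.
Implicit Types C : amodule R k X.

(** [Pmod] and [Pmap] restate the functor with modules and operators as types, hiding the passage
    through [Acat]. *)
Definition Pmod C : amodule R k Y := Phi C.

Definition Pmap C C' (t : approx_op C C') : approx_op (Pmod C) (Pmod C') :=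
  Defs.fmap Phi (t : @Defs.hom (Acat R k X) C C').

Lemma Pmap_lin C C' a (r s t : approx_op C C') : (forall x, r x = a *: s x + t x) ->
  forall y, Pmap r y = a *: Pmap s y + Pmap t y.
Proof.
move=> rst y; have -> : r = approx_lin a s t by exact: approx_op_eq.
by rewrite {1}/Pmap sfunctor_linear.
Qed.

Lemma Pmap_add C C' (r s t : approx_op C C') : (forall x, r x = s x + t x) ->
  forall y, Pmap r y = Pmap s y + Pmap t y.
Proof.
move=> h y; rewrite (Pmap_lin (a := 1) (s := s) (t := t)) ?scale1r// => x.
by rewrite scale1r.
Qed.

Lemma Pmap0 C C' (r : approx_op C C') : (forall x, r x = 0) -> forall y, Pmap r y = 0.
Proof.
move=> r0 y; have := Pmap_add (r := r) (s := r) (t := r) _ y.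
move=> /(_ _)/eqP; rewrite -subr_eq0 opprD addrA subrr sub0r oppr_eq0 => h.
by apply/eqP/h => x; rewrite r0 addr0.
Qed.

Lemma PmapZ C C' a (r s : approx_op C C') : (forall x, r x = a *: s x) ->
  forall y, Pmap r y = a *: Pmap s y.
Proof.
move=> rs y; pose z : approx_op C C' := ApproxOp (approximable0 C C').
have z0 x : z x = 0 by rewrite /= thetaE scaler0.
rewrite (Pmap_lin (a := a) (s := s) (t := z)) => [|x]; last by rewrite z0 addr0.
by rewrite (Pmap0 z0) addr0.
Qed.

Lemma Pmap_comp C C' C'' (s : approx_op C' C'') (t : approx_op C C')
  (r : approx_op C C'') : (forall x, r x = s (t x)) ->
  forall y, Pmap r y = Pmap s (Pmap t y).
Proof.
move=> rst y; have -> : r = approx_comp s t by exact: approx_op_eq.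
by rewrite {1}/Pmap -[approx_comp s t]/(@Defs.cmp (Acat R k X) C C' C'' s t) Defs.fmap_cmp.
Qed.

Lemma Pmap_adj C C' (t : approx_op C C') (s : approx_op C' C) :
  is_adjoint t s -> is_adjoint (Pmap t) (Pmap s).
Proof. exact: sfunctor_adjoint. Qed.

Section Transport.
Variables (C C' : amodule R k X).
Variables (U : bop C (Pmod C)) (Us : bop (Pmod C) C).
Variables (U' : bop C' (Pmod C')) (Us' : bop (Pmod C') C').
Hypotheses (UU : implements U Us) (UU' : implements U' Us').

Lemma implementsE (t : approx_op C C) y : Pmap t y = U (t (Us y)).
Proof. by case: UU => _ /(_ t) ->. Qed.

(** For rank-one [t] between unit vectors, [s t] and [t s] are endomorphisms, where [U] and [U']
    compute [Phi]. From [t = t s t] the image of [t] starts at [U v] and ends on the line of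
    [U' v']; isometry makes the coefficient a phase. *)
Lemma functor_transport : transport U U' (@Pmap C C').
Proof.
have [[ad UsU UUs] _] := UU.
have nrm (t : approx_op C C') (s : approx_op C' C) : is_adjoint t s ->
    forall x, rnorm (Pmap t (U x)) = rnorm (t x).
  move=> ts x; apply: rnorm_eq_dot; rewrite (Pmap_adj ts).
  rewrite -(Pmap_comp (r := approx_comp s t))// implementsE ad UsU /=.
  by rewrite UsU -ts.
split=> //; first by move=> *; exact: Pmap_add.
move=> t s v v' tE sE v1 v'1.
have ts : is_adjoint t s by move=> x y; rewrite tE sE; exact: theta_adj.
have vv : hdot v v = 1 by rewrite -rnorm_dot v1 expr1n.
have vv' : hdot v' v' = 1 by rewrite -rnorm_dot v'1 expr1n.
have tts x : t x = t (approx_comp s t x).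
  by rewrite /= !tE sE !thetaE !hdotZl vv vv' !mulr1.
have stE x : approx_comp s t x = hdot x v *: v.
  by rewrite /= tE sE !thetaE hdotZl vv' mulr1.
have tsE x : approx_comp t s x = hdot x v' *: v'.
  by rewrite /= tE sE !thetaE hdotZl vv mulr1.
set z := Pmap t (U v).
have tz y : Pmap t y = hdot y (U v) *: z.
  rewrite (Pmap_comp tts) implementsE stE linearZ /= linearZ /= -/z.
  by congr (_ *: _); rewrite -[y in RHS]UUs ad UsU.
have [[ad' UsU' UUs'] tE'] := UU'.
have zE : z = hdot (Us' z) v' *: U' v'.
  have {1}-> : z = Pmap (approx_comp t s) z.
    by apply: Pmap_comp => x; rewrite [LHS]tts.
  have := tE' (approx_comp t s) z; rewrite /= -/(Pmap _) => ->.
  by rewrite /= [t _]tsE linearZ.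
exists (hdot (Us' z) v') => [|y]; last first.
  by rewrite tz {1}zE scalerA mulrC.
have : rnorm z = 1 by rewrite /z (nrm _ _ ts) tE thetaE vv scale1r.
by rewrite {1}zE rnormZE (unitary_norm (And3 ad' UsU' UUs')) v'1 mulr1 => ->.
Qed.

End Transport.
End Functor.

Section Implement.
Variables (R : realType) (k : rank_bound) (X Y : lfcm).
Variable Phi : star_functor R k X Y.
Hypothesis ff : fully_faithful Phi.

Lemma Pmap_inj (C C' : amodule R k X) (t s : approx_op C C') :
  Pmap Phi t =1 Pmap Phi s -> t =1 s.
Proof.
move=> /approx_op_eq ts; have [g gK _] := ff C C'.
by have := congr1 g ts; rewrite /Pmap !gK => ->.
Qed.

Lemma Pmap_surj (C C' : amodule R k X) (T : approx_op (Pmod Phi C) (Pmod Phi C')) :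
  exists t : approx_op C C', Pmap Phi t = T.
Proof. by have [g _ gK] := ff C C'; exists (g T); exact: gK. Qed.

Variable C : amodule R k X.

(** Fullness: [t] is the image of some endomorphism of [C], and conjugating back recovers that
    endomorphism. *)
Lemma implements_conj_approx (U : bop C (Pmod Phi C)) (Us : bop (Pmod Phi C) C)
    (UU : implements U Us) (t : bop (Pmod Phi C) (Pmod Phi C)) :
  approximable t -> approximable (bop_comp Us (bop_comp t U)).
Proof.
move=> at_; have [s sE] := Pmap_surj (ApproxOp at_).
apply: approximable_eq (aop_approximable s) => x /=.
have [[_ UsU _] _] := UU.
by rewrite -[bfun t (U x)]/(bfun (ApproxOp at_) (U x)) -sE (implementsE UU) !UsU.
Qed.

Lemma inverse_transport (U : bop C (Pmod Phi C)) (Us : bop (Pmod Phi C) C)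
    (UU : implements U Us) :
  transport Us Us (fun t : approx_op (Pmod Phi C) (Pmod Phi C) =>
    ApproxOp (implements_conj_approx UU (aop_approximable t))).
Proof.
have [uni _] := UU; have [ad UsU UUs] := uni; split => /=.
- by move=> r s t rst y; rewrite rst linearD.
- by move=> t s _ x; rewrite UUs (unitary_norm (unitary_sym uni)).
- move=> t s v v' tE _ _ _; exists 1 => [|y].
    by rewrite -(rmorph1 (real_complex R)) cmod_real normr1.
  by rewrite tE thetaE linearZ mul1r ad.
Qed.

Definition local_vector (e : C) : Prop :=
  e != 0 /\ exists2 A, disc_meas A & supported A e.

(** For local vectors this says that they lie in the same coarse component; phrased through
    morphisms it also makes sense for images of local vectors, which need not be local. *)
Definition linked (u e : C) : Prop :=
  approximable (theta u e) /\ approximable (theta e u).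

Lemma linked_refl e : local_vector e -> linked e e.
Proof.
move=> [_ [A [mA bA] Ae]]; have AE : ent (A `*` A).
  by apply: (entS (ent_coarse X)) (disc_ent_entourage X).
have h := controlled_approximable (theta_controlled mA mA Ae Ae AE).
by split.
Qed.

Lemma linked_sym u e : linked u e -> linked e u.
Proof. by case. Qed.

Lemma approximable_theta_trans (a b c d : C) : hdot c b != 0 ->
  approximable (theta a b) -> approximable (theta c d) -> approximable (theta a d).
Proof.
move=> cb ab cd.
apply: (approximableZ (a := (hdot c b)^-1)) (approximable_comp ab cd) => x /=.
by rewrite theta_comp scalerA mulVf// scale1r.
Qed.

Lemma linked_trans a b c : b != 0 -> linked a b -> linked b c -> linked a c.
Proof.
move=> b0 [ab ba] [bc cb]; have bb : hdot b b != 0 by rewrite dnorm_eq0.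
by split; [exact: approximable_theta_trans ab bc|exact: approximable_theta_trans cb ba].
Qed.

Definition linked_class (e : C) : set C := [set e' | local_vector e' /\ linked e e'].

(** Chosen from the class as a set, so that linked local vectors get the same representative. *)
Definition representative (e : C) : C := xget 0 (linked_class e).

Lemma representativeP e : local_vector e ->
  local_vector (representative e) /\ linked e (representative e).
Proof.
move=> le; have h : exists e', linked_class e e'.
  by exists e; split => //; exact: linked_refl.
exact: (xgetPex 0 h).
Qed.

Lemma representative_eq e e' : local_vector e -> local_vector e' -> linked e e' ->
  representative e = representative e'.
Proof.
move=> [e0 _] [e'0 _] ee'; congr xget; apply/seteqP; split => x [lx h]; split => //.
  exact: linked_trans (linked_sym ee') h.
exact: linked_trans ee' h.
Qed.

Definition is_representative e := local_vector e /\ representative e = e.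

(** Faithfulness of the functor gives a [y] not killed by the image of [theta e e]. This operator
    being a positive multiple of a projection, the quadratic form at [y] is the number [r > 0]
    below, and [y] is rescaled. *)
Lemma exists_cyclic : exists xi : C -> Pmod Phi C, forall e, local_vector e ->
  forall t : approx_op C C, t =1 theta e e -> hdot (Pmap Phi t (xi e)) (xi e) = 1.
Proof.
suff /choice[xi h] : forall e : C, exists y, local_vector e ->
  forall t : approx_op C C, t =1 theta e e -> hdot (Pmap Phi t y) y = 1 by exists xi.
move=> e; have [le|] := pselect (local_vector e); last by exists 0.
have [ee _] := linked_refl le; pose t : approx_op C C := ApproxOp ee.
have e0 : e != 0 by case: le.
have ne := rnorm_gt0 e0.
have [y Py] : exists y, Pmap Phi t y != 0.
  apply: contrapT => no; have : t =1 ApproxOp (approximable0 C C).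
    apply: Pmap_inj => y; rewrite [RHS]Pmap0 => [|x]; last by rewrite /= thetaE scaler0.
    by apply: contrapT => /eqP ?; apply: no; exists y.
  move=> /(_ e)/eqP; rewrite /= !thetaE scaler0 scaler_eq0 (negbTE e0) orbF.
  by rewrite dnorm_eq0 (negbTE e0).
set r := (rnorm (Pmap Phi t y) / rnorm e) ^+ 2.
have r0 : 0 < r by rewrite exprn_gt0// divr_gt0// rnorm_gt0.
have tt x : t (t x) = (rnorm e ^+ 2)%:C *: t x.
  by rewrite /= theta_comp -rnorm_dot.
have tad : is_adjoint t t by exact: theta_adj.
have Py2 : hdot (Pmap Phi t y) y = r%:C.
  have h : hdot (Pmap Phi t (Pmap Phi t y)) y = (rnorm (Pmap Phi t y) ^+ 2)%:C.
    by rewrite (Pmap_adj tad) rnorm_dot.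
  rewrite -(Pmap_comp (r := approx_comp t t))// in h.
  rewrite (PmapZ (a := (rnorm e ^+ 2)%:C) (s := t))// hdotZl in h.
  have ne2 : (rnorm e ^+ 2)%:C != 0 :> R[i].
    by rewrite -(rmorph0 (real_complex R)) (inj_eq (@complexI R)) expf_neq0// gt_eqF.
  apply: (mulfI ne2); rewrite h -rmorphM /r; congr (_%:C).
  by rewrite expr_div_n mulrC divfK// expf_neq0// gt_eqF.
exists ((Num.sqrt r)^-1%:C *: y) => _ t' t'E.
have -> : t' = t by apply: approx_op_eq => x; rewrite t'E.
have -> a : Pmap Phi t (a *: y) = a *: Pmap Phi t y by rewrite linearZ.
rewrite hdotZl hdotZr conj_realC Py2 -!rmorphM /=.
rewrite mulrA -invfM -expr2 sqr_sqrtr ?(ltW r0)// mulVf ?gt_eqF//.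
Qed.

(* On each coarse component fix a vector [e] and set [U u := Phi (theta u e) (xi e)]; the
   choice of [xi e] makes this isometric, and fullness makes it onto. *)
Lemma exists_implements : exists (U : bop C (Pmod Phi C)) (Us : bop (Pmod Phi C) C),
  implements U Us.
Proof.
have [xi xiP] := exists_cyclic.
pose G (u : C) (w : Pmod Phi C) := exists e, [/\ is_representative e, linked u e &
  exists2 t : approx_op C C, t =1 theta u e & w = Pmap Phi t (xi e)].
(* If the inner product is nonzero, the two representatives are linked, hence equal, and the
   normalisation of [xi e] gives the identity; if it is zero, the composite vanishes and so do both
   sides. *)
have gram u w u' w' : G u w -> G u' w' -> hdot u u' = hdot w w'.
  move=> [e [[le re] ue [t tE ->]]] [e' [[le' re'] ue' [t' tE' ->]]].
  have [_ eu'] := ue'; pose s' : approx_op C C := ApproxOp eu'.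
  have s't' : is_adjoint s' t' by move=> x y; rewrite tE'; exact: theta_adj.
  have stE x : approx_comp s' t x = hdot u u' *: theta e' e x.
    by rewrite /= tE theta_comp.
  rewrite -(Pmap_adj s't') -(Pmap_comp (r := approx_comp s' t))//.
  have [uu0|uu0] := eqVneq (hdot u u') 0.
    by rewrite uu0 Pmap0 ?hdot0l// => x; rewrite stE uu0 scale0r.
  have ee' : linked e e'.
    have [a1 a2] := ue; have [b1 b2] := ue'; split.
      by apply: approximable_theta_trans a2 b1; rewrite hdotC conjC_eq0.
    exact: approximable_theta_trans b2 a1.
  have eE : e = e' by rewrite -re -re'; exact: representative_eq.
  subst e'; have [ee _] := linked_refl le; pose p : approx_op C C := ApproxOp ee.
  by rewrite (PmapZ (a := hdot u u') (s := p))// hdotZl xiP// mulr1.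
have Gloc u : local_vector u -> exists w, G u w.
  move=> lu; have [lr ur] := representativeP lu; have [ae _] := ur.
  exists (Pmap Phi (ApproxOp ae) (xi (representative u))), (representative u).
  split => //; last by exists (ApproxOp ae).
  by split => //; exact: representative_eq (linked_sym ur).
(* [G] is stable under morphisms. As [t u] need not be local, the reverse half of [linked] comes
   from [flip]. *)
have GT (t : approx_op C C) u w : G u w -> G (t u) (Pmap Phi t w).
  move=> [e [re ue [s sE ->]]]; have [[e0 [A dA Ae]] _] := re; have [a1 _] := ue.
  have te : approximable (theta (t u) e).
    apply: approximable_eq (approximable_comp (aop_approximable t) a1) => x.
    by rewrite /= !thetaE linearZ.
  exists e; split => //; first by split => //; exact: (flip dA).
  exists (approx_comp t s) => [x|]; first by rewrite /= sE !thetaE linearZ.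
  by apply/esym; apply: Pmap_comp.
have Gspan u : (exists A x, disc_meas A /\ ind C A x = u) -> exists w, gspan G u w.
  move=> [A [x [dA <-]]]; have [->|nz] := eqVneq (ind C A x) 0.
    by exists 0; exact: gspan0.
  have [|w Gw] := Gloc (ind C A x); last by exists w; exact: gspan1.
  by split => //; exists A => //; apply: ind_ind; case: dA.
have [//|x e e0|y e e0|U [Us [uni GU]]] := @gram_unitary R C (Pmod Phi C) G.
- have [v [n [c [u [hu ->]]]] xv] := dense_rnorm (ind_dense (c := C)) x e0.
  have [|w hw] := @gspan_sum _ _ _ G n c u.
    by move=> i; have [A dA [z _ Az]] := hu i; apply: Gspan; exists A, z.
  by exists (\sum_(i < n) c i *: u i), w; split => //; exact: ltW.
- have [v [n [c [u [hu ->]]]] xv] := dense_rnorm (ind_dense (c := Pmod Phi C)) y e0.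
  have [|w hw] := @gspan_sum _ _ _ (fun y x => G x y) n c u; last first.
    exists w, (\sum_(i < n) c i *: u i); split; last exact: ltW.
    exact: (gspan_flip hw).
  move=> i; have [A dA [z' _ Az]] := hu i; set z := u i in Az *.
  suff [w hw] : exists w, gspan G w z by exists w; exact: gspan_flip.
  have [->|z0] := eqVneq z 0; first by exists 0; exact: gspan0.
  have [mA bA] := dA.
  have zA : supported A z by rewrite -Az; exact: ind_ind.
  have AE : ent (A `*` A) by apply: (entS (ent_coarse Y)) (disc_ent_entourage Y).
  pose T : approx_op (Pmod Phi C) (Pmod Phi C) :=
    ApproxOp (controlled_approximable (theta_controlled mA mA zA zA AE)).
  (* The rank-one [T] at [z] is the image of some [t], which is nonzero on some local vector. The
     image under [t] of that vector is [G]-related to a multiple of [z], nonzero by equality of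
     norms. *)
  have [t tT] := Pmap_surj T.
  have [B [x [dB tx]]] : exists B x, disc_meas B /\ t (ind C B x) != 0.
    apply: contrapT => no.
    have t0 x : t x = 0.
      apply: (disc_eq0 (t := t)) => B dB; apply: contrapT => /eqP ?.
      by apply: no; exists B, x.
    have := Pmap0 t0 z; rewrite tT /= thetaE => /eqP.
    by rewrite scaler_eq0 dnorm_eq0 orbb (negbTE z0).
  have [mB _] := dB.
  have lx : local_vector (ind C B x).
    split; first by apply: contraNneq tx => ->; rewrite linear0.
    by exists B => //; exact: ind_ind.
  have [w Gw] := Gloc _ lx; have := GT t _ _ Gw; rewrite tT /= thetaE => Gtz.
  have wz : hdot w z != 0.
    apply: contraNneq tx => wz0; have := gram _ _ _ _ Gtz Gtz.
    by rewrite wz0 scale0r hdot0l => /eqP; rewrite dnorm_eq0.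
  exists ((hdot w z)^-1 *: t (ind C B x) + 0).
  rewrite -[z in gspan G _ z]scale1r -(mulVf wz) -scalerA -[X in gspan G _ X]addr0.
  by apply: gspanS Gtz _; exact: gspan0.
exists U, Us; split => // t y.
have [_ _ UUs] := uni.
rewrite -[y in LHS]UUs -[LHS]/(Pmap Phi t (U (Us y))) /=.
apply/eqP; rewrite -subr_eq0; apply/eqP.
(* The difference of the two sides is a bounded operator, so it need only vanish on local vectors,
   where [GT] and [GU] compute it. *)
pose d := bop_lin (-1) (bop_comp U t) (bop_comp (Pmap Phi t) U).
have dE x : d x = Pmap Phi t (U x) - U (t x) by rewrite /= scaleN1r addrC.
rewrite -dE; apply: disc_eq0 => A dA; rewrite dE.
have [->|nz] := eqVneq (ind C A (Us y)) 0; first by rewrite !linear0 addr0.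
have lA : local_vector (ind C A (Us y)).
  by split => //; exists A => //; apply: ind_ind; case: dA.
have [w Gw] := Gloc _ lA; rewrite (GU _ _ Gw) (GU _ _ (GT t _ _ Gw)); exact: subrr.
Qed.

End Implement.

(** * Approximate relations *)

Section ApproximateRelations.
Variables (R : realType) (X Y : lfcm).

Lemma opnorm_attained (H K : hilbert R) (t : bop H K) (c : R) : c < opnorm t ->
  exists2 x, rnorm x <= 1 & c < rnorm (t x).
Proof.
move=> ct; apply: contrapT => no.
suff : opnorm t <= c by rewrite leNgt ct.
apply: ge_sup; first by exists (rnorm (t 0)), 0 => //=; rewrite normr0.
move=> _ [x /= x1 <-]; rewrite leNgt; apply/negP => cx; apply: no; exists x => //.
by move: x1; rewrite rnormE lecR.
Qed.

Lemma approx_relationP (C : coarse_module R X) (D : coarse_module R Y) (U : bop C D)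
    (delta : R) F E y x : 0 <= delta ->
  approx_relation U delta F E (y, x) <->
  exists A v B, [/\ concentrated U E F delta A v B, B y & A x].
Proof.
move=> d0; split.
  move=> [B [A [bB bA + [/= By Ax]]]].
  rewrite -[X in opnorm X]/(bfun (bop_comp (ind D B) (bop_comp U (ind C A)))).
  move=> /opnorm_attained[h h1 dh]; have [mA _] := bA.
  set z := ind C A h; rewrite /= -/z in dh.
  have z0 : z != 0.
    by apply: contraTneq dh => ->; rewrite !linear0 rnorm0 -leNgt.
  exists A, (normalize z), B; split => //; split => //.
  - by apply: supportedZ; exact: ind_ind.
  - exact: normalize_norm.
  - apply: lt_le_trans dh _; rewrite (bop_normalize (bop_comp (ind D B) U)).
    rewrite ler_piMl ?rnorm_ge0//; exact: le_trans (ind_norm _ _) h1.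
move=> [A [v [B [[bA Av v1 bB dv] By Ax]]]]; exists B, A; split => //.
apply: lt_le_trans dv _.
have := le_opnorm (bop_comp (ind D B) (bop_comp U (ind C A))) v.
by rewrite v1 mulr1 /= Av.
Qed.

Lemma approx_relation_mono (C : coarse_module R X) (D : coarse_module R Y) (U : C -> D)
    (delta delta' : R) F F' E E' : delta' <= delta -> F `<=` F' -> E `<=` E' ->
  approx_relation U delta F E `<=` approx_relation U delta' F' E'.
Proof.
move=> dd FF EE p [B [A [[mB bB] [mA bA] h BA]]]; exists B, A; split => //.
- by split => // q /bB /FF.
- by split => // q /bA /EE.
- exact: le_lt_trans h.
Qed.

End ApproximateRelations.

(** A block of [Us] is the adjoint of one of [U], so their norms agree: the normalised
    [ind D B (U v)] is a witness, by Cauchy-Schwarz against [v]. *)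
Lemma approx_relation_flip (R : realType) (X Y : lfcm) (C : coarse_module R X)
    (D : coarse_module R Y) (U : bop C D) (Us : bop D C) (delta : R) F E y x :
  Defs.is_unitary U Us -> 0 <= delta ->
  approx_relation U delta F E (y, x) -> approx_relation Us delta E F (x, y).
Proof.
move=> uni d0 /(approx_relationP _ _ _ _ _ d0)[A [v [B [[bA Av v1 bB dv] By Ax]]]].
apply/(approx_relationP _ _ _ _ _ d0).
have [mA _] := bA; have [mB _] := bB.
have nz : ind D B (U v) != 0.
  by apply: contraTneq dv => ->; rewrite rnorm0 -leNgt.
exists B, (normalize (ind D B (U v))), A; split => //; split => //.
- by apply: supportedZ; exact: ind_ind.
- exact: normalize_norm.
apply: lt_le_trans dv _; have n0 := rnorm_gt0 nz; rewrite -(ler_pM2l n0).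
rewrite -(bop_normalize (bop_comp (ind C A) Us)) /=.
have := cauchy_schwarz (ind C A (Us (ind D B (U v)))) v; rewrite v1 mulr1.
have [ad _ _] := unitary_sym uni.
by rewrite ind_selfadj Av ad ind_selfadj ind_dot// cmod_real ger0_norm ?sqr_ge0.
Qed.

Section RelationControlled.
Variables (R : realType) (X Y : lfcm) (C C' : coarse_module R X).
Variables (D D' : coarse_module R Y) (U : bop C D) (U' : bop C' D').
Variables (Us : bop D C) (Us' : bop D' C').
Hypotheses (UU : Defs.is_unitary U Us) (UU' : Defs.is_unitary U' Us').
Variables (Psi : approx_op C C' -> approx_op D D').
Variables (Psi1 : approx_op C C -> approx_op D D).
Variables (Psi2 : approx_op C' C' -> approx_op D' D').
Hypotheses (Psi_tr : transport U U' Psi) (Psi_tr1 : transport U U Psi1)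
  (Psi_tr2 : transport U' U' Psi2).
Hypothesis cgY : countably_generated (@ent Y).

Lemma relation_controlled (E E1 : set (X * X)) (F1 : set (Y * Y)) (delta : R) :
  ent E -> ent E1 -> ent F1 -> 0 < delta ->
  exists2 G, ent G & forall y x y' x', approx_relation U delta F1 E1 (y, x) ->
    approx_relation U' delta F1 E1 (y', x') -> E (x', x) -> G (y', y).
Proof.
move=> EE E1E F1E d0; have [F cofF] := countably_generated_cofinal (ent_coarse Y) cgY.
have cX := ent_coarse X.
(* The composite contains the product of the sets [A'] and [A]; [E1] is added so that each of them
   stays bounded by [W]. *)
pose W := E1 `|` rcomp E1 (rcomp E E1).
have WE : ent W.
  by apply: (coarse_setU cX) => //; apply: ent_rcomp => //; exact: ent_rcomp.
have [G GE hG] := transport_controlled UU UU' Psi_tr Psi_tr1 Psi_tr2 cofF WE F1E d0.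
exists G => // y x y' x'.
have mono (C0 : coarse_module R X) (D0 : coarse_module R Y) (V : bop C0 D0) A v B :
    concentrated V E1 F1 delta A v B -> concentrated V W F1 delta A v B.
  by move=> [[mA bA] Av v1 bB dv]; split => //; split => // p /bA; left.
move=> /(approx_relationP _ _ _ _ _ (ltW d0))[A [v [B [c By Ax]]]].
move=> /(approx_relationP _ _ _ _ _ (ltW d0))[A' [v' [B' [c' By' Ax']]]] xx'.
apply: (hG A A' v v' B B') => //; [|exact: mono|exact: mono].
have [[_ bA] _ _ _ _] := c; have [[_ bA'] _ _ _ _] := c'.
move=> [a' a] [/= Aa' Aa]; right; exists x'; first exact: bA'.
by exists x => //; exact: bA.
Qed.

End RelationControlled.

(** [faithful_module] with its entourage as a parameter. *)
Definition charged (R : realType) (X : lfcm) (C : coarse_module R X) (E : set (X * X)) :=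
  forall x, exists a A, [/\ disc_meas A, A a, exists h, ind C A h != 0 & E (x, a)].

Lemma faithful_charged (R : realType) (X : lfcm) (C : coarse_module R X) :
  faithful_module C -> exists2 E, ent E & charged C E.
Proof.
move=> [_ [E EE h]]; exists E => // x.
by have [a [A [dA nz] Aa] xa] := h x I; exists a, A.
Qed.

Lemma relation_total (R : realType) (X Y : lfcm) (C : coarse_module R X)
    (D : coarse_module R Y) (U : bop C D) (Us : bop D C) (E : set (X * X)) (delta : R) :
  Defs.is_unitary U Us ->
  (forall t : bop D D, approximable t -> approximable (bop_comp Us (bop_comp t U))) ->
  countably_generated (@ent X) -> ent E -> charged C E -> 0 < delta < 1 ->
  exists2 E0, ent E0 & forall x, exists y,
    approx_relation U delta (disc_ent Y) E0 (y, x).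
Proof.
move=> uni conj cgX EE ch d01.
have [F cofF] := countably_generated_cofinal (ent_coarse X) cgX.
have [E0 E0E h] := concentration uni conj cofF EE d01.
exists E0 => // x; have [a [A [dA Aa nz xa]]] := ch x.
have [A1 [u [j [c A1x]]]] := h _ _ _ dA Aa nz xa.
have [y yj] := disc_nonempty j; have d0 : 0 <= delta by case/andP: d01 => /ltW.
by exists y; apply/(approx_relationP _ _ _ _ _ d0); exists A1, u, (disc j).
Qed.

(** The isomorphism need not be unitary, but [zeta] is at least [(M + 1)^-1] on unit vectors, with
    [M] a bound for [eta]. Quasi-locality at half of this value keeps a nonzero part of [zeta v]
    near [A]. *)
Lemma charged_iso (R : realType) (X : lfcm) (C D : coarse_module R X)
    (eta : approx_op D C) (zeta : approx_op C D) (E : set (X * X)) :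
  cancel zeta eta -> ent E -> charged C E -> exists2 E', ent E' & charged D E'.
Proof.
move=> zK EE ch; have cX := ent_coarse X; have dX := disc_ent_entourage X.
have [M M0 etaM] := bop_bounded eta.
have M1 : 0 < M + 1 by rewrite ltr_wpDl.
have zM v : rnorm v = 1 -> (M + 1)^-1 <= rnorm (zeta v).
  move=> v1; rewrite -[leLHS]mulr1 -ler_pdivlMl ?invr_gt0// invrK.
  have := etaM (zeta v); rewrite zK v1 => /le_trans; apply.
  by rewrite ler_wpM2r ?rnorm_ge0// lerDl.
have e0 : 0 < (M + 1)^-1 / 2 by rewrite divr_gt0// invr_gt0.
have [W WE ql] := quasi_local (aop_approximable zeta) e0.
exists (rcomp E (rcomp (disc_ent X) (rcomp (W^-1)%relation (disc_ent X)))).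
  by do 3!(apply: ent_rcomp => //); exact: (coarse_inv cX).
move=> x; have [a [A [[mA bA] Aa [h nz] xa]]] := ch x.
have v1 := normalize_norm nz; set v := normalize _ in v1.
have Av : supported A v by apply: supportedZ; exact: ind_ind.
pose A1 := sat (thickening W A); have mA1 : meas A1 by exact: meas_sat.
have sep : separated W (~` A1) A.
  by move=> y b nA1 Ab Wb; apply: nA1; apply: sub_sat; exists b.
have zA1 : ind D A1 (zeta v) != 0.
  apply/eqP => z0; have := ql _ _ mA (measC mA1) sep v.
  have := ind_pythagoras (zeta v) mA1; rewrite z0 rnorm0 expr0n add0r.
  move=> /eqP; rewrite eqrXn2 ?rnorm_ge0// => /eqP zE; rewrite Av -zE v1 mulr1.
  by have := zM v v1; move: e0; lra.
have [G [dG GA1 nzG]] : exists G, [/\ disc_meas G, G `<=` A1 & ind D G (zeta v) != 0].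
  apply: contrapT => no; move/eqP: zA1; apply; apply: ind_eq0 => // G dG GA1.
  by apply: contrapT => /eqP ?; apply: no; exists G.
have [b Gb] : G !=set0.
  by apply/set0P/eqP => G0; move: nzG; rewrite G0 ind_set0 eqxx.
exists b, G; split => //; first by exists (zeta v).
have [c [a' Aa' ca'] bc] := sat_thick (GA1 _ Gb).
exists a => //; exists a'; first exact: bA.
exists c => //; exact: disc_ent_sym.
Qed.

(** * Coarse maps and relations close to them *)

Section CoarseMaps.
Variables (X Y : Type) (EX : set (set (X * X))) (EY : set (set (Y * Y))).
Hypotheses (coarseX : is_coarse EX) (coarseY : is_coarse EY).

Lemma prod_entourage_coarse F E : EY F -> EX E ->
  prod_coarse EX EY (Defs.prod_entourage F E).
Proof. by move=> FE EE A [_ h]; apply: h; exists F, E. Qed.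

(** The sets contained in some product entourage already form a coarse structure, so the smallest
    one consists of such sets. *)
Lemma prod_coarse_sub Q : prod_coarse EX EY Q ->
  exists F E, [/\ EY F, EX E & Q `<=` Defs.prod_entourage F E].
Proof.
move=> /(_ [set Q | exists F E, [/\ EY F, EX E & Q `<=` Defs.prod_entourage F E]]); apply.
split; last by move=> Q' [F [E [FE EE ->]]]; exists F, E; split.
split=> [|A B AB [F [E [FE EE h]]]|A B|A [F [E [FE EE h]]]|A B].
- exists diagonal, diagonal.
  split; [exact: coarse_diag coarseY|exact: coarse_diag coarseX|].
  by move=> [[a b] [c d]] [-> ->].
- by exists F, E; split => //; exact: subset_trans h.
- move=> [F [E [FE EE h]]] [F' [E' [FE' EE' h']]].
  exists (F `|` F'), (E `|` E'); split.
  + exact: (coarse_setU coarseY).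
  + exact: (coarse_setU coarseX).
  + by move=> p [/h[? ?]|/h'[? ?]]; split; [left|left|right|right].
- exists (F^-1)%relation, (E^-1)%relation; split.
  + exact: (coarse_inv coarseY).
  + exact: (coarse_inv coarseX).
  + by move=> p /h.
- move=> [F [E [FE EE h]]] [F' [E' [FE' EE' h']]].
  exists (rcomp F' F), (rcomp E' E); split; [exact: ent_rcomp|exact: ent_rcomp|].
  by move=> p [z /h'[? ?] /h[? ?]]; split; [exists z.1|exists z.2].
Qed.

Variable f : X -> Y.
Hypothesis f_coarse : coarse_map EX EY f.

Lemma relation_close_near (R : set (Y * X)) G : EY G ->
  (forall y x, R (y, x) -> G (y, f x)) -> (forall x, exists y, R (y, x)) ->
  relation_close EX EY R f.
Proof.
move=> GE RG tot; have dX := coarse_diag coarseX; split.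
  exists (Defs.prod_entourage G diagonal); first exact: prod_entourage_coarse.
  by move=> [y x] Ryx; exists (f x, x); [exists x|split => //; exact: RG].
exists (Defs.prod_entourage (G^-1)%relation diagonal).
  by apply: prod_entourage_coarse => //; exact: (coarse_inv coarseY).
move=> _ [x _ <-]; have [y Ryx] := tot x; exists (y, x) => //; split => //=.
exact: RG.
Qed.

(** From [(f b, b)] one passes to a point of [R] and on to some [(g x', x')]. Here [x'] is near [b],
    so [g x'] is near [g a] whenever [a] is near [b]. *)
Lemma relation_close_unique (g : X -> Y) R : coarse_map EX EY g ->
  relation_close EX EY R f -> relation_close EX EY R g -> coarse_close EX EY g f.
Proof.
move=> g_coarse [_ [Q QE fR]] [[Q' QE' Rg] _].
have [F [E [FE EE QF]]] := prod_coarse_sub QE.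
have [F' [E' [FE' EE' QF']]] := prod_coarse_sub QE'.
move=> W WE.
have H := ent_rcomp coarseY (g_coarse _ (ent_rcomp coarseX WE (ent_rcomp coarseX EE EE')))
  (coarse_inv coarseY (ent_rcomp coarseY FE FE')).
apply: entS H => // _ [[a b] Wab <-].
have [[y x] Ryx /QF[/= Fy Ex]] := fR (f b, b) (ex_intro2 _ _ b I erefl).
have [_ [x' _ <-] /QF'[/= Fy' Ex']] := Rg _ Ryx.
exists (g x') => /=; last by exists y.
by exists (a, x') => //; exists b => //; exists x.
Qed.

Lemma coarse_embedding_expansive :
  (forall F, EY F -> EX [set p | F (f p.1, f p.2)]) -> coarse_embedding EX EY f.
Proof.
move=> f_exp; split.
  move=> E EE; rewrite /induced_coarse /=; apply: (entS coarseY) (f_coarse EE).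
  by move=> q [r] [[a b] Eab <-] <-; exists (a, b).
have /choice[g gP] : forall y : {y | range f y}, exists x, f x = sval y.
  by move=> [y yP] /=; have [x _ xy] := yP; exists x.
exists g; split.
- move=> E EE; apply: entS (f_exp _ EE) => // q [[a b] Ep <-] /=.
  by exists (a, b) => //=; rewrite !gP.
- move=> E EE; rewrite /induced_coarse /=; apply: (entS coarseY) EE.
  move=> q [r [[a b] Ep pr] rq]; exists (a, b) => //.
  by rewrite -rq -pr /= gP.
- move=> E EE; apply: entS (f_exp _ (f_coarse EE)) => // q [[a b] Ep <-] /=.
  by exists (a, b) => //=; rewrite gP.
Qed.

(** The inverse picks [x] with [f x] near [y]; an entourage of [Y] applied to such choices is moved
    by [W] at both ends and pulled back along [f]. *)
Lemma coarse_equivalence_surjective W :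
  (forall F, EY F -> EX [set p | F (f p.1, f p.2)]) -> EY W ->
  (forall y, exists x, W (y, f x)) -> coarse_equivalence EX EY f.
Proof.
move=> f_exp WE /choice[g gP]; split => //; have WI := coarse_inv coarseY WE.
exists g; split.
- move=> F FE.
  apply: entS (f_exp _ (ent_rcomp coarseY WI (ent_rcomp coarseY FE WE))) => //.
  by move=> _ [[y y'] Fy <-]; exists y => //; exists y'.
- move=> F FE; apply: entS (ent_rcomp coarseY WI FE) => //.
  by move=> _ [[y y'] Fy <-]; exists y.
- move=> E EE; apply: entS (f_exp _ (ent_rcomp coarseY WI (f_coarse EE))) => //.
  by move=> _ [[x x'] Ex <-]; exists (f x) => //=; exists (x, x').
Qed.

End CoarseMaps.

(** * The coarse map of the functor *)

Section Main.
Variables (R : realType) (k : rank_bound) (X Y : lfcm).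
Hypotheses (cgX : countably_generated (@ent X)) (cgY : countably_generated (@ent Y)).
Variable Phi : star_functor R k X Y.
Hypothesis ff : fully_faithful Phi.

(** With [C' = C] this makes a selection from the relation coarse; with [E] the diagonal it compares
    different modules and parameters, so that the map depends on neither. *)
Lemma functor_relation_controlled (C C' : amodule R k X)
    (U : bop C (Pmod Phi C)) (Us : bop (Pmod Phi C) C)
    (U' : bop C' (Pmod Phi C')) (Us' : bop (Pmod Phi C') C')
    (delta delta' : R) (E E1 E1' : set (X * X)) (F1 F1' : set (Y * Y)) :
  implements U Us -> implements U' Us' -> ent E -> ent E1 -> ent E1' ->
  ent F1 -> ent F1' -> 0 < delta -> 0 < delta' ->
  exists2 G, ent G & forall y x y' x', approx_relation U delta F1 E1 (y, x) ->
    approx_relation U' delta' F1' E1' (y', x') -> E (x', x) -> G (y', y).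
Proof.
move=> UU UU' EE E1E E1E' F1E F1E' d0 d0'.
have uni : Defs.is_unitary U Us by case: UU.
have uni' : Defs.is_unitary U' Us' by case: UU'.
have m0 : 0 < Num.min delta delta' by rewrite lt_min d0.
have [G GE h] := relation_controlled uni uni' (functor_transport UU UU')
  (functor_transport UU UU) (functor_transport UU' UU') cgY EE
  (coarse_setU (ent_coarse X) E1E E1E') (coarse_setU (ent_coarse Y) F1E F1E') m0.
exists G => // y x y' x' r r' xx'; apply: h xx'.
  apply: approx_relation_mono r; [by rewrite ge_min lexx|by left|by left].
apply: approx_relation_mono r'; [by rewrite ge_min lexx orbT|by right|by right].
Qed.

Lemma inverse_relation_controlled (C : amodule R k X)
    (U : bop C (Pmod Phi C)) (Us : bop (Pmod Phi C) C)
    (delta : R) (E1 : set (X * X)) (F F1 : set (Y * Y)) :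
  implements U Us -> ent F -> ent E1 -> ent F1 -> 0 < delta ->
  exists2 G, ent G & forall y x y' x', approx_relation U delta F1 E1 (y, x) ->
    approx_relation U delta F1 E1 (y', x') -> F (y', y) -> G (x', x).
Proof.
move=> UU FE E1E F1E d0; have uni : Defs.is_unitary U Us by case: UU.
have tr := inverse_transport ff UU.
have [G GE h] := relation_controlled (unitary_sym uni) (unitary_sym uni) tr tr tr
  cgX FE F1E E1E d0.
exists G => // y x y' x' r r'; apply: h.
  exact: approx_relation_flip uni (ltW d0) r.
exact: approx_relation_flip uni (ltW d0) r'.
Qed.

(** A quasi-inverse writes the faithful [D] as the image of [C = G D] up to isomorphism, so this
    image is charged, and totality for [Us] in place of [U] relates every [y] to some [x]. *)
Lemma equivalence_coarsely_surjective (D : amodule R k Y) : is_equivalence Phi ->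
  faithful_module D ->
  exists (C : amodule R k X) (U : bop C (Pmod Phi C)) (Us : bop (Pmod Phi C) C) F,
    [/\ implements U Us, ent F & forall y, exists x,
      approx_relation U (1 / 2 : R) F (disc_ent X) (y, x)].
Proof.
move=> [G [_ [eta [iso _]]]] fD.
pose C : amodule R k X := G D; have [U [Us UU]] := exists_implements ff C.
have [zeta [ez _]] := iso D.
pose eta' : approx_op (Pmod Phi C) D := eta D.
pose zeta' : approx_op D (Pmod Phi C) := zeta.
have zK : cancel zeta' eta'.
  move=> x; exact: (congr1 (fun t : approx_op D D => t x) ez).
have [E EE ch] := faithful_charged fD.
have [E' EE' ch'] := charged_iso zK EE ch.
have uni : Defs.is_unitary U Us by case: UU.
have conj (t : bop C C) : approximable t -> approximable (bop_comp U (bop_comp t Us)).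
  move=> at_; apply: approximable_eq (aop_approximable (Pmap Phi (ApproxOp at_))) => y.
  by rewrite (implementsE UU).
have d01 : 0 < (1 / 2 : R) < 1 by apply/andP; split; lra.
have [F FE tot] := relation_total (unitary_sym uni) conj cgY EE' ch' d01.
exists C, U, Us, F; split => // y; have [x r] := tot y; exists x.
apply: approx_relation_flip (unitary_sym uni) _ r; lra.
Qed.

End Main.

Theorem theorem3p2 (R : realType) (k : rank_bound) (X Y : lfcm)
    (hX : countably_generated (@ent X)) (hY : countably_generated (@ent Y))
    (Phi : star_functor R k X Y) (hPhi : fully_faithful Phi)
    (fX : exists C : amodule R k X, faithful_module C)
    (fY : exists D : amodule R k Y, faithful_module D) :
  exists f : X -> Y,
    [/\ coarse_embedding (@ent X) (@ent Y) f,
        approximated Phi f,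
        (forall g : X -> Y, coarse_embedding (@ent X) (@ent Y) g ->
           approximated Phi g -> coarse_close (@ent X) (@ent Y) g f)
      & is_equivalence Phi -> coarse_equivalence (@ent X) (@ent Y) f].
Proof.
have cX := ent_coarse X; have cY := ent_coarse Y.
have dX := disc_ent_entourage X; have dY := disc_ent_entourage Y.
have [C faithC] := fX; have [E EE chC] := faithful_charged faithC.
have [U [Us UU]] := exists_implements hPhi C.
have d01 : 0 < (1 / 2 : R) < 1 by apply/andP; split; lra.
have d0 : 0 < (1 / 2 : R) by lra.
have uni : Defs.is_unitary U Us by case: UU.
(* The value 1/2 and the selection are arbitrary: the relation is controlled in both directions. *)
have [E0 E0E /choice[f fP]] := relation_total uni
  (implements_conj_approx hPhi UU) hX EE chC d01.
have f_coarse : coarse_map (@ent X) (@ent Y) f.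
  move=> W WE; have [G GE h] :=
    functor_relation_controlled hY UU UU WE E0E E0E dY dY d0 d0.
  by apply: (entS cY) GE => _ [[a b] Wp <-]; exact: h (fP _) (fP _) Wp.
have f_exp F : ent F -> ent [set p | F (f p.1, f p.2)].
  move=> FE; have [G GE h] := inverse_relation_controlled hX hPhi UU FE E0E dY d0.
  by apply: (entS cX) GE => -[a b] Fab; exact: h (fP _) (fP _) Fab.
have f_emb := coarse_embedding_expansive cX cY f_coarse f_exp.
have f_app : approximated Phi f.
  move=> C' faithC' U' Us' UU' delta dd; have d0' : 0 < delta by case/andP: dd.
  have uni' : Defs.is_unitary U' Us' by case: UU'.
  have [E' EE' chC'] := faithful_charged faithC'.
  have [E1 E1E tot] := relation_total uni'
    (implements_conj_approx hPhi UU') hX EE' chC' dd.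
  (* At these thresholds the relation is total, and by monotonicity it stays so above them. *)
  exists (disc_ent Y), E1; split => // F E2 FE E2E YF E12.
  have [G GE h] := functor_relation_controlled hY UU UU' (coarse_diag cX)
    E0E E2E dY FE d0 d0'.
  apply: (relation_close_near cX cY GE) => [y x r|x]; first exact: h (fP x) r _.
  by have [y r] := tot x; exists y; exact: approx_relation_mono r.
exists f; split => //.
- move=> g g_emb g_app.
  have [F1 [E1 [F1E E1E h1]]] := f_app C faithC U Us UU _ d01.
  have [F2 [E2 [F2E E2E h2]]] := g_app C faithC U Us UU _ d01.
  (* Parameters above both thresholds, so that [f] and [g] are close to the same relation. *)
  have FE := coarse_setU cY F1E F2E; have EE12 := coarse_setU cX E1E E2E.
  have g_coarse : coarse_map (@ent X) (@ent Y) g.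
    move=> W WE; have [gW _] := g_emb; apply: (entS cY) (gW _ WE).
    move=> _ [[a b] Wab <-]; exists (corestrict g a, corestrict g b) => //.
    by exists (a, b).
  apply: (relation_close_unique (R := approx_relation U (1 / 2) (F1 `|` F2) (E1 `|` E2))
    cX cY g_coarse).
    by apply: h1 FE EE12 _ _; left.
  by apply: h2 FE EE12 _ _; right.
- move=> eqPhi; have [D faithD] := fY.
  have [C1 [U1 [Us1 [F [UU1 FE tot]]]]] :=
    equivalence_coarsely_surjective hY hPhi eqPhi faithD.
  have [G GE h] :=
    functor_relation_controlled hY UU UU1 (coarse_diag cX) E0E dX dY FE d0 d0.
  apply: (coarse_equivalence_surjective cX cY f_coarse f_exp GE) => y.
  by have [x r] := tot y; exists x; exact: h (fP x) r _.
Qed.
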